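(* For every complex $k$ with $\Re(k)>0$, $$\eta(k)=\frac{(i\pi)^{k}}{2\,\Gamma(k+1)}+\frac{(i\pi)^{k-1}\left(1+\log(-i\pi)\right)}{\Gamma(k)}+\frac{(i\pi)^{k}}{2\,\Gamma(k)}\int_{0}^{1}\left[-i(1-u)^{k-1}\cot\frac{\pi u}{2}+\frac{2\left(1-\pi^{-k}\left(\pi+i\log(1-u)\right)^k\right)}{k\,u^2}\right]du ,$$ and the analytic continuation of the Riemann zeta function to $\Re(k)>0$ is given by $$\zeta(k)=\frac{\eta(k)}{1-2^{1-k}}$$ for all $k$ with $\Re(k)>0$ and $2^{1-k}\neq 1$.
   Context: $\eta$ denotes the Dirichlet eta function, $\eta(k)=\sum_{j=1}^{\infty}\frac{(-1)^{j+1}}{j^{k}}$ for $\Re(k)>0$ (equivalently $\eta(k)=-\mathrm{Li}_k(-1)$, where $\mathrm{Li}_k$ is the polylogarithm). $\zeta(k)=\sum_{j\ge1}j^{-k}$ for $\Re(k)>1$. $i$ is the imaginary unit, $\Gamma$ is the gamma function, and logarithms and complex powers take their principal values, with $w^k=\exp(k\log w)$; in particular $\log(-i\pi)=\log\pi-i\pi/2$ and $(i\pi)^k=\exp\left(k(\log\pi+i\pi/2)\right)$. *)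

(* Defs.v *)
From Stdlib Require Import Reals.
From Coquelicot Require Import Coquelicot.
Open Scope R_scope.
Open Scope C_scope.

Definition Cexp (z : C) : C :=
  RtoC (exp (Re z)) * (cos (Im z), sin (Im z)).

(** Principal argument, in (-PI, PI].  The value at [0] is irrelevant. *)
Definition Carg (z : C) : R :=
  if Rlt_dec (Im z) 0 then (- acos (Re z / Cmod z))%R
  else acos (Re z / Cmod z).

Definition Clog (z : C) : C := (ln (Cmod z), Carg z).

(** Principal complex power; it is only meaningful for [w <> 0].
    Coquelicot's [Cpow], written [^], has natural number exponents only. *)
Definition Cpower (w k : C) : C := Cexp (k * Clog w).

(** Euler's integral, an improper Riemann integral that converges for
    [0 < Re z]. *)
Definition CGamma (z : C) : C :=
  RInt_gen (V := C_R_CompleteNormedModule)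
    (fun t : R => Cpower (RtoC t) (z - 1) * RtoC (exp (- t)))
    (at_right 0) (Rbar_locally p_infty).

(** The index is shifted, [j = S n], so the sign [(-1)^(j+1)] is [(-1)^n]. *)
Definition eta_term (k : C) (n : nat) : C :=
  RtoC ((-1) ^ n) / Cpower (RtoC (INR (S n))) k.

(** The sum of the series, as the limit of its partial sums: the series is
    only conditionally convergent when [Re k <= 1]. *)
Definition eta (k : C) : C :=
  iota (T := C_CompleteNormedModule)
    (is_series (V := C_NormedModule) (eta_term k)).

Definition zeta_term (k : C) (n : nat) : C :=
  1 / Cpower (RtoC (INR (S n))) k.

Definition eta_integrand (k : C) (u : R) : C :=
  - Ci * Cpower (RtoC (1 - u)) (k - 1)
       * RtoC (cos (PI * u / 2) / sin (PI * u / 2))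
  + 2 * (1 - Cpower (RtoC PI) (- k)
             * Cpower (RtoC PI + Ci * RtoC (ln (1 - u))) k)
    / (k * RtoC (u ^ 2)).

(** [f] is the sum of a power series on a neighbourhood of [w]. *)
Definition analytic_at (f : C -> C) (w : C) : Prop :=
  exists a : nat -> C,
    locally (T := C_UniformSpace) w (fun z : C =>
      is_pseries (K := C_AbsRing) (V := C_NormedModule) a (z - w) (f z)).

(** [Z] continues [zeta] from [1 < Re k] to [0 < Re k].  The point [1], where
    [zeta] has a pole, is removed; the values of [Z] at [1] and outside the
    half-plane are unconstrained. *)
Definition is_zeta_continuation (Z : C -> C) : Prop :=
  (forall k : C, (0 < Re k)%R -> k <> 1 -> analytic_at Z k) /\
  (forall k : C, (1 < Re k)%R ->
     is_series (V := C_NormedModule) (zeta_term k) (Z k)).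

(* Main.v *)
Require Import Defs.
From Stdlib Require Import Reals Lra Lia Psatz Factorial.
From Corelib Require Import ssreflect.
From Coquelicot Require Import Coquelicot.

(** Write [E t = e^t / (e^t + 1)^2] and [s = Re k].  Integrating the expansion
    of [E] in powers of [e^(-t)] term by term against [t^k] gives
    [Gamma(k+1) eta(k)], and the error after [N] terms is of order [N^(-s)]
    ([eta_series]).  Dividing is legitimate because Gamma has no zero: for [Re k]
    large the mass of its integral concentrates near [t = Re k - 1], and the
    functional equation brings the conclusion back to [0 < Re k]
    ([CGamma_neq_0]).

    The path of integration is then moved from the positive axis to the segment
    from [0] to [i pi] followed by the half-line [i pi + [0, oo)].  The double
    pole of [E] at the corner [i pi] would make this diverge, so the Taylor
    polynomial of degree one of [t^k] at [i pi] is first subtracted; its own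
    integral is elementary and contributes [1/2] and [ln 2].  The resulting [G]
    is holomorphic in the open strip and continuous on the closed half-strip
    ([G_cont]), so that Cauchy's theorem holds up to the edges ([rectangle],
    [contour]).

    On the segment put [t = i pi (1 - u)]: then [E] is [1 / (4 sin^2 (pi u / 2))],
    and an integration by parts produces the cotangent.  On the half-line put
    [t = i pi - ln (1 - u)]: then [E dt] is [- du / u^2].  What the
    subtracted polynomial leaves on the two pieces, [i cot (pi u / 2)] and
    [2 i ln (1 - u) / (pi u^2)] up to a common factor, diverges on each of them
    but has together the elementary primitive [i jfun], whose limit at [0]
    supplies [1 + ln (pi / 2)]
    ([eta_primitive_derive], [eta_integral]).  All integrals are handled through
    primitives with limits at the ends.

    For zeta, the sum over [n] of [n^(-k)] minus the integral of [x^(-k)] from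
    [n] to [n + 1] converges absolutely for [0 < Re k].  Expanding [x^(-k)] at
    [w] in powers of [k - w], the remainder after [M] terms is bounded by
    [2^(-M)] times a telescoping series, which shows that the sum is analytic
    ([zeta_reg_taylor]); adding [1 / (k - 1)] gives a continuation [zeta0].
    Comparing partial sums gives [eta = (1 - 2^(1-k)) zeta0] ([eta_zeta0]), and
    the identity theorem along a segment that avoids the pole shows that every
    continuation agrees with [zeta0] ([continuation_unique]). *)

Local Open Scope C_scope.
Local Open Scope R_scope.
Set Bullet Behavior "Strict Subproofs".

(** * Limits and derivatives of complex-valued functions *)

Notation Csum := (sum_n (G := C_AbelianMonoid)) (only parsing).
Notation is_Cseries := (is_series (V := C_NormedModule)) (only parsing).
Notation Clocally := (locally (T := C_UniformSpace)) (only parsing).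

Notation at_oo := (Rbar_locally p_infty) (only parsing).
Notation ex_derive_cont := (ex_derive_continuous (V := R_NormedModule)) (only parsing).
Notation cot_half u := (cos (PI * u / 2) / sin (PI * u / 2)) (only parsing).

Ltac ball_simpl := unfold ball; simpl; unfold AbsRing_ball, abs, minus, plus, opp; simpl.
Ltac ball_simpl_all :=
  unfold ball in *; simpl in *; unfold AbsRing_ball, abs, minus, plus, opp in *; simpl in *.

(** Componentwise, so that the real limit lemmas apply; [Clim_spec] is the
    equivalent form with the modulus. *)
Definition Clim {T : Type} (F : (T -> Prop) -> Prop) (f : T -> C) (l : C) : Prop :=
  filterlim (fun t => Re (f t)) F (locally (Re l)) /\
  filterlim (fun t => Im (f t)) F (locally (Im l)).

(** Derivative along a real parameter.  Complex functions are differentiated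
    only along paths: each of them gets a chain rule, and no complex derivative
    is needed. *)
Definition is_Cderive (g : R -> C) (x : R) (l : C) : Prop :=
  is_derive (fun t => Re (g t)) x (Re l) /\
  is_derive (fun t => Im (g t)) x (Im l).

Lemma Clim_spec {T} (F : (T -> Prop) -> Prop) {FF : Filter F} (f : T -> C) (l : C) :
  Clim F f l <-> filterlim (fun t => Cmod (f t - l)) F (locally 0).
Proof.
split.
- intros [H1 H2].
  apply filterlim_locally. intros eps.
  assert (he : 0 < eps / 2) by (destruct eps; simpl; lra).
  pose proof (proj1 (filterlim_locally _ _) H1 (mkposreal _ he)) as A.
  pose proof (proj1 (filterlim_locally _ _) H2 (mkposreal _ he)) as B.
  apply: filter_imp (filter_and _ _ A B).
  intros t [a b].
  ball_simpl_all.
  rewrite Ropp_0 Rplus_0_r Rabs_pos_eq; last by apply Cmod_ge_0.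
  apply Rle_lt_trans with (Rabs (Re (f t) + - Re l) + Rabs (Im (f t) + - Im l)); last lra.
  replace (f t - l)%C with ((Re (f t) + - Re l)%R + Ci * (Im (f t) + - Im l)%R)%C.
  2: { destruct (f t) as [a1 a2], l as [b1 b2]; apply injective_projections; simpl; ring. }
  eapply Rle_trans; first apply Cmod_triangle.
  rewrite Cmod_mult Cmod_Ci !Cmod_R. lra.
- intros H. split; apply filterlim_locally; intros eps;
  pose proof (proj1 (filterlim_locally _ _) H eps) as A;
  apply: filter_imp A; intros t;
  unfold ball; simpl; unfold AbsRing_ball, abs, minus, plus, opp; simpl;
  rewrite Ropp_0 Rplus_0_r (Rabs_pos_eq (Cmod _)); try apply Cmod_ge_0; intros A;
  (eapply Rle_lt_trans; last exact A);
  (eapply Rle_trans; last apply Rmax_Cmod);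
  destruct (f t) as [a1 a2], l as [b1 b2]; simpl.
  + apply Rmax_l.
  + apply Rmax_r.
Qed.

Lemma Clim_squeeze {T} (F : (T -> Prop) -> Prop) {FF : Filter F} (f : T -> C) (l : C)
  (g : T -> R) :
  F (fun t => Cmod (f t - l) <= g t) -> filterlim g F (locally 0) -> Clim F f l.
Proof.
intros H1 H2. apply Clim_spec; first exact FF.
apply (filterlim_le_le (fun _ => 0) _ g (Finite 0)); last exact H2.
- apply: filter_imp H1; intros t Ht; split; [apply Cmod_ge_0 | exact Ht].
- apply filterlim_const.
Qed.

Lemma Clim_ext_loc {T} (F : (T -> Prop) -> Prop) {FF : Filter F} (f g : T -> C) (l : C) :
  F (fun t => f t = g t) -> Clim F f l -> Clim F g l.
Proof.
intros E [H1 H2]. split.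
- apply: filterlim_ext_loc H1. apply: filter_imp E. intros t ->. reflexivity.
- apply: filterlim_ext_loc H2. apply: filter_imp E. intros t ->. reflexivity.
Qed.

Lemma Clim_comp {T U : Type} (F : (T -> Prop) -> Prop) (G : (U -> Prop) -> Prop)
  (f : T -> U) (g : U -> C) (l : C) :
  filterlim f F G -> Clim G g l -> Clim F (fun t => g (f t)) l.
Proof.
intros H [H1 H2]. split.
- exact (filterlim_comp _ _ _ _ _ _ _ _ H H1).
- exact (filterlim_comp _ _ _ _ _ _ _ _ H H2).
Qed.

Lemma Clim_const {T} (F : (T -> Prop) -> Prop) {FF : Filter F} (c : C) :
  Clim F (fun _ => c) c.
Proof. split; apply filterlim_const. Qed.

Lemma Clim_RtoC {T} (F : (T -> Prop) -> Prop) {FF : Filter F} (f : T -> R) (l : R) :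
  filterlim f F (locally l) -> Clim F (fun t => RtoC (f t)) (RtoC l).
Proof. intros H. split; simpl; [exact H | apply filterlim_const]. Qed.

Lemma Rlim_plus {T} (F : (T -> Prop) -> Prop) {FF : Filter F} (f g : T -> R) (a b : R) :
  filterlim f F (locally a) -> filterlim g F (locally b) ->
  filterlim (fun t => f t + g t) F (locally (a + b)).
Proof.
intros H1 H2. eapply (filterlim_comp_2 (F := F)); [exact H1 | exact H2 | ].
exact (filterlim_plus (V := R_NormedModule) a b).
Qed.

Lemma Rlim_mult {T} (F : (T -> Prop) -> Prop) {FF : Filter F} (f g : T -> R) (a b : R) :
  filterlim f F (locally a) -> filterlim g F (locally b) ->
  filterlim (fun t => f t * g t) F (locally (a * b)).
Proof.
intros H1 H2. eapply (filterlim_comp_2 (F := F)); [exact H1 | exact H2 | ].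
exact (filterlim_mult (K := R_AbsRing) a b).
Qed.

Lemma Rlim_opp {T} (F : (T -> Prop) -> Prop) {FF : Filter F} (f : T -> R) (a : R) :
  filterlim f F (locally a) -> filterlim (fun t => - f t) F (locally (- a)).
Proof.
intros H. eapply filterlim_comp; [exact H|].
exact (filterlim_opp (V := R_NormedModule) a).
Qed.

Lemma Rlim_cont {T} (F : (T -> Prop) -> Prop) {FF : Filter F} (f : T -> R) (h : R -> R) (a : R) :
  filterlim f F (locally a) -> continuous h a -> filterlim (fun t => h (f t)) F (locally (h a)).
Proof. intros H1 H2. eapply filterlim_comp; [exact H1|exact H2]. Qed.

Lemma Clim_plus {T} (F : (T -> Prop) -> Prop) {FF : Filter F} (f g : T -> C) (a b : C) :
  Clim F f a -> Clim F g b -> Clim F (fun t => f t + g t)%C (a + b)%C.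
Proof. intros [A B] [A' B']. split; simpl; by apply: Rlim_plus. Qed.

Lemma Clim_opp {T} (F : (T -> Prop) -> Prop) {FF : Filter F} (f : T -> C) (a : C) :
  Clim F f a -> Clim F (fun t => - f t)%C (- a)%C.
Proof. intros [A B]. split; simpl; by apply: Rlim_opp. Qed.

Lemma Clim_minus {T} (F : (T -> Prop) -> Prop) {FF : Filter F} (f g : T -> C) (a b : C) :
  Clim F f a -> Clim F g b -> Clim F (fun t => f t - g t)%C (a - b)%C.
Proof. intros. apply: Clim_plus => //. by apply: Clim_opp. Qed.

Lemma Clim_mult {T} (F : (T -> Prop) -> Prop) {FF : Filter F} (f g : T -> C) (a b : C) :
  Clim F f a -> Clim F g b -> Clim F (fun t => f t * g t)%C (a * b)%C.
Proof.
intros [A B] [A' B']. split; simpl; apply: Rlim_plus; try apply: Rlim_opp; by apply: Rlim_mult.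
Qed.

Lemma Clim_inv {T} (F : (T -> Prop) -> Prop) {FF : Filter F} (f : T -> C) (a : C) :
  a <> 0 -> Clim F f a -> Clim F (fun t => / f t)%C (/ a)%C.
Proof.
intros Ha [A B].
assert (Hm : fst a ^ 2 + snd a ^ 2 <> 0).
{ intros H. apply Ha. apply injective_projections; simpl; nra. }
assert (K : filterlim (fun t => / (Re (f t) ^ 2 + Im (f t) ^ 2)) F (locally (/ (Re a ^ 2 + Im a ^ 2)))).
{ apply: (Rlim_cont F (fun t => Re (f t) ^ 2 + Im (f t) ^ 2) Rinv).
  - simpl. apply: Rlim_plus; repeat apply: Rlim_mult => //; apply: filterlim_const.
  - apply: (ex_derive_cont). auto_derive. exact Hm. }
split; simpl; apply: Rlim_mult => //; apply: Rlim_opp => //.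
Qed.

Lemma Clim_div {T} (F : (T -> Prop) -> Prop) {FF : Filter F} (f g : T -> C) (a b : C) :
  b <> 0 -> Clim F f a -> Clim F g b -> Clim F (fun t => f t / g t)%C (a / b)%C.
Proof. intros. apply: Clim_mult => //. by apply: Clim_inv. Qed.

Lemma Clim_unique {T : Type} (F : (T -> Prop) -> Prop) {FF : ProperFilter' F} (f : T -> C) (a b : C) :
  Clim F f a -> Clim F f b -> a = b.
Proof.
intros [A B] [A' B'].
apply injective_projections.
- exact (filterlim_locally_unique (V := R_NormedModule) _ _ _ A A').
- exact (filterlim_locally_unique (V := R_NormedModule) _ _ _ B B').
Qed.

Lemma Clim_Cmod {T} (F : (T -> Prop) -> Prop) {FF : Filter F} (f : T -> C) (a : C) :
  Clim F f a -> filterlim (fun t => Cmod (f t)) F (locally (Cmod a)).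
Proof.
intros [A B]. unfold Cmod.
apply: (Rlim_cont F (fun t => Re (f t) ^ 2 + Im (f t) ^ 2) sqrt).
- simpl. apply: Rlim_plus; repeat apply: Rlim_mult => //; apply: filterlim_const.
- apply continuity_pt_filterlim, continuity_pt_sqrt. nra.
Qed.

Lemma Clim_Cexp {T} (F : (T -> Prop) -> Prop) {FF : Filter F} (f : T -> C) (a : C) :
  Clim F f a -> Clim F (fun t => Cexp (f t)) (Cexp a).
Proof.
intros [A B]. unfold Cexp. apply: Clim_mult.
- apply: Clim_RtoC. apply: (Rlim_cont F _ exp) => //. apply: (ex_derive_cont). by auto_derive.
- split; simpl.
  + apply: (Rlim_cont F _ cos) => //. apply: (ex_derive_cont). by auto_derive.
  + apply: (Rlim_cont F _ sin) => //. apply: (ex_derive_cont). by auto_derive.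
Qed.

Lemma is_Cderive_Clim (g : R -> C) (x : R) (l : C) :
  is_Cderive g x l -> Clim (locally x) g (g x).
Proof.
intros [A B]. split; apply: ex_derive_continuous; eexists; eassumption.
Qed.

Lemma is_Cderive_ext_loc (f g : R -> C) (x : R) (l : C) :
  locally x (fun t => f t = g t) -> is_Cderive f x l -> is_Cderive g x l.
Proof.
intros E [A B]. split; [apply: is_derive_ext_loc A | apply: is_derive_ext_loc B];
apply: filter_imp E; by intros t ->.
Qed.

Lemma is_Cderive_eq (f : R -> C) (x : R) (l l' : C) : is_Cderive f x l -> l = l' -> is_Cderive f x l'.
Proof. by intros H <-. Qed.

Lemma is_Cderive_const (c : C) (x : R) : is_Cderive (fun _ => c) x 0.
Proof. split; apply: is_derive_const. Qed.

Lemma is_Cderive_RtoC (f : R -> R) (x l : R) :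
  is_derive f x l -> is_Cderive (fun t => RtoC (f t)) x (RtoC l).
Proof. intros H. split; simpl; [exact H | apply: is_derive_const]. Qed.

Lemma is_Cderive_plus (f g : R -> C) (x : R) (a b : C) :
  is_Cderive f x a -> is_Cderive g x b -> is_Cderive (fun t => f t + g t)%C x (a + b)%C.
Proof. intros [A B] [A' B']. split; simpl; by apply: is_derive_plus. Qed.

Lemma is_Cderive_opp (f : R -> C) (x : R) (a : C) :
  is_Cderive f x a -> is_Cderive (fun t => - f t)%C x (- a)%C.
Proof. intros [A B]. split; simpl; by apply: is_derive_opp. Qed.

Lemma is_Cderive_minus (f g : R -> C) (x : R) (a b : C) :
  is_Cderive f x a -> is_Cderive g x b -> is_Cderive (fun t => f t - g t)%C x (a - b)%C.
Proof. intros. apply: is_Cderive_plus => //. by apply: is_Cderive_opp. Qed.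

Ltac have_derives :=
  repeat match goal with
  | H : is_derive ?f ?x ?l |- _ =>
      lazymatch goal with
      | _ : Derive f x = l |- _ => fail
      | _ => pose proof (is_derive_unique f x l H);
             assert (ex_derive f x) by (exists l; exact H)
      end
  end.


Lemma is_Cderive_mult (f g : R -> C) (x : R) (a b : C) :
  is_Cderive f x a -> is_Cderive g x b ->
  is_Cderive (fun t => f t * g t)%C x (a * g x + f x * b)%C.
Proof.
intros [A B] [A' B'].
set (p := fun t => Re (f t)) in A. set (q := fun t => Im (f t)) in B.
set (r := fun t => Re (g t)) in A'. set (s := fun t => Im (g t)) in B'.
have_derives.
split; [change (is_derive (fun t => p t * r t - q t * s t) x (Re (a * g x + f x * b)%C))
  | change (is_derive (fun t => p t * s t + q t * r t) x (Im (a * g x + f x * b)%C))];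
(auto_derive; [repeat split; assumption|]);
rewrite H H1 H3 H5; unfold p, q, r, s, Re, Im; simpl; ring.
Qed.

Lemma is_Cderive_inv (f : R -> C) (x : R) (a : C) :
  f x <> 0 -> is_Cderive f x a -> is_Cderive (fun t => / f t)%C x (- a / (f x * f x))%C.
Proof.
intros Hf [A B].
assert (Hm : fst (f x) ^ 2 + snd (f x) ^ 2 <> 0).
{ intros H. apply Hf. apply injective_projections; simpl; nra. }
set (p := fun t => Re (f t)) in A. set (q := fun t => Im (f t)) in B.
have_derives.
split; [change (is_derive (fun t => p t / (p t ^ 2 + q t ^ 2)) x (Re (- a / (f x * f x))%C))
  | change (is_derive (fun t => - q t / (p t ^ 2 + q t ^ 2)) x (Im (- a / (f x * f x))%C))];
(auto_derive; [repeat split; assumption|]);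
rewrite H H1; unfold p, q, Re, Im; simpl; clear H H1;
destruct (f x) as [u v]; simpl in *; field; nra.
Qed.

Lemma is_Cderive_div (f g : R -> C) (x : R) (a b : C) :
  g x <> 0 -> is_Cderive f x a -> is_Cderive g x b ->
  is_Cderive (fun t => f t / g t)%C x ((a * g x - f x * b) / (g x * g x))%C.
Proof.
intros Hg A B. eapply is_Cderive_eq.
- apply: is_Cderive_mult; [exact A | apply: is_Cderive_inv; [exact Hg|exact B]].
- simpl. field. exact Hg.
Qed.

Lemma is_Cderive_Cexp (f : R -> C) (x : R) (a : C) :
  is_Cderive f x a -> is_Cderive (fun t => Cexp (f t)) x (a * Cexp (f x))%C.
Proof.
intros [A B].
set (p := fun t => Re (f t)) in A. set (q := fun t => Im (f t)) in B.
have_derives.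
split; [change (is_derive (fun t => exp (p t) * cos (q t) - 0 * sin (q t)) x (Re (a * Cexp (f x))%C))
  | change (is_derive (fun t => exp (p t) * sin (q t) + 0 * cos (q t)) x (Im (a * Cexp (f x))%C))];
(auto_derive; [repeat split; assumption|]);
rewrite H H1; unfold p, q, Re, Im; simpl; unfold Re, Im; ring.
Qed.

(** * Complex exponential, logarithm and powers *)

Lemma Cexp_plus (a b : C) : Cexp (a + b)%C = (Cexp a * Cexp b)%C.
Proof.
unfold Cexp, Re, Im. destruct a as [x y], b as [u v]. simpl.
rewrite exp_plus cos_plus sin_plus. apply injective_projections; simpl; ring.
Qed.

Lemma Cexp_0 : Cexp 0 = 1.
Proof. unfold Cexp; simpl. rewrite exp_0 cos_0 sin_0. apply injective_projections; simpl; ring. Qed.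

Lemma Cmod_Cexp (a : C) : Cmod (Cexp a) = exp (Re a).
Proof.
unfold Cexp. rewrite Cmod_mult Cmod_R Rabs_pos_eq; last by left; apply exp_pos.
replace (Cmod _) with 1; first by ring.
unfold Cmod; simpl. rewrite -[LHS]sqrt_1. f_equal.
generalize (sin2_cos2 (Im a)). unfold Rsqr. lra.
Qed.

Lemma Cexp_neq_0 (a : C) : Cexp a <> 0.
Proof. intros H. apply Cmod_gt_0 in H => //. rewrite Cmod_Cexp. apply exp_pos. Qed.

Lemma Cexp_opp (a : C) : Cexp (- a)%C = (/ Cexp a)%C.
Proof.
assert (H : (Cexp (- a) * Cexp a = 1)%C).
{ rewrite -Cexp_plus. replace (- a + a)%C with (RtoC 0) by ring. apply Cexp_0. }
pose proof (Cexp_neq_0 a). rewrite -[LHS]Cmult_1_r -(Cinv_r (Cexp a)) // Cmult_assoc H. ring.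
Qed.

Lemma Cexp_minus (a b : C) : Cexp (a - b)%C = (Cexp a / Cexp b)%C.
Proof. unfold Cminus. by rewrite Cexp_plus Cexp_opp. Qed.

Lemma Cexp_R (x : R) : Cexp (RtoC x) = RtoC (exp x).
Proof. unfold Cexp; simpl. rewrite cos_0 sin_0. apply injective_projections; simpl; ring. Qed.

(** Polar coordinates characterise the argument.  The arc cosine that defines
    it is not differentiable at the value [1], hence on the positive axis. *)
Lemma Carg_polar (r a : R) : 0 < r -> - PI < a <= PI -> Carg (r * cos a, r * sin a) = a.
Proof.
intros Hr Ha.
assert (Hm : Cmod (r * cos a, r * sin a) = r).
{ unfold Cmod; simpl.
  replace (_ + _) with (Rsqr r * (Rsqr (sin a) + Rsqr (cos a))) by (unfold Rsqr; ring).
  rewrite sin2_cos2 Rmult_1_r sqrt_Rsqr; lra. }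
unfold Carg. rewrite Hm. simpl.
replace (r * cos a / r) with (cos a) by (field; lra).
destruct (Rlt_dec (r * sin a) 0) as [H|H].
- assert (a < 0).
  { apply Rnot_le_lt. intros Hp. pose proof (sin_ge_0 a Hp (proj2 Ha)). nra. }
  rewrite -cos_neg acos_cos; lra.
- assert (0 <= a).
  { apply Rnot_lt_le. intros Hp. pose proof (sin_lt_0_var a (proj1 Ha) Hp). nra. }
  apply acos_cos; lra.
Qed.

Lemma Carg_bounds (z : C) : - PI <= Carg z <= PI.
Proof.
unfold Carg. pose proof (acos_bound (Re z / Cmod z)). pose proof PI_RGT_0.
destruct Rlt_dec; lra.
Qed.

Lemma Clog_Cexp (w : C) : - PI < Im w <= PI -> Clog (Cexp w) = w.
Proof.
intros H. unfold Clog. rewrite Cmod_Cexp ln_exp.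
replace (Cexp w) with ((exp (Re w) * cos (Im w), exp (Re w) * sin (Im w)) : C).
- rewrite Carg_polar //. + by destruct w. + apply exp_pos.
- unfold Cexp. apply injective_projections; simpl; ring.
Qed.

Lemma Cmod_sqr (z : C) : Cmod z * Cmod z = Re z * Re z + Im z * Im z.
Proof. pose proof (Cmod2_alt z). simpl in H. lra. Qed.

Lemma Cexp_Clog (z : C) : z <> 0 -> Cexp (Clog z) = z.
Proof.
intros Hz. pose proof (proj1 (Cmod_gt_0 z) Hz) as Hp.
unfold Cexp, Clog; simpl. rewrite exp_ln //.
pose proof (Cmod_sqr z) as Hs.
assert (Hb : -1 <= Re z / Cmod z <= 1).
{ pose proof (re_le_Cmod z) as Hr. apply Rabs_le_between in Hr.
  split; [apply Rle_div_r | apply Rle_div_l]; lra. }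
assert (Hq : Cmod z * sqrt (1 - Rsqr (Re z / Cmod z)) = Rabs (Im z)).
{ rewrite -{1}(sqrt_Rsqr (Cmod z)); last lra.
  rewrite -sqrt_mult_alt; last apply Rle_0_sqr.
  rewrite -sqrt_Rsqr_abs. f_equal.
  unfold Rsqr. field_simplify; [|lra]. simpl. nra. }
unfold Carg. destruct (Rlt_dec (Im z) 0) as [H|H].
- rewrite cos_neg sin_neg cos_acos // sin_acos //.
  rewrite Rabs_left in Hq => //.
  destruct z as [a b]; apply injective_projections; unfold Re, Im in *; simpl in *; [field; lra|].
  rewrite -Ropp_mult_distr_r. lra.
- rewrite cos_acos // sin_acos //.
  rewrite Rabs_pos_eq in Hq; last lra.
  destruct z as [a b]; apply injective_projections; unfold Re, Im in *; simpl in *; [field; lra|].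
  lra.
Qed.

Lemma Clog_R (x : R) : 0 < x -> Clog (RtoC x) = RtoC (ln x).
Proof.
intros H. replace (RtoC x) with (Cexp (RtoC (ln x))).
- apply Clog_Cexp. simpl. pose proof PI_RGT_0; lra.
- rewrite Cexp_R exp_ln //.
Qed.

(** Smooth formulas for the argument on two half-planes, which cover all the
    points of the contour except the origin. *)
Lemma Carg_right (z : C) : 0 < Re z -> Carg z = atan (Im z / Re z).
Proof.
destruct z as [a b]; unfold Re, Im; simpl; intros H.
pose proof (atan_bound (b / a)). pose proof PI_RGT_0.
rewrite -(Carg_polar (a * sqrt (1 + Rsqr (b / a))) (atan (b / a))); last lra.
- f_equal. rewrite cos_atan sin_atan.
  assert (0 < sqrt (1 + Rsqr (b / a))) by (apply sqrt_lt_R0; pose proof (Rle_0_sqr (b / a)); lra).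
  f_equal; field; lra.
- apply Rmult_lt_0_compat => //. apply sqrt_lt_R0. pose proof (Rle_0_sqr (b / a)); lra.
Qed.

Lemma Carg_up (z : C) : 0 < Im z -> Carg z = PI / 2 - atan (Re z / Im z).
Proof.
destruct z as [a b]; unfold Re, Im; simpl; intros H.
pose proof (atan_bound (a / b)). pose proof PI_RGT_0.
rewrite -(Carg_polar (b * sqrt (1 + Rsqr (a / b))) (PI / 2 - atan (a / b))); last lra.
- f_equal. rewrite cos_shift sin_shift cos_atan sin_atan.
  assert (0 < sqrt (1 + Rsqr (a / b))) by (apply sqrt_lt_R0; pose proof (Rle_0_sqr (a / b)); lra).
  f_equal; field; lra.
- apply Rmult_lt_0_compat => //. apply sqrt_lt_R0. pose proof (Rle_0_sqr (a / b)); lra.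
Qed.

(** The union of the right and upper half-planes, where the logarithm is
    differentiated. *)
Definition slit (z : C) : Prop := 0 < Re z \/ 0 < Im z.

Lemma slit_neq_0 (z : C) : slit z -> z <> 0.
Proof. intros H E. rewrite E in H. destruct H as [H|H]; simpl in H; lra. Qed.

Lemma Clim_Clog {T} (F : (T -> Prop) -> Prop) {FF : Filter F} (f : T -> C) (a : C) :
  slit a -> Clim F f a -> Clim F (fun t => Clog (f t)) (Clog a).
Proof.
intros Ha H. split.
- simpl. apply: (Rlim_cont F _ ln); first by apply Clim_Cmod.
  apply: (ex_derive_cont). auto_derive.
  apply Cmod_gt_0. by apply slit_neq_0.
- simpl. destruct H as [A B]. destruct Ha as [Ha|Ha].
  + rewrite (Carg_right a) //.
    apply (filterlim_ext_loc (fun t => atan (Im (f t) * / Re (f t)))).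
    { assert (E : F (fun t => 0 < Re (f t))).
      { apply A. exact (open_gt 0 _ Ha). }
      apply: filter_imp E. intros t Ht. by rewrite Carg_right. }
    apply: (Rlim_cont F _ atan); last by apply: (ex_derive_cont); auto_derive.
    apply: Rlim_mult => //. apply: (Rlim_cont F _ Rinv) => //.
    apply: (ex_derive_cont). auto_derive. lra.
  + rewrite (Carg_up a) //.
    apply (filterlim_ext_loc (fun t => PI / 2 + - atan (Re (f t) * / Im (f t)))).
    { assert (E : F (fun t => 0 < Im (f t))).
      { apply B. exact (open_gt 0 _ Ha). }
      apply: filter_imp E. intros t Ht. by rewrite Carg_up. }
    apply: Rlim_plus; first by apply filterlim_const. apply: Rlim_opp.
    apply: (Rlim_cont F _ atan); last by apply: (ex_derive_cont); auto_derive.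
    apply: Rlim_mult => //. apply: (Rlim_cont F _ Rinv) => //.
    apply: (ex_derive_cont). auto_derive. lra.
Qed.

Lemma is_Cderive_Clog (f : R -> C) (x : R) (a : C) :
  slit (f x) -> is_Cderive f x a -> is_Cderive (fun t => Clog (f t)) x (a / f x)%C.
Proof.
intros Hf H. pose proof (is_Cderive_Clim _ _ _ H) as [CA CB].
pose proof (slit_neq_0 _ Hf) as Hn.
assert (Hm : 0 < fst (f x) * (fst (f x) * 1) + snd (f x) * (snd (f x) * 1)).
{ apply Rnot_le_lt. intros H'. apply Hn. apply injective_projections; simpl; nra. }
destruct H as [A B].
assert (E1 : 0 < Re (f x) -> locally x (fun t => 0 < Re (f t))).
{ intros Hp. apply CA. exact (open_gt 0 _ Hp). }
assert (E2 : 0 < Im (f x) -> locally x (fun t => 0 < Im (f t))).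
{ intros Hp. apply CB. exact (open_gt 0 _ Hp). }
set (p := fun t => Re (f t)) in A. set (q := fun t => Im (f t)) in B.
have_derives.
split.
- change (is_derive (fun t => ln (sqrt (p t * (p t * 1) + q t * (q t * 1)))) x (Re (a / f x)%C)).
  auto_derive.
  + unfold p, q, Re, Im. repeat split; try assumption. apply sqrt_lt_R0. lra.
  + rewrite H H1; unfold p, q, Re, Im; simpl; clear H H1 E1 E2.
    assert (K : sqrt (fst (f x) * (fst (f x) * 1) + snd (f x) * (snd (f x) * 1)) ^ 2
      = fst (f x) * (fst (f x) * 1) + snd (f x) * (snd (f x) * 1)).
    { rewrite pow2_sqrt; lra. }
    assert (K' : 0 < sqrt (fst (f x) * (fst (f x) * 1) + snd (f x) * (snd (f x) * 1))).
    { apply sqrt_lt_R0. lra. }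
    destruct (f x) as [u v], a as [a1 a2]. simpl fst in *. simpl snd in *.
    set (w := sqrt _) in *.
    transitivity ((u * a1 + v * a2) / w ^ 2); [field; lra|].
    rewrite K. simpl in *. field. lra.
- destruct Hf as [Hf|Hf].
  + apply (is_derive_ext_loc (fun t => atan (q t / p t))).
    { apply: filter_imp (E1 Hf). intros t Ht. unfold p, q. simpl. by rewrite Carg_right. }
    unfold Re in Hf.
    auto_derive.
    * repeat split; try assumption. unfold p, Re. lra.
    * rewrite H H1; unfold p, q, Re, Im; simpl; clear H H1 E1 E2.
      destruct (f x) as [u v], a as [a1 a2]. simpl in *. field. split; nra.
  + apply (is_derive_ext_loc (fun t => PI / 2 - atan (p t / q t))).
    { apply: filter_imp (E2 Hf). intros t Ht. unfold p, q. simpl. by rewrite Carg_up. }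
    unfold Im in Hf.
    auto_derive.
    * repeat split; try assumption. unfold q, Im. lra.
    * rewrite H H1; unfold p, q, Re, Im; simpl; clear H H1 E1 E2.
      destruct (f x) as [u v], a as [a1 a2]. simpl in *. field. split; nra.
Qed.

Lemma Cpower_plus (w a b : C) : Cpower w (a + b)%C = (Cpower w a * Cpower w b)%C.
Proof. unfold Cpower. rewrite -Cexp_plus. f_equal. ring. Qed.

Lemma Cpower_opp (w a : C) : Cpower w (- a)%C = (/ Cpower w a)%C.
Proof. unfold Cpower. rewrite -Cexp_opp. f_equal. ring. Qed.

Lemma Cpower_minus (w a b : C) : Cpower w (a - b)%C = (Cpower w a / Cpower w b)%C.
Proof. unfold Cminus. by rewrite Cpower_plus Cpower_opp. Qed.

Lemma Cpower_1 (w : C) : w <> 0 -> Cpower w 1 = w.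
Proof. intros H. unfold Cpower. rewrite Cmult_1_l. by apply Cexp_Clog. Qed.

Lemma Cpower_minus_1 (w k : C) : w <> 0 -> Cpower w (k - 1)%C = (Cpower w k / w)%C.
Proof. intros H. by rewrite Cpower_minus Cpower_1. Qed.

Lemma Cpower_neq_0 (w k : C) : Cpower w k <> 0.
Proof. apply Cexp_neq_0. Qed.

Lemma Cmod_Cpower (w k : C) : Cmod (Cpower w k) = exp (Re k * ln (Cmod w) - Im k * Carg w).
Proof. unfold Cpower. rewrite Cmod_Cexp. f_equal. Qed.

Lemma Cpower_R (x : R) (k : C) : 0 < x -> Cpower (RtoC x) k = Cexp (k * RtoC (ln x))%C.
Proof. intros H. unfold Cpower. by rewrite Clog_R. Qed.

Lemma Cmod_Cpower_R (x : R) (k : C) : 0 < x -> Cmod (Cpower (RtoC x) k) = exp (Re k * ln x).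
Proof. intros H. rewrite Cpower_R // Cmod_Cexp. f_equal. destruct k; simpl. ring. Qed.

Lemma Clog_scal (x : R) (w : C) : 0 < x -> w <> 0 -> Clog (x * w)%C = (ln x + Clog w)%C.
Proof.
intros Hx Hw. pose proof (proj1 (Cmod_gt_0 w) Hw) as Hp. unfold Clog.
assert (E : Cmod (x * w) = x * Cmod w) by (rewrite Cmod_mult Cmod_R Rabs_pos_eq; lra).
apply injective_projections.
- simpl. rewrite E ln_mult //.
- simpl. rewrite Rplus_0_l. unfold Carg. rewrite E. destruct w as [a b]; simpl in *.
  replace (x * a - 0 * b) with (x * a) by ring.
  replace (x * b + 0 * a) with (x * b) by ring.
  replace (x * a / (x * Cmod (a, b))) with (a / Cmod (a, b)) by (field; lra).
  destruct (Rlt_dec (x * b) 0), (Rlt_dec b 0) => //; exfalso; nra.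
Qed.

Lemma Cpower_scal (x : R) (w k : C) : 0 < x -> w <> 0 ->
  Cpower (x * w)%C k = (Cpower x k * Cpower w k)%C.
Proof.
intros Hx Hw. unfold Cpower. rewrite Clog_scal // Clog_R // -Cexp_plus. f_equal. ring.
Qed.

Lemma Cexp_Ci (x : R) : Cexp (Ci * RtoC x)%C = (cos x, sin x).
Proof.
unfold Cexp. simpl. replace (0 * x - 1 * 0) with 0 by ring. rewrite exp_0.
replace (0 * 0 + 1 * x) with x by ring. apply injective_projections; simpl; ring.
Qed.

(** Turning a point of the right half-plane by a right angle keeps its
    argument in the principal range. *)
Lemma Clog_Ci_mult (w : C) : 0 < Re w -> Clog (Ci * w)%C = (Ci * RtoC (PI / 2) + Clog w)%C.
Proof.
intros H.
assert (Hw : w <> 0) by (apply slit_neq_0; by left).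
assert (E : (Ci * w)%C = Cexp (Ci * RtoC (PI / 2) + Clog w)%C).
{ rewrite Cexp_plus Cexp_Clog // Cexp_Ci cos_PI2 sin_PI2. reflexivity. }
rewrite E. apply Clog_Cexp. simpl. rewrite Carg_right //.
pose proof (atan_bound (Im w / Re w)). lra.
Qed.

Lemma Cpower_Ci_mult (w k : C) : 0 < Re w -> Cpower (Ci * w)%C k = (Cpower Ci k * Cpower w k)%C.
Proof.
intros H. unfold Cpower.
assert (E : Clog Ci = (Ci * RtoC (PI / 2))%C).
{ replace Ci with (Ci * RtoC 1)%C at 1 by ring. rewrite Clog_Ci_mult; simpl; [|lra].
  rewrite Clog_R; [|lra]. rewrite ln_1. ring. }
rewrite Clog_Ci_mult // E -Cexp_plus. f_equal. ring.
Qed.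

Lemma Clim_Cpower {T} (F : (T -> Prop) -> Prop) {FF : Filter F} (f : T -> C) (a k : C) :
  slit a -> Clim F f a -> Clim F (fun t => Cpower (f t) k) (Cpower a k).
Proof.
intros Ha H. unfold Cpower. apply: Clim_Cexp. apply: Clim_mult; [apply: Clim_const|].
by apply: Clim_Clog.
Qed.

Lemma is_Cderive_Cpower (f : R -> C) (x : R) (a k : C) :
  slit (f x) -> is_Cderive f x a ->
  is_Cderive (fun t => Cpower (f t) k) x (k * Cpower (f x) (k - 1) * a)%C.
Proof.
intros Hf H. pose proof (slit_neq_0 _ Hf).
eapply is_Cderive_eq.
- apply: is_Cderive_Cexp. apply: is_Cderive_mult; [apply: is_Cderive_const|].
  apply: is_Cderive_Clog; [exact Hf|exact H].
- rewrite Cpower_minus_1 //. unfold Cpower. field. done.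
Qed.

(** * Improper integrals through primitives *)

(** The fundamental theorem of calculus for an improper integral over an
    interval [D], with a primitive that has limits at both ends. *)
Lemma is_RInt_gen_primitive (Fa Fb : (R -> Prop) -> Prop) {FFa : Filter Fa} {FFb : Filter Fb}
  (D : R -> Prop) (f F : R -> C) (la lb : C) :
  (forall x y z, D x -> D y -> x <= z <= y -> D z) ->
  Fa D -> Fb D ->
  (forall x, D x -> is_Cderive F x (f x)) ->
  (forall x, D x -> Clim (locally x) f (f x)) ->
  Clim Fa F la -> Clim Fb F lb ->
  is_RInt_gen (V := C_R_NormedModule) f Fa Fb (lb - la)%C.
Proof.
intros HD Ha Hb Hder Hcont [La1 La2] [Lb1 Lb2].
assert (HI : forall a b, D a -> D b -> is_RInt (V := C_R_NormedModule) f a b (F b - F a)%C).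
{ intros a b Da Db.
  assert (HD' : forall z, Rmin a b <= z <= Rmax a b -> D z).
  { intros z Hz. unfold Rmin, Rmax in Hz. destruct (Rle_dec a b).
    - apply (HD a b) => //. - apply (HD b a) => //. }
  apply (is_RInt_fct_extend_pair (U := R_NormedModule) (V := R_NormedModule)).
  - apply (is_RInt_derive (V := R_CompleteNormedModule) (fun x => Re (F x))).
    + intros x Hx. apply Hder. by apply HD'.
    + intros x Hx. apply (Hcont x). by apply HD'.
  - apply (is_RInt_derive (V := R_CompleteNormedModule) (fun x => Im (F x))).
    + intros x Hx. apply Hder. by apply HD'.
    + intros x Hx. apply (Hcont x). by apply HD'. }
assert (HL : filterlim (fun ab : R * R => (F (snd ab) - F (fst ab))%C) (filter_prod Fa Fb)
  (Clocally (lb - la)%C)).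
{ apply filterlim_locally. intros eps.
  assert (K : Clim (filter_prod Fa Fb) (fun ab : R * R => (F (snd ab) - F (fst ab))%C) (lb - la)%C).
  { apply: Clim_minus.
    - apply: (Clim_comp _ Fb snd F); [exact filterlim_snd | by split].
    - apply: (Clim_comp _ Fa fst F); [exact filterlim_fst | by split]. }
  destruct K as [K1 K2].
  apply: filter_imp (filter_and _ _ (proj1 (filterlim_locally _ _) K1 eps)
    (proj1 (filterlim_locally _ _) K2 eps)).
  intros ab [A B]. split; assumption. }
intros P HP.
specialize (HL P HP). unfold filtermapi, filtermap in *.
assert (HDD : filter_prod Fa Fb (fun ab => D (fst ab) /\ D (snd ab))).
{ exists D D => //. }
apply: filter_imp (filter_and _ _ HDD HL).
intros [a b] [[A B] H]. simpl in *. exists (F b - F a)%C. split => //. by apply HI.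
Qed.

Lemma derive_nonneg_incr (f df : R -> R) (a b : R) : a <= b ->
  (forall x, a <= x <= b -> is_derive f x (df x)) ->
  (forall x, a <= x <= b -> 0 <= df x) -> f a <= f b.
Proof.
intros Hab Hd Hp.
destruct (MVT_gen f a b df) as [c [Hc E]].
- intros x Hx. rewrite Rmin_left // Rmax_right // in Hx. apply Hd; lra.
- intros x Hx. rewrite Rmin_left // Rmax_right // in Hx.
  apply continuity_pt_filterlim. apply: (ex_derive_cont).
  eexists. by apply Hd.
- rewrite Rmin_left // Rmax_right // in Hc. pose proof (Hp c Hc). nra.
Qed.

(** The increments of [h] are dominated by those of a convergent function, so
    [h] is Cauchy along the filter. *)
Lemma filterlim_dominated (F : (R -> Prop) -> Prop) {FF : ProperFilter F} (D : R -> Prop)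
  (h g : R -> R) (l : R) :
  F D -> (forall x y, D x -> D y -> Rabs (h y - h x) <= Rabs (g y - g x)) ->
  filterlim g F (locally l) -> exists l', filterlim h F (locally l').
Proof.
intros HD H Hg.
apply (filterlim_locally_cauchy (U := R_CompleteNormedModule)).
intros eps.
destruct (proj2 (filterlim_locally_cauchy (U := R_CompleteNormedModule) (F := F) g)
  (ex_intro _ l Hg) eps) as [P [HP HP']].
exists (fun x => P x /\ D x). split; first by apply filter_and.
intros u v [Pu Du] [Pv Dv]. specialize (HP' u v Pu Pv).
ball_simpl_all.
eapply Rle_lt_trans; [apply (H u v) => //| exact HP'].
Qed.

(** [is_halfint f l]: [l] is the integral of [f] over the half-line, certified by a
    primitive with limits at both ends; change of variables, integration by
    parts and comparison are then statements about derivatives. *)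
Definition is_halfint (f : R -> C) (l : C) : Prop :=
  exists (F : R -> C) (la lb : C),
    (forall x, 0 < x -> is_Cderive F x (f x)) /\
    Clim (at_right 0) F la /\ Clim at_oo F lb /\ l = (lb - la)%C.

Lemma at_right_pos : at_right 0 (fun x => 0 < x).
Proof. exists (mkposreal 1 Rlt_0_1). by intros. Qed.

Lemma at_right_lt (b : R) : 0 < b -> at_right 0 (fun x => x < b).
Proof.
intros H. exists (mkposreal b H). intros y Hy _.
ball_simpl_all.
apply Rabs_def2 in Hy. lra.
Qed.

Lemma p_infty_gt (b : R) : Rbar_locally p_infty (fun x => b < x).
Proof. exists b. by intros. Qed.

Lemma halfint_ext (f g : R -> C) (l : C) : (forall x, 0 < x -> f x = g x) -> is_halfint f l -> is_halfint g l.
Proof.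
intros E [F [la [lb [H1 H2]]]]. exists F, la, lb. split => //.
intros x Hx. rewrite -E //. by apply H1.
Qed.

Lemma halfint_plus (f g : R -> C) (a b : C) : is_halfint f a -> is_halfint g b ->
  is_halfint (fun t => f t + g t)%C (a + b)%C.
Proof.
intros [F [la [lb [H1 [H2 [H3 H4]]]]]] [F' [la' [lb' [H1' [H2' [H3' H4']]]]]].
exists (fun t => F t + F' t)%C, (la + la')%C, (lb + lb')%C. split; [|split; [|split]]; try by apply: Clim_plus.
- intros x Hx. apply: is_Cderive_plus; auto.
- rewrite H4 H4'. ring.
Qed.

Lemma halfint_scal (c : C) (f : R -> C) (a : C) : is_halfint f a -> is_halfint (fun t => c * f t)%C (c * a)%C.
Proof.
intros [F [la [lb [H1 [H2 [H3 H4]]]]]].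
exists (fun t => c * F t)%C, (c * la)%C, (c * lb)%C.
assert (forall F0, Filter F0 -> forall l, Clim F0 F l -> Clim F0 (fun t => c * F t)%C (c * l)%C).
{ intros. apply: Clim_mult => //. apply: Clim_const. }
split; [|split; [|split]].
- intros x Hx. eapply is_Cderive_eq.
  + apply: is_Cderive_mult; [apply: is_Cderive_const|by apply H1].
  + cbv beta. ring.
- by apply: H.
- by apply: H.
- rewrite H4. ring.
Qed.

(** The real part of a primitive is monotone, so its increment over the whole
    half-line is at least the one between [1] and [2]. *)
Lemma halfint_increment (f : R -> C) (l : C) : is_halfint f l -> (forall x, 0 < x -> 0 <= Re (f x)) ->
  exists F : R -> C, (forall x, 0 < x -> is_Cderive F x (f x)) /\ Re (F 1) <= Re (F 2) /\
    Re (F 2) - Re (F 1) <= Re l.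
Proof.
intros [F [la [lb [H1 [[H2 _] [[H3 _] H4]]]]]] Hp.
assert (K : forall x y, 0 < x -> x <= y -> Re (F x) <= Re (F y)).
{ intros x y Hx Hy. apply (derive_nonneg_incr (fun t => Re (F t)) (fun t => Re (f t))) => //.
  - intros z Hz. apply H1; lra. - intros z Hz. apply Hp; lra. }
assert (A : Re la <= Re (F 1)).
{ apply (filterlim_le (F := at_right 0) (fun t => Re (F t)) (fun _ => Re (F 1)) (Re la) (Re (F 1))) => //.
  - apply: filter_imp (filter_and _ _ at_right_pos (at_right_lt 1 Rlt_0_1)). intros x [Hx Hx']. apply K; lra.
  - apply filterlim_const. }
assert (B : Re (F 2) <= Re lb).
{ apply (filterlim_le (F := Rbar_locally p_infty) (fun _ => Re (F 2)) (fun t => Re (F t)) (Re (F 2)) (Re lb)) => //.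
  - apply: filter_imp (p_infty_gt 2). intros x Hx. apply K; lra.
  - apply filterlim_const. }
exists F. split => //. split; first by apply K; lra.
rewrite H4. simpl. unfold Re in *. lra.
Qed.

Lemma halfint_nonneg (f : R -> C) (l : C) : is_halfint f l -> (forall x, 0 < x -> 0 <= Re (f x)) -> 0 <= Re l.
Proof. intros H Hp. destruct (halfint_increment f l H Hp) as [F [_ [A B]]]. lra. Qed.

Lemma halfint_unique (f : R -> C) (a b : C) : is_halfint f a -> is_halfint f b -> a = b.
Proof.
intros Ha Hb.
assert (K : forall c : C, 0 <= Re (c * (a - b))%C /\ 0 <= Re (- (c * (a - b)))%C).
{ intros c.
  assert (H : is_halfint (fun _ => RtoC 0) (c * (a - b))%C).
  { apply (halfint_ext (fun t => c * (f t + (-1)%R * f t))%C).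
    - intros. ring.
    - replace (c * (a - b))%C with (c * (a + (-1)%R * b))%C by ring.
      apply halfint_scal, halfint_plus => //. by apply halfint_scal. }
  split.
  - apply (halfint_nonneg _ _ H). intros; simpl; lra.
  - apply (halfint_nonneg (fun t => (-1)%R * (RtoC 0))%C).
    + replace (- (c * (a - b)))%C with ((-1)%R * (c * (a - b)))%C by ring. by apply halfint_scal.
    + intros; simpl; lra. }
destruct (K 1%C) as [A B], (K Ci) as [A' B'].
destruct a as [a1 a2], b as [b1 b2]; simpl in *. apply injective_projections; simpl; lra.
Qed.

Lemma halfint_pos (f : R -> C) (l : C) : is_halfint f l -> (forall x, 0 < x -> 0 < Re (f x)) -> 0 < Re l.
Proof.
intros H Hp.
destruct (halfint_increment f l H (fun x Hx => Rlt_le _ _ (Hp x Hx))) as [F [H1 [_ B]]].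
destruct (MVT_gen (fun t => Re (F t)) 1 2 (fun t => Re (f t))) as [c [Hc E]].
- intros x Hx. rewrite Rmin_left ?Rmax_right in Hx; try lra. apply H1; lra.
- intros x Hx. rewrite Rmin_left ?Rmax_right in Hx; try lra.
  apply continuity_pt_filterlim. apply: (ex_derive_cont).
  eexists. apply H1; lra.
- rewrite Rmin_left ?Rmax_right in Hc; try lra. pose proof (Hp c ltac:(lra)). nra.
Qed.

Lemma halfint_RInt_gen (f : R -> C) (l : C) : is_halfint f l -> (forall x, 0 < x -> Clim (locally x) f (f x)) ->
  is_RInt_gen (V := C_R_NormedModule) f (at_right 0) at_oo l.
Proof.
intros [F [la [lb [H1 [H2 [H3 ->]]]]]] Hc.
apply: (is_RInt_gen_primitive _ _ (fun x => 0 < x) f F) => //.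
- intros; lra.
- apply at_right_pos.
- apply (p_infty_gt 0).
Qed.

(** The primitive is the integral from [1]; its increments are dominated by
    those of [G].  The factor [2] comes from treating the real and imaginary
    parts separately. *)
Lemma halfint_dominated (f : R -> C) (g G : R -> R) (ga gb : R) :
  (forall x, 0 < x -> Clim (locally x) f (f x)) ->
  (forall x, 0 < x -> Cmod (f x) <= g x) ->
  (forall x, 0 < x -> is_derive G x (g x)) ->
  filterlim G (at_right 0) (locally ga) -> filterlim G at_oo (locally gb) ->
  exists l, is_halfint f l /\ Cmod l <= 2 * (gb - ga).
Proof.
intros Hc Hg HG Ha Hb.
assert (K : forall h : R -> R, (forall x, 0 < x -> continuous h x) ->
  (forall x, 0 < x -> Rabs (h x) <= g x) ->
  exists H a b, (forall x, 0 < x -> is_derive H x (h x)) /\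
    filterlim H (at_right 0) (locally a) /\ filterlim H at_oo (locally b) /\
    Rabs (b - a) <= gb - ga).
{ intros h hc hg.
  set (H := fun x => RInt h 1 x).
  assert (HH : forall x, 0 < x -> is_derive H x (h x)).
  { intros x Hx. apply: (is_derive_RInt _ _ 1); last by apply hc.
    exists (mkposreal x Hx). intros y Hy.
    ball_simpl_all.
    apply Rabs_def2 in Hy.
    apply: RInt_correct. apply: ex_RInt_continuous. intros z Hz. apply hc.
    unfold Rmin in Hz. destruct (Rle_dec 1 y); lra. }
  assert (HM : forall x y, 0 < x -> x <= y -> Rabs (H y - H x) <= G y - G x).
  { intros x y Hx Hy.
    assert (A1 : G x - H x <= G y - H y).
    { apply (derive_nonneg_incr (fun t => G t - H t) (fun t => g t - h t)) => //.
      - intros z Hz. apply: (is_derive_minus G H); [apply HG|apply HH]; lra.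
      - intros z Hz. assert (Hz' : 0 < z) by lra. generalize (hg z Hz'). unfold Rabs. destruct Rcase_abs; lra. }
    assert (A2 : G x + H x <= G y + H y).
    { apply (derive_nonneg_incr (fun t => G t + H t) (fun t => g t + h t)) => //.
      - intros z Hz. apply: (is_derive_plus G H); [apply HG|apply HH]; lra.
      - intros z Hz. assert (Hz' : 0 < z) by lra. generalize (hg z Hz'). unfold Rabs. destruct Rcase_abs; lra. }
    unfold Rabs. destruct Rcase_abs; lra. }
  assert (HM' : forall x y, 0 < x -> 0 < y -> Rabs (H y - H x) <= Rabs (G y - G x)).
  { intros x y Hx Hy. destruct (Rle_dec x y).
    - eapply Rle_trans; [apply HM => //|apply Rle_abs].
    - rewrite Rabs_minus_sym (Rabs_minus_sym (G y)). eapply Rle_trans; [apply HM => //; lra|apply Rle_abs]. }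
  destruct (filterlim_dominated (at_right 0) (fun x => 0 < x) H G ga at_right_pos HM' Ha) as [a La].
  destruct (filterlim_dominated at_oo (fun x => 0 < x) H G gb (p_infty_gt 0) HM' Hb) as [b Lb].
  exists H, a, b. split => //. split => //. split => //.
  assert (L1 : filterlim (fun ab : R * R => Rabs (H (snd ab) - H (fst ab)))
    (filter_prod (at_right 0) at_oo) (locally (Rabs (b - a)))).
  { apply: (Rlim_cont _ (fun ab : R * R => H (snd ab) - H (fst ab)) Rabs).
    - apply: Rlim_plus.
      + exact (filterlim_comp _ _ _ _ _ _ _ _ filterlim_snd Lb).
      + apply: Rlim_opp. exact (filterlim_comp _ _ _ _ _ _ _ _ filterlim_fst La).
    - apply: continuous_Rabs. }
  assert (L2 : filterlim (fun ab : R * R => G (snd ab) - G (fst ab))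
    (filter_prod (at_right 0) at_oo) (locally (gb - ga))).
  { apply: Rlim_plus.
      + exact (filterlim_comp _ _ _ _ _ _ _ _ filterlim_snd Hb).
      + apply: Rlim_opp. exact (filterlim_comp _ _ _ _ _ _ _ _ filterlim_fst Ha). }
  apply (filterlim_le (F := filter_prod (at_right 0) at_oo) _ _ (Rabs (b - a)) (gb - ga)) with (2 := L1) (3 := L2).
  exists (fun x => 0 < x < 1) (fun x => 1 < x).
  - apply filter_and; [apply at_right_pos|apply at_right_lt; lra].
  - apply p_infty_gt.
  - intros x y Hx Hy. simpl. apply HM; lra. }
destruct (K (fun t => Re (f t))) as [H1 [a1 [b1 [D1 [A1 [B1 M1]]]]]].
- intros x Hx. apply (Hc x Hx).
- intros x Hx. eapply Rle_trans; [apply re_le_Cmod|by apply Hg].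
- destruct (K (fun t => Im (f t))) as [H2 [a2 [b2 [D2 [A2 [B2 M2]]]]]].
  + intros x Hx. apply (Hc x Hx).
  + intros x Hx. eapply Rle_trans; [|by apply Hg]. eapply Rle_trans; [|apply Rmax_Cmod]. apply Rmax_r.
  + exists ((b1, b2) - (a1, a2))%C. split.
    * exists (fun t => (H1 t, H2 t)), (a1, a2), (b1, b2).
      split; [|split; [|split]] => //. intros x Hx. split; simpl; auto.
    * replace ((b1, b2) - (a1, a2))%C with ((b1 - a1)%R + Ci * (b2 - a2)%R)%C.
      -- eapply Rle_trans; [apply Cmod_triangle|]. rewrite Cmod_mult Cmod_Ci !Cmod_R. lra.
      -- apply injective_projections; simpl; ring.
Qed.

(** * The Gamma integral *)

Lemma exp_le_compat (x y : R) : x <= y -> exp x <= exp y.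
Proof. intros [H| ->]; [left; by apply exp_increasing | lra]. Qed.

(** This is [ln y <= y - 1] at [y = a t / s]. *)
Lemma pow_le_exp (s a t : R) : 0 < s -> 0 < a -> 0 < t ->
  exp (s * ln t) <= exp (s * ln (s / a)) * exp (a * t).
Proof.
intros Hs Ha Ht. rewrite -exp_plus. apply exp_le_compat.
assert (Hx : 0 < a * t / s) by (apply Rdiv_lt_0_compat; nra).
assert (Hy : 0 < s / a) by (apply Rdiv_lt_0_compat; lra).
replace (ln t) with (ln (a * t / s) + ln (s / a)).
- pose proof (exp_ineq1_le (ln (a * t / s))) as H. rewrite exp_ln // in H.
  assert (s * ln (a * t / s) <= s * (a * t / s)) by (apply Rmult_le_compat_l; lra).
  replace (s * (a * t / s)) with (a * t) in H0 by (field; lra). lra.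
- rewrite -ln_mult //. f_equal. field. lra.
Qed.

Lemma lim_pow_0 (s : R) : 0 < s -> filterlim (fun t => exp (s * ln t)) (at_right 0) (locally 0).
Proof.
intros Hs. apply filterlim_locally. intros eps.
apply: filter_imp (filter_and _ _ at_right_pos (at_right_lt (exp (ln eps / s)) (exp_pos _))).
intros t [Ht Ht'].
ball_simpl.
rewrite Ropp_0 Rplus_0_r Rabs_pos_eq; last by left; apply exp_pos.
rewrite -(exp_ln eps); last by apply cond_pos. apply exp_increasing.
apply ln_increasing in Ht' => //. rewrite ln_exp in Ht'.
apply Rlt_div_r in Ht'; lra.
Qed.

Lemma lim_exp_neg (a : R) : 0 < a -> filterlim (fun t => exp (- (a * t))) at_oo (locally 0).
Proof.
intros Ha. apply filterlim_locally. intros eps.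
apply: filter_imp (p_infty_gt (- ln eps / a)).
intros t Ht.
ball_simpl.
rewrite Ropp_0 Rplus_0_r Rabs_pos_eq; last by left; apply exp_pos.
rewrite -(exp_ln eps); last by apply cond_pos. apply exp_increasing.
apply Rlt_div_l in Ht; lra.
Qed.

Lemma Rlim_squeeze_0 {T} (F : (T -> Prop) -> Prop) {FF : Filter F} (f g : T -> R) :
  F (fun t => Rabs (f t) <= g t) -> filterlim g F (locally 0) -> filterlim f F (locally 0).
Proof.
intros H1 H2. apply filterlim_locally. intros eps.
apply: filter_imp (filter_and _ _ H1 (proj1 (filterlim_locally _ _) H2 eps)).
intros t [A B]. ball_simpl_all.
rewrite -> Ropp_0, Rplus_0_r in *. eapply Rle_lt_trans; [exact A|].
eapply Rle_lt_trans; [apply Rle_abs|exact B].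
Qed.

Lemma lim_pow_exp (s a : R) : 0 < s -> 0 < a ->
  filterlim (fun t => exp (s * ln t) * exp (- (a * t))) at_oo (locally 0).
Proof.
intros Hs Ha.
apply: (Rlim_squeeze_0 _ _ (fun t => exp (s * ln (s / (a / 2))) * exp (- (a / 2 * t)))).
- apply: filter_imp (p_infty_gt 0). intros t Ht.
  rewrite Rabs_pos_eq; last by (left; apply Rmult_lt_0_compat; apply exp_pos).
  replace (exp (- (a / 2 * t))) with (exp (a / 2 * t) * exp (- (a * t))).
  + rewrite -Rmult_assoc. apply Rmult_le_compat_r; [left; apply exp_pos|]. apply pow_le_exp; lra.
  + rewrite -exp_plus. f_equal. field.
- rewrite -(Rmult_0_r (exp (s * ln (s / (a / 2))))).
  apply: Rlim_mult; [apply: filterlim_const|]. apply lim_exp_neg. lra.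
Qed.

Definition gamma_integrand (k : C) (t : R) : C := (Cpower (RtoC t) (k - 1) * RtoC (exp (- t)))%C.

Lemma is_Cderive_id (x : R) : is_Cderive RtoC x 1.
Proof. apply is_Cderive_RtoC. apply: is_derive_id. Qed.

Lemma is_Cderive_Cpower_R (x : R) (k : C) : 0 < x ->
  is_Cderive (fun t => Cpower (RtoC t) k) x (k * Cpower (RtoC x) (k - 1))%C.
Proof.
intros Hx. eapply is_Cderive_eq.
- apply: is_Cderive_Cpower; [by left | apply is_Cderive_id].
- ring.
Qed.

Lemma is_Cderive_exp_neg (a x : R) :
  is_Cderive (fun t => RtoC (exp (- (a * t)))) x (RtoC (- a * exp (- (a * x)))).
Proof. apply is_Cderive_RtoC. auto_derive => //. ring. Qed.

Lemma RtoC_neq_0 (x : R) : x <> 0 -> RtoC x <> 0.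
Proof. intros H E. apply H. exact (f_equal fst E). Qed.

Lemma gamma_integrand_cont (k : C) (x : R) : 0 < x ->
  Clim (locally x) (gamma_integrand k) (gamma_integrand k x).
Proof.
intros Hx. unfold gamma_integrand. apply: Clim_mult.
- apply: is_Cderive_Clim. by apply is_Cderive_Cpower_R.
- apply: is_Cderive_Clim. apply: is_Cderive_ext_loc (is_Cderive_exp_neg 1 x).
  apply filter_forall. intros t. by rewrite Rmult_1_l.
Qed.

Lemma Cmod_gamma_integrand (k : C) (t : R) : 0 < t ->
  Cmod (gamma_integrand k t) = exp ((Re k - 1) * ln t) * exp (- t).
Proof.
intros Ht. unfold gamma_integrand. rewrite Cmod_mult Cmod_Cpower_R // Cmod_R Rabs_pos_eq //.
left; apply exp_pos.
Qed.

(** The majorant [t^(s-1) / (1+t^s)^2], with [s = Re k], is integrable at both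
    ends and has an elementary primitive. *)
Lemma halfint_gamma_ex (k : C) : 0 < Re k -> exists l, is_halfint (gamma_integrand k) l.
Proof.
intros Hk. set (s := Re k) in *.
set (c := exp (s * ln (s / (1 / 2)))). set (A := (1 + c) ^ 2).
assert (hc : 0 < c) by apply exp_pos.
set (G := fun t => - (A / s) / (1 + exp (s * ln t))).
destruct (halfint_dominated (gamma_integrand k)
  (fun t => A * exp ((s - 1) * ln t) / (1 + exp (s * ln t)) ^ 2) G (- (A / s)) 0) as [l [Hl _]].
- intros x Hx. by apply gamma_integrand_cont.
- intros x Hx. rewrite Cmod_gamma_integrand //. fold s.
  pose proof (exp_pos (s * ln x)) as E0. pose proof (exp_pos ((s - 1) * ln x)) as E1.
  apply (Rle_div_r _ _ ((1 + exp (s * ln x)) ^ 2)); first by apply pow_lt; lra.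
  rewrite Rmult_assoc (Rmult_comm A). apply Rmult_le_compat_l; first lra.
  pose proof (pow_le_exp s (1 / 2) x Hk ltac:(lra) Hx) as H. fold c in H.
  assert (E2 : 1 <= exp (1 / 2 * x)) by (pose proof (exp_le_compat 0 (1 / 2 * x) ltac:(lra)) as E3; rewrite exp_0 in E3; exact E3).
  assert (H2 : (1 + exp (s * ln x)) ^ 2 <= ((1 + c) * exp (1 / 2 * x)) ^ 2).
  { apply pow_incr. split; [lra|]. nra. }
  replace (exp (- x)) with (/ (exp (1 / 2 * x) ^ 2)).
  + apply Rmult_le_reg_l with (exp (1 / 2 * x) ^ 2); first by nra.
    rewrite -Rmult_assoc Rinv_r; last by nra.
    rewrite Rpow_mult_distr in H2. unfold A. lra.
  + simpl. rewrite Rmult_1_r -exp_plus -exp_Ropp. f_equal. field.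
- intros x Hx. unfold G. pose proof (exp_pos (s * ln x)) as E0. auto_derive.
  + repeat split; lra.
  + replace (exp ((s - 1) * ln x)) with (exp (s * ln x) / x).
    * field. split; [lra|]. split; lra.
    * replace ((s - 1) * ln x) with (s * ln x + - ln x) by ring.
      rewrite exp_plus exp_Ropp exp_ln //.
- unfold G. assert (E : - (A / s) = - (A / s) * / (1 + 0)) by (field; lra). rewrite {2}E.
  apply: Rlim_mult; [apply: filterlim_const|].
  apply: (Rlim_cont _ (fun t => 1 + exp (s * ln t)) Rinv (1 + 0)).
  + apply: Rlim_plus; [apply: filterlim_const|by apply lim_pow_0].
  + apply: (ex_derive_cont). auto_derive. lra.
- unfold G. rewrite -(Rmult_0_r (- (A / s))).
  apply: Rlim_mult; [apply: filterlim_const|].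
  apply filterlim_locally. intros eps.
  apply: filter_imp (filter_and _ _ (p_infty_gt 0) (p_infty_gt (exp (- ln eps / s)))).
  intros t [Ht Ht'].
  ball_simpl.
  pose proof (exp_pos (s * ln t)) as E0.
  rewrite Ropp_0 Rplus_0_r Rabs_pos_eq; last by left; apply Rinv_0_lt_compat; lra.
  apply ln_increasing in Ht'; last by apply exp_pos. rewrite ln_exp in Ht'.
  apply Rlt_div_l in Ht' => //.
  rewrite -(Rinv_inv eps). apply Rinv_lt_contravar.
  + pose proof (cond_pos eps). pose proof (Rinv_0_lt_compat _ H). apply Rmult_lt_0_compat; lra.
  + rewrite -(exp_ln eps); last by apply cond_pos. rewrite -exp_Ropp.
    apply Rlt_trans with (exp (s * ln t)); last lra. apply exp_increasing. lra.
- by exists l.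
Qed.

Lemma halfint_gamma (k : C) : 0 < Re k -> is_halfint (gamma_integrand k) (CGamma k).
Proof.
intros Hk. destruct (halfint_gamma_ex k Hk) as [l Hl].
replace (CGamma k) with l => //. symmetry. unfold CGamma.
apply (is_RInt_gen_unique (V := C_R_CompleteNormedModule)
  (Fa := at_right 0) (Fb := Rbar_locally p_infty) (gamma_integrand k) l).
apply halfint_RInt_gen => //.
intros x Hx. by apply gamma_integrand_cont.
Qed.

Lemma Clim_pow_exp_oo (k : C) (a : R) : 0 < Re k -> 0 < a ->
  Clim at_oo (fun t => Cpower (RtoC t) k * RtoC (exp (- (a * t))))%C 0.
Proof.
intros Hk Ha. apply: Clim_squeeze; last exact: (lim_pow_exp (Re k) a Hk Ha).
apply: filter_imp (p_infty_gt 0). intros t Ht.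
replace (Cpower t k * exp (- (a * t)) - 0)%C with (Cpower t k * exp (- (a * t)))%C by ring.
rewrite Cmod_mult Cmod_Cpower_R // Cmod_R Rabs_pos_eq; [lra|left; apply exp_pos].
Qed.

Lemma Clim_pow_0 (k : C) : 0 < Re k -> Clim (at_right 0) (fun t => Cpower (RtoC t) k) 0.
Proof.
intros Hk. apply: Clim_squeeze; last exact: (lim_pow_0 (Re k) Hk).
apply: filter_imp at_right_pos. intros t Ht.
replace (Cpower t k - 0)%C with (Cpower t k) by ring. rewrite Cmod_Cpower_R //. lra.
Qed.

Lemma lim_at_right_cont (f : R -> R) (x : R) : continuous f x -> filterlim f (at_right x) (locally (f x)).
Proof. intros H. apply: filterlim_filter_le_1 H. by apply filter_le_within. Qed.

(** Integration by parts: [t^k e^(-t)] vanishes at both ends, and its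
    derivative is [k t^(k-1) e^(-t) - t^k e^(-t)]. *)
Lemma CGamma_succ (k : C) : 0 < Re k -> CGamma (k + 1)%C = (k * CGamma k)%C.
Proof.
intros Hk.
assert (H1 : is_halfint (fun t => k * gamma_integrand k t + (-1)%R * gamma_integrand (k + 1) t)%C
  (k * CGamma k + (-1)%R * CGamma (k + 1))%C).
{ apply halfint_plus; apply halfint_scal; apply halfint_gamma => //. unfold Re in *; simpl; lra. }
assert (H2 : is_halfint (fun t => k * gamma_integrand k t + (-1)%R * gamma_integrand (k + 1) t)%C 0).
{ exists (fun t => Cpower (RtoC t) k * RtoC (exp (- (1 * t))))%C, (RtoC 0), (RtoC 0).
  split; [|split; [|split]].
  - intros x Hx. eapply is_Cderive_eq.
    + apply: is_Cderive_mult; [by apply is_Cderive_Cpower_R|apply is_Cderive_exp_neg].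
    + cbv beta. unfold gamma_integrand. replace (k + 1 - 1)%C with k by ring.
      rewrite Rmult_1_l RtoC_mult RtoC_opp. ring.
  - replace (RtoC 0) with (RtoC 0 * RtoC (exp (- (1 * 0))))%C by ring.
    apply: Clim_mult; [by apply Clim_pow_0|]. apply: Clim_RtoC.
    apply: (lim_at_right_cont (fun t => exp (- (1 * t)))).
    apply: (ex_derive_cont). by auto_derive.
  - apply Clim_pow_exp_oo => //. lra.
  - ring. }
pose proof (halfint_unique _ _ _ H1 H2) as E.
replace (CGamma (k + 1)) with (k * CGamma k - (k * CGamma k + (-1)%R * CGamma (k + 1)))%C by ring.
rewrite E. ring.
Qed.

Lemma is_series_Clim (a : nat -> C) (l : C) :
  is_Cseries a l <-> Clim eventually (Csum a) l.
Proof.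
split.
- intros H. split; apply filterlim_locally; intros eps;
  apply: filter_imp (proj1 (filterlim_locally (U := C_UniformSpace) _ _) H eps);
  intros n [A B]; assumption.
- intros [A B].
  apply (proj2 (filterlim_locally (U := C_UniformSpace) _ _)). intros eps.
  apply: filter_imp (filter_and _ _ (proj1 (filterlim_locally _ _) A eps)
    (proj1 (filterlim_locally _ _) B eps)).
  intros n [K1 K2]. split; assumption.
Qed.

Lemma one_minus_sq_le_cos (x : R) : 1 - x ^ 2 / 2 <= cos x.
Proof.
replace x with (2 * (x / 2)) at 2 by field. rewrite cos_2a_sin.
assert (H : Rsqr (sin (x / 2)) <= Rsqr (x / 2)).
{ apply Rsqr_le_abs_1. apply Rabs_le.
  assert (K : forall y, 0 <= y -> sin y <= y).
  { intros y [Hy|<-]; [left; by apply sin_lt_x|rewrite sin_0; lra]. }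
  assert (K' : forall y, 0 <= y -> - y <= sin y).
  { intros y Hy.
    assert (K0 : sin 0 + 0 <= sin y + y).
    { apply (derive_nonneg_incr (fun t => sin t + t) (fun t => cos t + 1)) => //.
      - intros z _. auto_derive => //. ring.
      - intros z _. pose proof (COS_bound z). lra. }
    rewrite sin_0 in K0. lra. }
  destruct (Rle_dec 0 (x / 2)).
  - rewrite Rabs_pos_eq //. split; [by apply K'|by apply K].
  - rewrite Rabs_left; last lra.
    pose proof (K (- (x / 2)) ltac:(lra)) as A. pose proof (K' (- (x / 2)) ltac:(lra)) as B.
    rewrite sin_neg in A, B. lra. }
unfold Rsqr in H. lra.
Qed.

(** The right-hand side is the square of [e^(x/2) - e^(-x/2)]. *)
Lemma sq_le_cosh (x : R) : x ^ 2 <= exp x - 2 + exp (- x).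
Proof.
assert (K : forall y, 0 <= y -> 2 * y <= exp y - exp (- y)).
{ intros y Hy. assert (K0 : exp 0 - exp (- 0) - 2 * 0 <= exp y - exp (- y) - 2 * y).
  { apply (derive_nonneg_incr (fun t => exp t - exp (- t) - 2 * t) (fun t => exp t + exp (- t) - 2)) => //.
    - intros z _. auto_derive => //. ring.
    - intros z _. rewrite exp_Ropp. pose proof (exp_pos z).
      replace (exp z + / exp z - 2) with ((exp z - 1) ^ 2 / exp z) by (field; lra).
      apply Rdiv_le_0_compat => //. apply pow2_ge_0. }
  rewrite Ropp_0 in K0. lra. }
assert (K2 : forall y, 0 <= y -> y ^ 2 <= exp y - 2 + exp (- y)).
{ intros y Hy. pose proof (K (y / 2) ltac:(lra)) as H.
  replace (exp y - 2 + exp (- y)) with ((exp (y / 2) - exp (- (y / 2))) ^ 2); first by nra.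
  rewrite exp_Ropp. replace (- y) with (- (y / 2) + - (y / 2)) by field.
  replace y with (y / 2 + y / 2) at 3 by field.
  rewrite !exp_plus exp_Ropp. pose proof (exp_pos (y / 2)). field. lra. }
destruct (Rle_dec 0 x); first by apply K2.
replace (x ^ 2) with ((- x) ^ 2) by ring.
pose proof (K2 (- x) ltac:(lra)). rewrite -> Ropp_involutive in *. lra.
Qed.

Lemma gamma_integrand_R (q t : R) : 0 < t ->
  gamma_integrand (RtoC q) t = RtoC (exp ((q - 1) * ln t) * exp (- t)).
Proof.
intros Ht. unfold gamma_integrand. rewrite Cpower_R //.
replace ((q - 1) * ln t)%C with (RtoC ((q - 1) * ln t)).
- by rewrite Cexp_R RtoC_mult.
- by rewrite RtoC_mult RtoC_minus.
Qed.

Lemma CGamma_R_pos (q : R) : 0 < q -> 0 < Re (CGamma q).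
Proof.
intros Hq. apply (halfint_pos (gamma_integrand q)).
- by apply halfint_gamma.
- intros x Hx. rewrite gamma_integrand_R //. simpl. apply Rmult_lt_0_compat; apply exp_pos.
Qed.

Lemma halfint_le (f g : R -> C) (a b : C) : is_halfint f a -> is_halfint g b ->
  (forall x, 0 < x -> Re (f x) <= Re (g x)) -> Re a <= Re b.
Proof.
intros Hf Hg H.
assert (K : 0 <= Re (b + (-1)%R * a)%C).
{ apply (halfint_nonneg (fun t => g t + (-1)%R * f t)%C).
  - apply halfint_plus => //. by apply halfint_scal.
  - intros x Hx. pose proof (H x Hx). unfold Re in *. simpl. lra. }
unfold Re in *. simpl in K. lra.
Qed.

(** With [c = Re k - 1], the integrand of [c^(-i Im k) Gamma(k)] has real part
    [t^c e^(-t) cos (Im k * ln (t/c))]; since [cos x >= 1 - x^2/2] and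
    [ln(t/c)^2 <= (t-c)^2/(tc)], the integral is at least
    [Gamma(c) (c - (Im k)^2/2)]. *)
Lemma CGamma_neq_0_large (k : C) : 1 + Im k ^ 2 < Re k -> CGamma k <> 0.
Proof.
intros Hk HG. set (c := Re k - 1). set (y := Im k).
assert (Hy : y ^ 2 < c) by (unfold c, y; lra).
assert (Hc : 0 < c) by (pose proof (pow2_ge_0 y); lra).
assert (Hk0 : 0 < Re k) by (unfold c in Hc; lra).
(* [t^(c-1) (t-c)^2] expanded into Gamma integrands *)
set (g := fun t => (gamma_integrand (c + 1) t + (- (y ^ 2 / (2 * c)))%R *
  (gamma_integrand (c + 1 + 1) t + ((- (2 * c))%R * gamma_integrand (c + 1) t + (c ^ 2)%R * gamma_integrand c t)))%C).
set (f := fun t => (Cexp (RtoC (- (y * ln c)) * Ci) * gamma_integrand k t)%C).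
assert (H1 : is_halfint f (Cexp (RtoC (- (y * ln c)) * Ci) * CGamma k)%C).
{ apply halfint_scal. by apply halfint_gamma. }
assert (H2 : is_halfint g (CGamma (c + 1) + (- (y ^ 2 / (2 * c)))%R *
  (CGamma (c + 1 + 1) + ((- (2 * c))%R * CGamma (c + 1) + (c ^ 2)%R * CGamma c)))%C).
{ apply halfint_plus; [apply halfint_gamma; simpl; lra|].
  apply halfint_scal. apply halfint_plus; [apply halfint_gamma; simpl; lra|].
  apply halfint_plus; apply halfint_scal; apply halfint_gamma; simpl; lra. }
assert (K := halfint_le _ _ _ _ H2 H1). rewrite HG Cmult_0_r in K.
rewrite (CGamma_succ (c + 1)) in K; last by simpl; lra.
rewrite !(CGamma_succ c) in K => //.
pose proof (CGamma_R_pos c Hc) as P.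
assert (K' : Re (CGamma c) * (c - y ^ 2 / 2) <= 0).
{ replace (Re (CGamma c) * (c - y ^ 2 / 2)) with (Re (c * CGamma c + (- (y ^ 2 / (2 * c)))%R *
   ((c + 1) * (c * CGamma c) + ((- (2 * c))%R * (c * CGamma c) + (c ^ 2)%R * CGamma c)))%C).
  - apply K. intros x Hx. unfold f, g.
    rewrite -!RtoC_plus !gamma_integrand_R //.
    unfold gamma_integrand. rewrite Cpower_R // Cmult_assoc -Cexp_plus.
    unfold Cexp. simpl.
    replace (fst k) with (c + 1) by (unfold c, Re; ring).
    replace (snd k) with y by reflexivity.
    set (X := ln x). set (L := X - ln c).
    match goal with |- context [cos ?u] => replace (cos u) with (cos (y * L)) by (f_equal; unfold L; ring) end.
    match goal with |- context [exp ?u * cos (y * L)] => replace (exp u) with (exp (c * X)) by (f_equal; ring) end.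
    replace ((c + 1 - 1) * X) with (c * X) by ring.
    replace ((c + 1 + 1 - 1) * X) with (c * X + X) by ring.
    replace ((c - 1) * X) with (c * X - X) by ring.
    unfold Rminus at 2 3 4. rewrite !exp_plus. rewrite !exp_Ropp.
    replace (exp X) with x by (unfold X; rewrite exp_ln //).
    pose proof (one_minus_sq_le_cos (y * L)) as C1.
    pose proof (sq_le_cosh L) as C2.
    replace (exp L) with (x / c) in C2 by (unfold L, X, Rminus; rewrite exp_plus exp_Ropp !exp_ln //).
    replace (exp (- L)) with (c / x) in C2
      by (unfold L, X; rewrite Ropp_minus_distr; unfold Rminus; rewrite exp_plus exp_Ropp !exp_ln //).
    pose proof (exp_pos (c * X)) as P1. pose proof (Rinv_0_lt_compat _ (exp_pos x)) as P2.
    set (A := exp (c * X)) in *. set (B := / exp x) in *.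
    assert (C3 : 1 - y ^ 2 / 2 * (x / c - 2 + c / x) <= cos (y * L)).
    { apply Rle_trans with (2 := C1). pose proof (pow2_ge_0 y).
      replace ((y * L) ^ 2) with (y ^ 2 * L ^ 2) by ring. nra. }
    assert (C4 : A * B * (1 - y ^ 2 / 2 * (x / c - 2 + c / x)) <= A * B * cos (y * L)).
    { apply Rmult_le_compat_l => //. nra. }
    eapply Rle_trans; [|eapply Rle_trans; [exact C4|]]; apply Req_le; [field; lra|ring].
  - destruct (CGamma c) as [u v]. simpl. field. lra. }
assert (0 < c - y ^ 2 / 2) by (pose proof (pow2_ge_0 y); lra).
nra.
Qed.

(** A zero at [k] would propagate to all the [k + n] by the functional
    equation, up to the region of [CGamma_neq_0_large]. *)
Lemma CGamma_neq_0 (k : C) : 0 < Re k -> CGamma k <> 0.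
Proof.
intros Hk H0.
assert (K : forall n : nat, CGamma (k + INR n)%C = 0).
{ intros n. induction n as [|n IH].
  - simpl. by replace (k + 0)%C with k by ring.
  - rewrite S_INR RtoC_plus Cplus_assoc CGamma_succ.
    + rewrite IH. ring.
    + simpl. pose proof (pos_INR n). unfold Re in *. lra. }
destruct (INR_unbounded (1 + Im k ^ 2)) as [n Hn].
apply (CGamma_neq_0_large (k + INR n)) => //.
simpl. rewrite -> Rplus_0_r. unfold Re, Im in *. simpl in Hn. lra.
Qed.

(** * The eta series as an integral *)

Lemma filterlim_scal_0 (a : R) : 0 < a -> filterlim (fun t => a * t) (at_right 0) (at_right 0).
Proof.
intros Ha P [d Hd].
assert (h : 0 < d / a) by (apply Rdiv_lt_0_compat => //; apply cond_pos).
apply: filter_imp (filter_and _ _ at_right_pos (at_right_lt (d / a) h)).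
intros t [Ht Ht']. apply Hd.
- ball_simpl.
  apply Rlt_div_r in Ht' => //. rewrite Ropp_0 Rplus_0_r Rabs_pos_eq; nra.
- nra.
Qed.

Lemma filterlim_scal_oo (a : R) : 0 < a ->
  filterlim (fun t => a * t) at_oo at_oo.
Proof.
intros Ha P [M HM].
apply: filter_imp (p_infty_gt (M / a)). intros t Ht. apply HM.
apply Rlt_div_l in Ht => //. lra.
Qed.

Lemma is_Cderive_comp_R (F : R -> C) (f : R -> R) (x d : R) (l : C) :
  is_Cderive F (f x) l -> is_derive f x d -> is_Cderive (fun t => F (f t)) x (d * l)%C.
Proof.
intros [A B] H. split.
- replace (Re (d * l)%C) with (scal d (Re l)).
  + apply (is_derive_comp (fun t => Re (F t)) f) => //.
  + unfold scal; simpl; unfold mult; simpl. unfold Re. ring.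
- replace (Im (d * l)%C) with (scal d (Im l)).
  + apply (is_derive_comp (fun t => Im (F t)) f) => //.
  + unfold scal; simpl; unfold mult; simpl. unfold Im. ring.
Qed.

(** The Gamma integral after the substitution [t -> a t]. *)
Lemma gamma_scaled (k : C) (a : R) : 0 < Re k -> 0 < a -> exists (F : R -> C) (la lb : C),
  (forall x, 0 < x -> is_Cderive F x (Cpower (RtoC x) k * RtoC (exp (- (a * x))))%C) /\
  Clim (at_right 0) F la /\ Clim at_oo F lb /\
  (lb - la)%C = (CGamma (k + 1) / Cpower (RtoC a) (k + 1))%C.
Proof.
intros Hk Ha.
destruct (halfint_gamma (k + 1)) as [F [la [lb [H1 [H2 [H3 H4]]]]]].
{ unfold Re in *; simpl; lra. }
set (c := (/ Cpower (RtoC a) (k + 1))%C).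
exists (fun t => F (a * t)%R * c)%C, (la * c)%C, (lb * c)%C.
assert (a_nz : RtoC a <> 0) by (apply RtoC_neq_0; lra).
split; [|split; [|split]].
- intros x Hx. assert (Hax : 0 < a * x) by nra.
  eapply is_Cderive_eq.
  + apply: is_Cderive_mult; [|apply: is_Cderive_const].
    apply: (is_Cderive_comp_R F (fun t => a * t) x a).
    * by apply H1.
    * auto_derive => //. ring.
  + cbv beta. unfold gamma_integrand, c. replace (k + 1 - 1)%C with k by ring.
    rewrite RtoC_mult Cpower_scal //; last by apply RtoC_neq_0; lra.
    rewrite Cpower_plus Cpower_1 //. field. split => //. apply Cpower_neq_0.
- apply: Clim_mult; [|apply: Clim_const]. apply: Clim_comp; [by apply filterlim_scal_0|exact H2].
- apply: Clim_mult; [|apply: Clim_const]. apply: Clim_comp; [by apply filterlim_scal_oo|exact H3].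
- rewrite H4. unfold c, Cdiv. ring.
Qed.

Lemma halfint_gamma_scaled (k : C) (a : R) : 0 < Re k -> 0 < a ->
  is_halfint (fun t => Cpower (RtoC t) k * RtoC (exp (- (a * t))))%C
    (CGamma (k + 1) / Cpower (RtoC a) (k + 1))%C.
Proof.
intros Hk Ha. destruct (gamma_scaled k a Hk Ha) as [F [la [lb [H1 [H2 [H3 H4]]]]]].
by exists F, la, lb.
Qed.

Lemma halfint_dominated_pow (s a A : R) (f : R -> C) : 0 < s -> 0 < a ->
  (forall x, 0 < x -> Clim (locally x) f (f x)) ->
  (forall x, 0 < x -> Cmod (f x) <= A * (exp (s * ln x) * exp (- (a * x)))) ->
  exists l, is_halfint f l /\ Cmod l <= 2 * (A * (Re (CGamma (RtoC (s + 1))) * exp (- ((s + 1) * ln a)))).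
Proof.
intros Hs Ha Hc Hf.
destruct (gamma_scaled s a Hs Ha) as [F [la [lb [H1 [[H2 _] [[H3 _] H4]]]]]].
destruct (halfint_dominated f (fun x => A * (exp (s * ln x) * exp (- (a * x)))) (fun x => A * Re (F x))
  (A * Re la) (A * Re lb)) as [l [Hl Hb]] => //.
- intros x Hx. destruct (H1 x Hx) as [D _].
  replace (A * (exp (s * ln x) * exp (- (a * x)))) with
    (A * Re (Cpower x s * RtoC (exp (- (a * x))))%C).
  + apply: (is_derive_scal (fun t => Re (F t))). exact D.
  + f_equal. rewrite Cpower_R // -RtoC_mult Cexp_R. simpl. ring.
- apply: Rlim_mult => //. apply: filterlim_const.
- apply: Rlim_mult => //. apply: filterlim_const.
- exists l. split => //. eapply Rle_trans; [exact Hb|]. apply Req_le.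
  assert (E : Re lb - Re la = Re (CGamma (RtoC (s + 1))) * exp (- ((s + 1) * ln a))).
  { transitivity (Re (lb - la)%C); [by destruct la, lb|]. rewrite H4 -RtoC_plus.
    rewrite Cpower_R // -RtoC_mult Cexp_R exp_Ropp. unfold Cdiv.
    rewrite -RtoC_inv; last by (apply Rgt_not_eq, exp_pos). destruct (CGamma (s + 1)%R). simpl. ring. }
  rewrite -E. ring.
Qed.

(** This is [e^t / (e^t + 1)^2], the opposite of the derivative of
    [1 / (e^t + 1)] and the sum of the [(-1)^n (n+1) e^(-(n+1) t)]. *)
Definition kernel (t : R) : R := exp (- t) / (1 + exp (- t)) ^ 2.

(** The remainder of that series after [N] terms, in closed form. *)
Definition kernel_tail (N : nat) (t : R) : R :=
  (-1) ^ N * exp (- (INR N * t)) * exp (- t) * (INR N / (1 + exp (- t)) + / (1 + exp (- t)) ^ 2).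

Lemma kernel_tail_0 (t : R) : kernel_tail 0 t = kernel t.
Proof.
unfold kernel_tail, kernel. simpl. rewrite Rmult_0_l Ropp_0 exp_0.
pose proof (exp_pos (- t)). field. lra.
Qed.

Lemma kernel_tail_S (N : nat) (t : R) :
  kernel_tail N t - kernel_tail (S N) t = (-1) ^ N * (INR (S N) * exp (- (INR (S N) * t))).
Proof.
unfold kernel_tail. rewrite !S_INR. simpl.
replace (- ((INR N + 1) * t)) with (- (INR N * t) + - t) by ring. rewrite exp_plus.
pose proof (exp_pos (- t)). field. lra.
Qed.

Lemma kernel_tail_bound (N : nat) (t : R) : 0 < t ->
  Rabs (kernel_tail N t) <= (INR N + 1) * exp (- (INR N * t)).
Proof.
intros Ht. unfold kernel_tail. rewrite !Rabs_mult pow_1_abs Rmult_1_l.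
pose proof (exp_pos (- t)) as P. pose proof (exp_pos (- (INR N * t))) as P'.
rewrite (Rabs_pos_eq (exp (- (INR N * t)))); [|lra]. rewrite (Rabs_pos_eq (exp (- t))); [|lra].
assert (exp (- t) <= 1) by (rewrite -exp_0; apply exp_le_compat; lra).
pose proof (pos_INR N) as PN.
assert (A : / (1 + exp (- t)) <= 1) by (rewrite -{2}Rinv_1; apply Rinv_le_contravar; lra).
assert (A' : 0 < / (1 + exp (- t))) by (apply Rinv_0_lt_compat; lra).
assert (B : INR N / (1 + exp (- t)) + / (1 + exp (- t)) ^ 2 <= INR N + 1).
{ rewrite -pow_inv. unfold Rdiv. nra. }
assert (B' : 0 <= INR N / (1 + exp (- t)) + / (1 + exp (- t)) ^ 2).
{ rewrite -pow_inv. unfold Rdiv. nra. }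
rewrite Rabs_pos_eq => //. set (u := _ + _) in *.
rewrite Rmult_assoc Rmult_comm. apply Rmult_le_compat_r; [lra|]. nra.
Qed.

Lemma kernel_tail_cont (N : nat) (x : R) : continuous (kernel_tail N) x.
Proof.
apply: (ex_derive_cont). unfold kernel_tail. auto_derive.
pose proof (exp_pos (- x)). repeat split; nra.
Qed.

(** Each term of the eta series is a Gamma integral after scaling:
    [Gamma(k+1) (n+1)^(-k)] is the integral of [t^k (n+1) e^(-(n+1) t)]. *)
Lemma halfint_partial_eta (k I : C) : 0 < Re k ->
  is_halfint (fun t => Cpower (RtoC t) k * RtoC (kernel t))%C I ->
  forall N, is_halfint (fun t => Cpower (RtoC t) k * RtoC (kernel_tail (S N) t))%C
    (I - CGamma (k + 1) * Csum (eta_term k) N)%C.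
Proof.
intros Hk HI.
assert (K : forall N J, is_halfint (fun t => Cpower (RtoC t) k * RtoC (kernel_tail N t))%C J ->
  is_halfint (fun t => Cpower (RtoC t) k * RtoC (kernel_tail (S N) t))%C (J - CGamma (k + 1) * eta_term k N)%C).
{ intros N J HJ.
  assert (HN : 0 < INR (S N)) by apply lt_0_INR, Nat.lt_0_succ.
  apply (halfint_ext (fun t => Cpower (RtoC t) k * RtoC (kernel_tail N t) +
    RtoC (- ((-1) ^ N * INR (S N))) * (Cpower (RtoC t) k * RtoC (exp (- (INR (S N) * t)))))%C).
  - intros x Hx.
    replace (kernel_tail (S N) x) with
      (kernel_tail N x - (-1) ^ N * (INR (S N) * exp (- (INR (S N) * x))))
      by (rewrite -kernel_tail_S; ring).
    rewrite !(RtoC_minus, RtoC_opp, RtoC_mult). ring.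
  - replace (J - CGamma (k + 1) * eta_term k N)%C with (J + RtoC (- ((-1) ^ N * INR (S N))) *
      (CGamma (k + 1) / Cpower (RtoC (INR (S N))) (k + 1)))%C.
    + apply halfint_plus => //. apply halfint_scal. by apply halfint_gamma_scaled.
    + unfold eta_term. rewrite Cpower_plus Cpower_1; last by apply RtoC_neq_0; lra.
      rewrite !(RtoC_opp, RtoC_mult). field. split; [apply Cpower_neq_0|apply RtoC_neq_0; lra]. }
induction N as [|N IH].
- rewrite sum_O. apply K. apply: halfint_ext HI. intros x _. by rewrite kernel_tail_0.
- rewrite sum_Sn. replace (I - _)%C with
    (I - CGamma (k + 1) * Csum (eta_term k) N - CGamma (k + 1) * eta_term k (S N))%C.
  + by apply K.
  + unfold plus; simpl. ring.
Qed.

Lemma kernel_int_ex (k : C) : 0 < Re k ->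
  exists I, is_halfint (fun t => Cpower (RtoC t) k * RtoC (kernel t))%C I.
Proof.
intros Hk.
destruct (halfint_dominated_pow (Re k) 1 1 (fun t => Cpower (RtoC t) k * RtoC (kernel t))%C) as [I [HI _]] => //.
- lra.
- intros x Hx. apply: Clim_mult.
  + apply: is_Cderive_Clim. by apply is_Cderive_Cpower_R.
  + apply: Clim_RtoC. apply: (ex_derive_cont). unfold kernel. auto_derive.
    pose proof (exp_pos (- x)). repeat split; nra.
- intros x Hx. rewrite Cmod_mult Cmod_Cpower_R // Cmod_R !Rmult_1_l.
  apply Rmult_le_compat_l; first by left; apply exp_pos.
  unfold kernel. pose proof (exp_pos (- x)).
  rewrite Rabs_pos_eq; last by (apply Rdiv_le_0_compat; nra).
  apply Rle_div_l; nra.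
- by exists I.
Qed.

Lemma lim_INR_pow (d : R) : 0 < d -> filterlim (fun n => exp (- d * ln (INR n + 1))) eventually (locally 0).
Proof.
intros Hd. apply filterlim_locally. intros eps.
destruct (INR_unbounded (exp (- ln eps / d))) as [M HM].
exists M. intros N HN.
ball_simpl.
rewrite Ropp_0 Rplus_0_r Rabs_pos_eq; last by left; apply exp_pos.
rewrite -(exp_ln eps); last by apply cond_pos. apply exp_increasing.
apply le_INR in HN.
assert (K : - ln eps / d < ln (INR N + 1)).
{ rewrite -(ln_exp (- ln eps / d)). apply ln_increasing; [apply exp_pos|lra]. }
apply Rlt_div_l in K => //. lra.
Qed.

(** The remainder after [N] terms is at most a constant times
    [(N+1) N^(-1-s)], which tends to zero for [s = Re k > 0]. *)
Lemma eta_series (k I : C) : 0 < Re k ->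
  is_halfint (fun t => Cpower (RtoC t) k * RtoC (kernel t))%C I ->
  is_Cseries (eta_term k) (I / CGamma (k + 1))%C.
Proof.
intros Hk HI. apply is_series_Clim.
assert (HG : CGamma (k + 1) <> 0) by (apply CGamma_neq_0; unfold Re in *; simpl; lra).
set (H := Csum (eta_term k)).
apply (Clim_ext_loc _ (fun N => (I - (I - CGamma (k + 1) * H N)) / CGamma (k + 1))%C).
{ apply filter_forall. intros N. field. exact HG. }
apply: Clim_div => //; last by apply: Clim_const.
replace I with (I - RtoC 0)%C at 1 by ring.
apply: Clim_minus; first by apply: Clim_const.
set (g := Re (CGamma (RtoC (Re k + 1)))).
assert (Hg : 0 < g) by (apply CGamma_R_pos; lra).
apply (Clim_squeeze _ _ _ (fun N => 4 * g * exp (- (Re k * ln (INR N + 1))))).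
- apply filter_forall. intros N.
  pose proof (halfint_partial_eta k I Hk HI N) as HN. fold H in HN.
  assert (PN : 0 < INR (S N)) by apply lt_0_INR, Nat.lt_0_succ.
  destruct (halfint_dominated_pow (Re k) (INR (S N)) (INR (S N) + 1) _ Hk PN
    ltac:(intros x Hx; apply: Clim_mult;
      [apply: is_Cderive_Clim; by apply is_Cderive_Cpower_R|
       apply: Clim_RtoC; exact (kernel_tail_cont (S N) x)])
    ltac:(intros x Hx; rewrite Cmod_mult Cmod_Cpower_R // Cmod_R;
      rewrite (Rmult_comm (INR (S N) + 1)) Rmult_assoc;
      apply Rmult_le_compat_l; [left; apply exp_pos|];
      rewrite Rmult_comm; by apply kernel_tail_bound)) as [l [Hl Hb]].
  rewrite (halfint_unique _ _ _ HN Hl).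
  replace (l - 0)%C with l by ring.
  eapply Rle_trans; [exact Hb|]. fold g.
  rewrite -(S_INR N).
  replace (- ((Re k + 1) * ln (INR (S N)))) with (- (Re k * ln (INR (S N))) + - ln (INR (S N))) by ring.
  rewrite exp_plus (exp_Ropp (ln _)) exp_ln //.
  pose proof (exp_pos (- (Re k * ln (INR (S N))))) as P. set (e := exp (- (Re k * ln (INR (S N))))) in *.
  assert (1 <= INR (S N)) by (rewrite S_INR; pose proof (pos_INR N); lra).
  replace (2 * ((INR (S N) + 1) * (g * (e * / INR (S N))))) with
    (2 * (g * e) * ((INR (S N) + 1) / INR (S N))) by (field; lra).
  replace (4 * g * e) with (2 * (g * e) * 2) by ring.
  apply Rmult_le_compat_l; [nra|]. apply Rle_div_l; lra.
- rewrite -(Rmult_0_r (4 * g)). apply: Rlim_mult; first by apply: filterlim_const.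
  apply (filterlim_ext (fun N => exp (- Re k * ln (INR N + 1)))); last by apply lim_INR_pow.
  intros N. f_equal. ring.
Qed.

(** * Removable singularities of the exponential *)

Lemma Cmod_le_sum (z : C) : Cmod z <= Rabs (Re z) + Rabs (Im z).
Proof.
replace z with (RtoC (Re z) + Ci * RtoC (Im z))%C at 1.
- eapply Rle_trans; [apply Cmod_triangle|]. rewrite Cmod_mult Cmod_Ci !Cmod_R. lra.
- destruct z; apply injective_projections; simpl; ring.
Qed.

Lemma Cmean_value_gen (F f : R -> C) (G g : R -> R) (a b : R) : a <= b ->
  (forall x, a <= x <= b -> is_Cderive F x (f x)) ->
  (forall x, a <= x <= b -> is_derive G x (g x)) ->
  (forall x, a <= x <= b -> Cmod (f x) <= g x) -> Cmod (F b - F a) <= 2 * (G b - G a).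
Proof.
intros Hab Hd HG Hb.
assert (K : forall h dh : R -> R, (forall x, a <= x <= b -> is_derive h x (dh x)) ->
  (forall x, a <= x <= b -> Rabs (dh x) <= g x) -> Rabs (h b - h a) <= G b - G a).
{ intros h dh H1 H2.
  assert (A1 : G a - h a <= G b - h b).
  { apply (derive_nonneg_incr (fun t => G t - h t) (fun t => g t - dh t)); first lra.
    - intros x Hx. apply: (is_derive_minus G h); [by apply HG|by apply H1].
    - intros x Hx. pose proof (H2 x Hx) as A. apply Rabs_le_between in A. lra. }
  assert (A2 : G a + h a <= G b + h b).
  { apply (derive_nonneg_incr (fun t => G t + h t) (fun t => g t + dh t)); first lra.
    - intros x Hx. apply: (is_derive_plus G h); [by apply HG|by apply H1].
    - intros x Hx. pose proof (H2 x Hx) as A. apply Rabs_le_between in A. lra. }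
  apply Rabs_le_between. lra. }
eapply Rle_trans; [apply Cmod_le_sum|].
assert (A := K (fun t => Re (F t)) (fun t => Re (f t)) (fun x Hx => proj1 (Hd x Hx))
  (fun x Hx => Rle_trans _ _ _ (re_le_Cmod (f x)) (Hb x Hx))).
assert (B := K (fun t => Im (F t)) (fun t => Im (f t)) (fun x Hx => proj2 (Hd x Hx))
  (fun x Hx => Rle_trans _ _ _ (Rle_trans _ _ _ (Rmax_r _ _) (Rmax_Cmod (f x))) (Hb x Hx))).
replace (Re (F b - F a)%C) with (Re (F b) - Re (F a)) by (destruct (F b), (F a); reflexivity).
replace (Im (F b - F a)%C) with (Im (F b) - Im (F a)) by (destruct (F b), (F a); reflexivity).
lra.
Qed.

Lemma Cmean_value (F f : R -> C) (M : R) :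
  (forall x, 0 <= x <= 1 -> is_Cderive F x (f x)) ->
  (forall x, 0 <= x <= 1 -> Cmod (f x) <= M) -> Cmod (F 1 - F 0) <= 2 * M.
Proof.
intros Hd Hb. replace (2 * M) with (2 * (M * 1 - M * 0)) by ring.
apply (Cmean_value_gen F f (fun x => M * x) (fun _ => M)) => //; first lra.
intros x _. auto_derive => //. ring.
Qed.

Lemma is_Cderive_line (z : C) (x : R) : is_Cderive (fun t => RtoC t * z)%C x z.
Proof.
eapply is_Cderive_eq.
- apply: is_Cderive_mult; [apply is_Cderive_id|apply: is_Cderive_const].
- cbv beta. ring.
Qed.

Lemma Cmod_line (x : R) (z : C) : 0 <= x <= 1 -> Cmod (RtoC x * z) <= Cmod z.
Proof. intros Hx. rewrite Cmod_mult Cmod_R Rabs_pos_eq; last lra. pose proof (Cmod_ge_0 z). nra. Qed.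

(** The three Taylor estimates are obtained from one another by the mean value
    inequality on the segment from [0] to [z]; each application doubles the
    constant, which starts from [e <= 3]. *)
Lemma Cexp_taylor_1 (z : C) : Cmod z <= 1 -> Cmod (Cexp z - 1) <= 6 * Cmod z.
Proof.
intros Hz.
replace (Cexp z - 1)%C with (Cexp (RtoC 1 * z) - Cexp (RtoC 0 * z))%C.
2: { by rewrite Cmult_1_l Cmult_0_l Cexp_0. }
replace (6 * Cmod z) with (2 * (3 * Cmod z)) by ring.
apply (Cmean_value (fun t => Cexp (RtoC t * z)) (fun t => z * Cexp (RtoC t * z))%C).
- intros x Hx. apply: is_Cderive_Cexp. apply is_Cderive_line.
- intros x Hx. rewrite Cmod_mult Cmod_Cexp Rmult_comm.
  apply Rmult_le_compat_r; first by apply Cmod_ge_0.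
  eapply Rle_trans; [|exact exp_le_3]. apply exp_le_compat.
  eapply Rle_trans; [apply Rle_abs|]. eapply Rle_trans; [apply re_le_Cmod|].
  pose proof (Cmod_line x z Hx). lra.
Qed.

Lemma Cexp_taylor_2 (z : C) : Cmod z <= 1 -> Cmod (Cexp z - 1 - z) <= 12 * Cmod z ^ 2.
Proof.
intros Hz.
replace (Cexp z - 1 - z)%C with ((Cexp (RtoC 1 * z) - RtoC 1 * z) - (Cexp (RtoC 0 * z) - RtoC 0 * z))%C.
2: { rewrite Cmult_1_l Cmult_0_l Cexp_0. ring. }
replace (12 * Cmod z ^ 2) with (2 * (Cmod z * (6 * Cmod z))) by ring.
apply (Cmean_value (fun t => Cexp (RtoC t * z) - RtoC t * z)%C (fun t => z * (Cexp (RtoC t * z) - 1))%C).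
- intros x Hx. eapply is_Cderive_eq.
  + apply: is_Cderive_minus; [apply: is_Cderive_Cexp|]; apply is_Cderive_line.
  + cbv beta. ring.
- intros x Hx. rewrite Cmod_mult. apply Rmult_le_compat_l; first by apply Cmod_ge_0.
  pose proof (Cmod_line x z Hx).
  eapply Rle_trans; [apply Cexp_taylor_1|]; lra.
Qed.

Lemma Cexp_taylor_3 (z : C) : Cmod z <= 1 -> Cmod (Cexp z - 1 - z - z * z / 2) <= 24 * Cmod z ^ 3.
Proof.
intros Hz.
replace (Cexp z - 1 - z - z * z / 2)%C with
  ((Cexp (RtoC 1 * z) - RtoC 1 * z - (RtoC 1 * z) * (RtoC 1 * z) / 2) -
   (Cexp (RtoC 0 * z) - RtoC 0 * z - (RtoC 0 * z) * (RtoC 0 * z) / 2))%C.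
2: { rewrite !Cmult_1_l !Cmult_0_l Cexp_0. unfold Cdiv. ring. }
replace (24 * Cmod z ^ 3) with (2 * (Cmod z * (12 * Cmod z ^ 2))) by ring.
apply (Cmean_value (fun t => Cexp (RtoC t * z) - RtoC t * z - (RtoC t * z) * (RtoC t * z) / 2)%C
  (fun t => z * (Cexp (RtoC t * z) - 1 - RtoC t * z))%C).
- intros x Hx. eapply is_Cderive_eq.
  + apply: is_Cderive_minus.
    * apply: is_Cderive_minus; [apply: is_Cderive_Cexp|]; apply is_Cderive_line.
    * apply: is_Cderive_mult; [apply: is_Cderive_mult; apply is_Cderive_line|apply: is_Cderive_const].
  + cbv beta. field.
- intros x Hx. rewrite Cmod_mult. apply Rmult_le_compat_l; first by apply Cmod_ge_0.
  pose proof (Cmod_line x z Hx). pose proof (Cmod_ge_0 (RtoC x * z)).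
  eapply Rle_trans; [apply Cexp_taylor_2; lra|]. nra.
Qed.

(** The entire functions [(e^z - 1) / z] and [(e^z - 1 - z) / z^2]. *)
Definition expd1 (z : C) : C := match Ceq_dec z 0 with left _ => 1 | right _ => ((Cexp z - 1) / z)%C end.
Definition expd2 (z : C) : C := match Ceq_dec z 0 with left _ => (1 / 2)%C | right _ => ((Cexp z - 1 - z) / (z * z))%C end.

Lemma expd1_neq (z : C) : z <> 0 -> expd1 z = ((Cexp z - 1) / z)%C.
Proof. intros H. unfold expd1. by destruct Ceq_dec. Qed.

Lemma expd2_neq (z : C) : z <> 0 -> expd2 z = ((Cexp z - 1 - z) / (z * z))%C.
Proof. intros H. unfold expd2. by destruct Ceq_dec. Qed.

Lemma expd1_0 : expd1 0 = 1.
Proof. unfold expd1. by destruct Ceq_dec. Qed.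

Lemma expd2_0 : expd2 0 = (1 / 2)%C.
Proof. unfold expd2. by destruct Ceq_dec. Qed.

Lemma Clim_Cmod_le {T} (F : (T -> Prop) -> Prop) {FF : Filter F} (f : T -> C) :
  Clim F f 0 -> F (fun t => Cmod (f t) <= 1).
Proof.
intros H. apply (Clim_Cmod F f 0 H (fun x => x <= 1)).
rewrite Cmod_0. apply: filter_imp (open_lt 1 0 Rlt_0_1). intros x Hx. lra.
Qed.

Lemma Clim_expd1 {T} (F : (T -> Prop) -> Prop) {FF : Filter F} (f : T -> C) :
  Clim F f 0 -> Clim F (fun t => expd1 (f t)) 1.
Proof.
intros H.
apply (Clim_squeeze _ _ _ (fun t => 12 * Cmod (f t))).
- apply: filter_imp (Clim_Cmod_le _ _ H). intros t Ht.
  destruct (Ceq_dec (f t) 0) as [E|Hf].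
  + rewrite E expd1_0.
    replace (1 - 1)%C with (RtoC 0) by ring. rewrite Cmod_0. lra.
  + rewrite expd1_neq //.
    replace ((Cexp (f t) - 1) / f t - 1)%C with ((Cexp (f t) - 1 - f t) / f t)%C by (field; done).
    rewrite Cmod_div //. apply Cmod_gt_0 in Hf. apply Rle_div_l => //.
    pose proof (Cexp_taylor_2 _ Ht). lra.
- rewrite -(Rmult_0_r 12). apply: Rlim_mult; first by apply: filterlim_const.
  rewrite -Cmod_0. by apply: Clim_Cmod.
Qed.

Lemma Clim_expd2 {T} (F : (T -> Prop) -> Prop) {FF : Filter F} (f : T -> C) :
  Clim F f 0 -> Clim F (fun t => expd2 (f t)) (1 / 2)%C.
Proof.
intros H.
apply (Clim_squeeze _ _ _ (fun t => 24 * Cmod (f t))).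
- apply: filter_imp (Clim_Cmod_le _ _ H). intros t Ht.
  destruct (Ceq_dec (f t) 0) as [E|Hf].
  + rewrite E expd2_0.
    replace (1 / 2 - 1 / 2)%C with (RtoC 0) by ring. rewrite Cmod_0. lra.
  + rewrite expd2_neq //.
    replace ((Cexp (f t) - 1 - f t) / (f t * f t) - 1 / 2)%C with
      ((Cexp (f t) - 1 - f t - f t * f t / 2) / (f t * f t))%C
      by (field; done).
    rewrite Cmod_div; last by (apply Cmult_neq_0).
    rewrite Cmod_mult. apply Cmod_gt_0 in Hf. apply Rle_div_l; first nra.
    pose proof (Cexp_taylor_3 _ Ht). lra.
- rewrite -(Rmult_0_r 24). apply: Rlim_mult; first by apply: filterlim_const.
  rewrite -Cmod_0. by apply: Clim_Cmod.
Qed.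

Lemma Clim_neq {T} (F : (T -> Prop) -> Prop) {FF : Filter F} (f : T -> C) (l c : C) :
  Clim F f l -> l <> c -> F (fun t => f t <> c).
Proof.
intros H Hn.
assert (K : filterlim (fun t => Cmod (f t - c)) F (locally (Cmod (l - c)))).
{ apply: Clim_Cmod. apply: Clim_minus => //. apply: Clim_const. }
assert (P : 0 < Cmod (l - c)).
{ apply Cmod_gt_0. intros E. apply Hn. replace l with (l - c + c)%C by ring. rewrite E. ring. }
assert (K2 : F (fun t => 0 < Cmod (f t - c))) by (apply K; exact (open_gt 0 _ P)).
apply: filter_imp K2. intros t Ht E. rewrite E in Ht.
replace (c - c)%C with (RtoC 0) in Ht by ring. rewrite Cmod_0 in Ht. lra.
Qed.

(** * The regularised integrand on the strip *)

Definition ipi : C := (Ci * RtoC PI)%C.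

Lemma ipi_neq_0 : ipi <> 0.
Proof. unfold ipi. intros E. apply (f_equal snd) in E. simpl in E. pose proof PI_RGT_0. lra. Qed.

Lemma Cexp_ipi : Cexp ipi = (- RtoC 1)%C.
Proof. unfold ipi. rewrite Cexp_Ci cos_PI sin_PI. apply injective_projections; simpl; ring. Qed.

(** [Cpower] has no meaning at [0], where the power tends to [0] when its
    exponent has positive real part. *)
Definition pow0 (t k : C) : C := match Ceq_dec t 0 with left _ => 0 | right _ => Cpower t k end.

Lemma pow0_neq (t k : C) : t <> 0 -> pow0 t k = Cpower t k.
Proof. intros H. unfold pow0. by destruct Ceq_dec. Qed.

(** [t^k] minus its Taylor polynomial of degree one at [ipi]. *)
Definition numer (k t : C) : C :=
  (pow0 t k - Cpower ipi k - k * Cpower ipi (k - 1) * (t - ipi))%C.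

(** The meromorphic extension of [kernel], with a double pole at [ipi]. *)
Definition Ckernel (t : C) : C := (Cexp t / ((Cexp t + 1) * (Cexp t + 1)))%C.

(** The value at [ipi], where [Ckernel] has a double pole and [numer] a double
    zero, is the limit. *)
Definition G (k t : C) : C :=
  match Ceq_dec t ipi with left _ => (- Cpower ipi (k - 2) * ((k * k - k) / 2))%C | right _ => (numer k t * Ckernel t)%C end.

Lemma Csub_eq (a b : C) : (a - b)%C = 0 -> a = b.
Proof. intros E. replace a with (a - b + b)%C by ring. rewrite E. ring. Qed.

Lemma G_neq (k t : C) : t <> ipi -> G k t = (numer k t * Ckernel t)%C.
Proof.
intros H. unfold G. by destruct Ceq_dec.
Qed.

Lemma G_ipi (k : C) : G k ipi = (- Cpower ipi (k - 2) * ((k * k - k) / 2))%C.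
Proof.
unfold G. by destruct Ceq_dec.
Qed.

(** With [w = log t - log (i pi)] and [v = t - i pi], both factors of [G] are
    expressed through the entire functions [expd1] and [expd2]. *)
Lemma G_near_ipi (k t : C) : k <> 0 -> t <> 0 -> t <> ipi ->
  let w := (Clog t - Clog ipi)%C in let v := (t - ipi)%C in
  expd1 v <> 0 -> expd1 w <> 0 ->
  G k t = (- Cpower ipi (k - 2) * Cexp v * (k * k * expd2 (k * w) - k * expd2 w) /
    (expd1 w * expd1 w * (expd1 v * expd1 v)))%C.
Proof.
intros Hk Ht Hti w v.
assert (Hv : v <> 0) by (intros E; apply Hti; by apply Csub_eq).
assert (Ew : (ipi * Cexp w)%C = t).
{ unfold w. rewrite Cexp_minus !Cexp_Clog //; last by apply ipi_neq_0. field. apply ipi_neq_0. }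
assert (Hw : w <> 0).
{ intros E. apply Hti. rewrite -Ew E Cexp_0. ring. }
assert (Hkw : (k * w)%C <> 0) by by apply Cmult_neq_0.
rewrite expd1_neq // expd1_neq // expd2_neq // expd2_neq // G_neq //.
unfold numer, Ckernel. rewrite pow0_neq //.
assert (Ep : Cpower t k = (Cpower ipi k * Cexp (k * w))%C).
{ unfold Cpower, w. rewrite -Cexp_plus. f_equal. ring. }
assert (Ee : Cexp t = (- Cexp v)%C).
{ replace t with (v + ipi)%C at 1 by (unfold v; ring).
  rewrite Cexp_plus Cexp_ipi. ring. }
assert (Ev : v = (ipi * (Cexp w - 1))%C) by (unfold v; rewrite -{1}Ew; ring).
replace (k - 2)%C with (k - 1 - 1)%C by ring.
rewrite !Cpower_minus_1 ?Ep ?Ee; try apply ipi_neq_0.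
pose proof ipi_neq_0 as Hi.
replace (t - ipi)%C with (ipi * (Cexp w - 1))%C by (rewrite -Ew; ring).
intros Hd1 Hd2.
assert (HD : (Cexp v - 1)%C <> 0) by (intros E; apply Hd1; rewrite E; unfold Cdiv; ring).
assert (HB : (Cexp w - 1)%C <> 0) by (intros E; apply Hd2; rewrite E; unfold Cdiv; ring).
assert (HD' : (- Cexp v + 1)%C <> 0).
{ intros E; apply HD. replace (Cexp v - 1)%C with (- (- Cexp v + 1))%C by ring. rewrite E. ring. }
clear Hd1 Hd2 Ee Ep Ew Hti.
set (D := Cexp v) in *. clearbody D. clearbody v. rewrite Ev. clear Ev Hv.
set (B := Cexp w) in *. set (A := Cexp (k * w)) in *. clearbody A B.
field. repeat split => //.
Qed.

Definition strip (t : C) : Prop := 0 <= Re t /\ 0 <= Im t <= PI.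

Lemma Clim_filterlim {T} (F : (T -> Prop) -> Prop) {FF : Filter F} (f : T -> C) (l : C) :
  Clim F f l -> filterlim f F (Clocally l).
Proof.
intros [A B]. apply (proj2 (filterlim_locally (U := C_UniformSpace) _ _)). intros eps.
apply: filter_imp (filter_and _ _ (proj1 (filterlim_locally _ _) A eps)
  (proj1 (filterlim_locally _ _) B eps)).
intros n [K1 K2]. split; assumption.
Qed.

Lemma Clim_id (t : C) : Clim (Clocally t) (fun z => z) t.
Proof.
split; apply filterlim_locally; intros eps; exists eps; intros z [A B]; assumption.
Qed.

Lemma Cexp_plus_1_neq_0 (t : C) : 0 <= Im t <= PI -> t <> ipi -> (Cexp t + 1)%C <> 0.
Proof.
destruct t as [s y]. unfold Re, Im. simpl. intros Hy Ht E.
unfold Cexp in E. simpl in E.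
pose proof (f_equal fst E) as E1. pose proof (f_equal snd E) as E2. simpl in E1, E2.
pose proof (exp_pos s) as P.
assert (S0 : sin y = 0) by nra.
assert (C1 : cos y < 0) by nra.
assert (Hy' : y = PI).
{ destruct (Rle_lt_or_eq_dec y PI) as [H|H] => //; first lra.
  destruct (Rle_lt_or_eq_dec 0 y) as [H'|H'] => //; first lra.
  - pose proof (sin_gt_0 y H' H). lra.
  - rewrite -H' cos_0 in C1. lra. }
rewrite Hy' cos_PI in E1.
assert (s = 0) by (apply exp_inv; rewrite exp_0; lra).
apply Ht. unfold ipi. apply injective_projections; simpl; lra.
Qed.

Lemma Cexp_plus_1_sq_neq_0 (t : C) : 0 <= Im t <= PI -> t <> ipi ->
  ((Cexp t + 1) * (Cexp t + 1))%C <> 0.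
Proof. intros. apply Cmult_neq_0; by apply Cexp_plus_1_neq_0. Qed.

Lemma Cmod_Cpower_le (t k : C) :
  Cmod (Cpower t k) <= exp (Rabs (Im k) * PI) * exp (Re k * ln (Cmod t)).
Proof.
rewrite Cmod_Cpower -exp_plus. apply exp_le_compat.
pose proof (Carg_bounds t) as B.
assert (H : Rabs (Carg t) <= PI) by (by apply Rabs_le).
assert (H' : - (Im k * Carg t) <= Rabs (Im k) * PI).
{ eapply Rle_trans; [apply Rle_abs|]. rewrite Rabs_Ropp Rabs_mult.
  apply Rmult_le_compat_l => //. apply Rabs_pos. }
lra.
Qed.

Lemma pow0_cont_0 (k : C) : 0 < Re k -> Clim (Clocally (RtoC 0)) (fun t => pow0 t k) 0.
Proof.
intros Hk. apply Clim_spec; first exact _.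
apply filterlim_locally. intros eps.
set (M := exp (Rabs (Im k) * PI)). assert (HM : 0 < M) by apply exp_pos.
assert (he : 0 < eps / M) by (apply Rdiv_lt_0_compat => //; apply cond_pos).
pose proof (proj1 (filterlim_locally _ _) (lim_pow_0 (Re k) Hk) (mkposreal _ he)) as [d Hd].
assert (HC := Clim_Cmod _ _ _ (Clim_id 0)). rewrite Cmod_0 in HC.
assert (HC2 : Clocally (RtoC 0) (fun t => Cmod t < d)).
{ apply (HC (fun x => x < d)). exact (open_lt d 0 (cond_pos d)). }
apply: filter_imp HC2. intros t Ht.
ball_simpl_all.
rewrite Ropp_0 Rplus_0_r Rabs_pos_eq; last by apply Cmod_ge_0.
replace (pow0 t k - 0)%C with (pow0 t k) by ring.
destruct (Ceq_dec t 0) as [E|E].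
- unfold pow0. destruct Ceq_dec => //. rewrite Cmod_0. apply cond_pos.
- rewrite pow0_neq //. pose proof E as E'. apply Cmod_gt_0 in E'.
  assert (K : Rabs (Cmod t + - 0) < d) by (rewrite Ropp_0 Rplus_0_r Rabs_pos_eq; lra).
  specialize (Hd (Cmod t) K E').
  rewrite Ropp_0 Rplus_0_r Rabs_pos_eq in Hd; last by left; apply exp_pos.
  eapply Rle_lt_trans; [apply Cmod_Cpower_le|]. fold M.
  apply Rlt_div_r in Hd => //. lra.
Qed.

Lemma strip_slit (t : C) : strip t -> t <> 0 -> slit t.
Proof.
destruct t as [s y]. unfold strip, slit, Re, Im; simpl. intros [H1 H2] Hn.
destruct (Rle_lt_or_eq_dec 0 s H1) as [|H]; first by left.
destruct (Rle_lt_or_eq_dec 0 y) as [|H']; first lra; first by right.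
exfalso. apply Hn. by rewrite -H -H'.
Qed.

Lemma pow0_cont (k t : C) : 0 < Re k -> strip t ->
  Clim (Clocally t) (fun z => pow0 z k) (pow0 t k).
Proof.
intros Hk Ht. destruct (Ceq_dec t 0) as [->|Hn].
- replace (pow0 0 k) with (RtoC 0); first by apply pow0_cont_0.
  unfold pow0. by destruct Ceq_dec.
- rewrite pow0_neq //. apply (Clim_ext_loc _ (fun z => Cpower z k)).
  + apply: filter_imp (Clim_neq _ _ _ 0 (Clim_id t) Hn). intros z Hz. by rewrite pow0_neq.
  + apply: Clim_Cpower; [by apply strip_slit|apply Clim_id].
Qed.

Lemma Ckernel_cont (t : C) : 0 <= Im t <= PI -> t <> ipi ->
  Clim (Clocally t) Ckernel (Ckernel t).
Proof.
intros H Hn. unfold Ckernel.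
assert (HE : Clim (Clocally t) Cexp (Cexp t)) by (apply: Clim_Cexp; apply Clim_id).
apply: Clim_div => //; first by apply Cexp_plus_1_sq_neq_0.
apply: Clim_mult; apply: Clim_plus => //; apply: Clim_const.
Qed.

Lemma strip_ipi : strip ipi.
Proof. unfold strip, ipi, Re, Im; simpl. pose proof PI_RGT_0. lra. Qed.

(** Near [ipi] this is [G_near_ipi].  Near [0] it holds because the modulus of
    [t^k] is at most a constant times the power [Re k] of that of [t]. *)
Lemma G_cont (k t : C) : 0 < Re k -> strip t ->
  Clim (Clocally t) (G k) (G k t).
Proof.
intros Hk Ht.
assert (Hk0 : k <> 0) by (intros E; rewrite E in Hk; simpl in Hk; lra).
destruct (Ceq_dec t ipi) as [->|Hn].
- rewrite G_ipi.
  set (w := fun z => (Clog z - Clog ipi)%C). set (v := fun z => (z - ipi)%C).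
  assert (Lw : Clim (Clocally ipi) w 0).
  { replace (RtoC 0) with (Clog ipi - Clog ipi)%C by ring.
    apply: Clim_minus; last by apply: Clim_const.
    apply: Clim_Clog; [apply strip_slit; [apply strip_ipi|apply ipi_neq_0]|apply Clim_id]. }
  assert (Lv : Clim (Clocally ipi) v 0).
  { replace (RtoC 0) with (ipi - ipi)%C by ring.
    apply: Clim_minus; [apply Clim_id|apply: Clim_const]. }
  assert (Lkw : Clim (Clocally ipi) (fun z => k * w z)%C 0).
  { replace (RtoC 0) with (k * 0)%C by ring. apply: Clim_mult => //. apply: Clim_const. }
  assert (H10 : RtoC 1 <> RtoC 0) by (apply RtoC_neq_0; lra).
  assert (E1 := Clim_expd1 _ _ Lw). assert (E2 := Clim_expd1 _ _ Lv).
  assert (F1 := Clim_expd2 _ _ Lw). assert (F2 := Clim_expd2 _ _ Lkw).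
  apply (Clim_ext_loc _ (fun z => (- Cpower ipi (k - 2) * Cexp (v z) * (k * k * expd2 (k * w z) - k * expd2 (w z)) /
    (expd1 (w z) * expd1 (w z) * (expd1 (v z) * expd1 (v z))))%C)).
  + apply: filter_imp (filter_and _ _ (Clim_neq _ _ _ 0 (Clim_id ipi) ipi_neq_0)
      (filter_and _ _ (Clim_neq _ _ _ 0 E1 H10) (Clim_neq _ _ _ 0 E2 H10))).
    intros z [Hz [Hw Hv]]. destruct (Ceq_dec z ipi) as [->|Hzi].
    * rewrite G_ipi. unfold w, v. replace (Clog ipi - Clog ipi)%C with (RtoC 0) by ring.
      replace (ipi - ipi)%C with (RtoC 0) by ring.
      rewrite Cmult_0_r expd1_0 expd2_0 Cexp_0. field.
    * symmetry. by apply G_near_ipi.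
  + replace (- Cpower ipi (k - 2) * ((k * k - k) / 2))%C with
      (- Cpower ipi (k - 2) * Cexp 0 * (k * k * (1 / 2) - k * (1 / 2)) / (1 * 1 * (1 * 1)))%C.
    2: { rewrite Cexp_0. field. }
    apply: Clim_div.
    * rewrite !Cmult_1_l. exact H10.
    * apply: Clim_mult.
      -- apply: Clim_mult; [apply: Clim_const|by apply: Clim_Cexp].
      -- apply: Clim_minus; apply: Clim_mult => //; apply: Clim_const.
    * by repeat apply: Clim_mult.
- rewrite G_neq //. apply (Clim_ext_loc _ (fun z => numer k z * Ckernel z)%C).
  + apply: filter_imp (Clim_neq _ _ _ ipi (Clim_id t) Hn). intros z Hz. by rewrite G_neq.
  + apply: Clim_mult; last by (apply Ckernel_cont; [apply Ht|]).
    unfold numer. apply: Clim_minus.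
    * apply: Clim_minus; [by apply pow0_cont|apply: Clim_const].
    * apply: Clim_mult; [apply: Clim_const|]. apply: Clim_minus; [apply Clim_id|apply: Clim_const].
Qed.

(** The complex derivative of [G] in the open strip [0 < Im t < PI]. *)
Definition dG (k t : C) : C :=
  ((k * Cpower t (k - 1) - k * Cpower ipi (k - 1)) * Ckernel t +
   (Cpower t k - Cpower ipi k - k * Cpower ipi (k - 1) * (t - ipi)) *
   (Cexp t * (1 - Cexp t) / ((Cexp t + 1) * (Cexp t + 1) * (Cexp t + 1))))%C.

Lemma interior_facts (t : C) : 0 < Im t < PI -> t <> 0 /\ t <> ipi /\ slit t /\ (Cexp t + 1)%C <> 0.
Proof.
intros H.
assert (t <> 0) by (intros E; rewrite E in H; simpl in H; lra).
assert (t <> ipi).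
{ intros E. rewrite E in H. unfold ipi, Im in H; simpl in H. lra. }
repeat split => //; [by right; lra|]. apply Cexp_plus_1_neq_0 => //. lra.
Qed.

Lemma G_interior (k t : C) : 0 < Im t < PI -> G k t =
  ((Cpower t k - Cpower ipi k - k * Cpower ipi (k - 1) * (t - ipi)) * Ckernel t)%C.
Proof.
intros H. destruct (interior_facts t H) as [H1 [H2 _]].
rewrite G_neq //. unfold numer. by rewrite pow0_neq.
Qed.

Lemma G_derive (k : C) (p : R -> C) (x : R) (dp : C) : 0 < Im (p x) < PI ->
  is_Cderive p x dp -> is_Cderive (fun u => G k (p u)) x (dG k (p x) * dp)%C.
Proof.
intros H Hp. destruct (interior_facts _ H) as [H1 [H2 [H3 H4]]].
apply (is_Cderive_ext_loc (fun u => (Cpower (p u) k - Cpower ipi k - k * Cpower ipi (k - 1) * (p u - ipi))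
  * Ckernel (p u))%C).
- destruct (is_Cderive_Clim _ _ _ Hp) as [_ B].
  assert (L : locally x (fun u => 0 < Im (p u) < PI)).
  { apply (B (fun y => 0 < y < PI)). apply filter_and; [exact (open_gt 0 _ (proj1 H))|exact (open_lt PI _ (proj2 H))]. }
  apply: filter_imp L. intros u Hu. by rewrite G_interior.
- eapply is_Cderive_eq.
  + apply: is_Cderive_mult.
    * apply: is_Cderive_minus.
      -- apply: is_Cderive_minus; [apply: is_Cderive_Cpower; [exact H3|exact Hp]|apply: is_Cderive_const].
      -- apply: is_Cderive_mult; [apply: is_Cderive_const|].
         apply: is_Cderive_minus; [exact Hp|apply: is_Cderive_const].
    * unfold Ckernel. apply: is_Cderive_div.
      -- by apply Cmult_neq_0.
      -- apply: is_Cderive_Cexp. exact Hp.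
      -- apply: is_Cderive_mult; (apply: is_Cderive_plus; [apply: is_Cderive_Cexp; exact Hp|apply: is_Cderive_const]).
  + cbv beta. unfold dG, Ckernel. field. done.
Qed.

Lemma dG_cont (k t : C) : 0 < Im t < PI -> Clim (Clocally t) (dG k) (dG k t).
Proof.
intros H. destruct (interior_facts _ H) as [H1 [H2 [H3 H4]]].
assert (LE : Clim (Clocally t) Cexp (Cexp t)) by (apply: Clim_Cexp; apply Clim_id).
unfold dG. apply: Clim_plus; apply: Clim_mult.
- apply: Clim_minus; [|apply: Clim_const]. apply: Clim_mult; [apply: Clim_const|].
  apply: Clim_Cpower => //. apply Clim_id.
- apply Ckernel_cont => //. lra.
- apply: Clim_minus.
  + apply: Clim_minus; [apply: Clim_Cpower => //; apply Clim_id|apply: Clim_const].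
  + apply: Clim_mult; [apply: Clim_const|]. apply: Clim_minus; [apply Clim_id|apply: Clim_const].
- apply: Clim_div.
  + by repeat apply Cmult_neq_0.
  + apply: Clim_mult => //. apply: Clim_minus => //. apply: Clim_const.
  + apply: Clim_mult; [apply: Clim_mult|]; (apply: Clim_plus => //; apply: Clim_const).
Qed.

(** * Contour integration *)

(** Composing with [clamp] extends a function from a closed interval to the
    whole line, which makes one-sided continuity at its ends two-sided. *)
Definition clamp (b y : R) : R := Rmax 0 (Rmin y b).

Lemma clamp_bounds (b y : R) : 0 <= b -> 0 <= clamp b y <= b.
Proof. intros H. unfold clamp, Rmax, Rmin. repeat destruct Rle_dec; lra. Qed.

Lemma clamp_id (b y : R) : 0 <= y <= b -> clamp b y = y.
Proof. intros H. unfold clamp, Rmax, Rmin. repeat destruct Rle_dec; lra. Qed.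

Lemma clamp_cont (b y : R) : 0 <= b -> continuous (clamp b) y.
Proof.
intros Hb. apply filterlim_locally. intros eps. exists eps. intros z Hz.
ball_simpl_all.
eapply Rle_lt_trans; [|exact Hz].
unfold clamp, Rmax, Rmin. apply Rabs_le.
pose proof (Rle_abs (z + - y)). pose proof (Rle_abs (- (z + - y))) as H'. rewrite Rabs_Ropp in H'.
pose proof (Rabs_pos (z + - y)).
repeat destruct Rle_dec; lra.
Qed.

(** By uniform continuity of [f] on a compact neighbourhood of the segment. *)
Lemma continuous_RInt_param (f : R -> R -> R) (a b : R) : a <= b ->
  (forall s y, a <= s <= b -> continuity_2d_pt f s y) ->
  forall y0, continuous (fun y => RInt (fun s => f s y) a b) y0.
Proof.
intros Hab Hf y0.
assert (Hex : forall y, ex_RInt (fun s => f s y) a b).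
{ intros y. apply: ex_RInt_continuous. intros s Hs. rewrite Rmin_left // Rmax_right // in Hs.
  apply filterlim_locally. intros eps. apply (locally_2d_1d_const_y _ _ _ (Hf s y Hs eps)). }
apply filterlim_locally. intros eps.
assert (he : 0 < eps / (b - a + 1)) by (apply Rdiv_lt_0_compat; [apply cond_pos|lra]).
destruct (uniform_continuity_2d_1d f a b y0 (fun s Hs => Hf s y0 Hs) (mkposreal _ he)) as [d Hd].
exists d. intros y Hy.
ball_simpl_all.
apply Rabs_def2 in Hy.
replace (RInt (fun s => f s y) a b + - RInt (fun s => f s y0) a b) with
  (RInt (fun s => f s y - f s y0) a b).
2: { apply: (RInt_minus (fun s => f s y) (fun s => f s y0)); apply Hex. }
apply Rle_lt_trans with ((b - a) * (eps / (b - a + 1))).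
- apply abs_RInt_le_const => //.
  + apply: (ex_RInt_minus (fun s => f s y) (fun s => f s y0)); apply Hex.
  + intros s Hs. left. apply Hd; try lra.
    rewrite Rminus_diag Rabs_R0. apply cond_pos.
- pose proof (cond_pos eps). apply Rlt_le_trans with ((b - a + 1) * (eps / (b - a + 1))).
  + nra.
  + apply Req_le. field. lra.
Qed.

(** Cauchy's theorem for a closed form on a rectangle: the derivative in [y] of
    the integral of [P] over a horizontal line is a boundary term.  The form is
    differentiable in the open strip only and continuous up to its edges. *)
Lemma rectangle (P Q H : R -> R -> R) (S b : R) : 0 <= S -> 0 < b ->
  (forall s y, 0 < y < b -> is_derive (fun y => P s y) y (H s y)) ->
  (forall s y, 0 < y < b -> is_derive (fun s => Q s y) s (H s y)) ->
  (forall s y, 0 < y < b -> continuous (fun z : R * R => H (fst z) (snd z)) (s, y)) ->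
  (forall s y, 0 <= s -> 0 <= y <= b -> continuous (fun z : R * R => P (fst z) (snd z)) (s, y)) ->
  (forall s y, 0 <= s -> 0 <= y <= b -> continuous (fun z : R * R => Q (fst z) (snd z)) (s, y)) ->
  RInt (fun s => P s b) 0 S - RInt (fun s => P s 0) 0 S = RInt (fun y => Q S y - Q 0 y) 0 b.
Proof.
intros HS Hb HP HQ HH CP CQ.
set (A := fun y => RInt (fun s => P s (clamp b y)) 0 S).
set (r := fun y => Q S (clamp b y) - Q 0 (clamp b y)).
assert (CA : forall y, continuous A y).
{ apply (continuous_RInt_param (fun s y => P s (clamp b y))) => //.
  intros s y Hs. apply continuity_2d_pt_filterlim.
  apply (continuous_comp_2 (fun z : R * R => fst z) (fun z : R * R => clamp b (snd z)) P (s, y)).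
  - apply continuous_fst.
  - apply: continuous_comp; [apply continuous_snd|apply clamp_cont; lra].
  - apply CP; simpl; [lra|apply clamp_bounds; lra]. }
assert (Cr : forall y, continuous r y).
{ assert (K : forall s y, 0 <= s -> continuous (fun y => Q s (clamp b y)) y).
  { intros s y Hs. apply (continuous_comp_2 (fun _ => s) (fun y => clamp b y) Q y).
    - apply continuous_const.
    - apply clamp_cont; lra.
    - apply CQ => //. apply clamp_bounds; lra. }
  intros y. apply: (continuous_minus (fun y => Q S (clamp b y))); apply K; lra. }
assert (Dr : forall y, is_derive (fun y => RInt r 0 y) y (r y)).
{ intros y. apply: (is_derive_RInt _ _ 0); last by apply Cr.
  apply filter_forall. intros z. apply: RInt_correct. apply: ex_RInt_continuous. intros; apply Cr. }
assert (Cfst : forall s y, 0 <= s -> 0 <= y <= b -> continuous (fun s => P s y) s).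
{ intros s y Hs Hy. apply (continuous_comp_2 (fun s => s) (fun _ => y) P s).
  - apply continuous_id.
  - apply continuous_const.
  - by apply CP. }
assert (Loc : forall y, 0 < y < b -> locally y (fun z => 0 < z < b)).
{ intros y Hy. apply filter_and; [exact (open_gt 0 _ (proj1 Hy))|exact (open_lt b _ (proj2 Hy))]. }
assert (DA : forall y, 0 < y < b -> is_derive A y (r y)).
{ intros y Hy. apply (is_derive_ext_loc (fun y => RInt (fun s => P s y) 0 S)).
  { apply: filter_imp (Loc y Hy). intros z Hz. unfold A. rewrite clamp_id //; lra. }
  replace (r y) with (RInt (fun s => Derive (fun u => P s u) y) 0 S).
  - apply (is_derive_RInt_param (fun y s => P s y)).
    + apply: filter_imp (Loc y Hy). intros z Hz t _. exists (H t z). by apply HP.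
    + intros t _. apply (continuity_2d_pt_ext_loc (fun u v => H v u)).
      * apply locally_2d_locally.
        destruct (Loc y Hy) as [d Hd]. exists d. intros [u v] [Hu _]. simpl.
        symmetry. apply is_derive_unique. apply HP. by apply Hd.
      * apply continuity_2d_pt_filterlim.
        apply (continuous_comp_2 (fun z : R * R => snd z) (fun z : R * R => fst z) H (y, t)).
        -- apply continuous_snd.
        -- apply continuous_fst.
        -- by apply HH.
    + apply: filter_imp (Loc y Hy). intros z Hz.
      apply: ex_RInt_continuous. intros s Hs. rewrite Rmin_left // in Hs. apply Cfst; lra.
  - unfold r. rewrite clamp_id; last lra.
    rewrite (RInt_ext _ (fun s => H s y)).
    2: { intros s _. apply is_derive_unique. by apply HP. }
    apply is_RInt_unique. apply: (is_RInt_derive (fun s => Q s y)).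
    + intros s _. by apply HQ.
    + intros s _. apply (continuous_comp_2 (fun s => s) (fun _ => y) H s).
      * apply continuous_id.
      * apply continuous_const.
      * by apply HH. }
destruct (MVT_gen (fun y => A y - RInt r 0 y) 0 b (fun _ => 0)) as [c [_ E]].
- intros y Hy. rewrite Rmin_left ?Rmax_right in Hy; try lra.
  assert (K := is_derive_minus A (fun y => RInt r 0 y) y _ _ (DA y Hy) (Dr y)).
  unfold minus, plus, opp in K. simpl in K. rewrite Rplus_opp_r in K. exact K.
- intros y _. apply continuity_pt_filterlim.
  apply: (continuous_minus A); first by apply CA.
  apply: (ex_derive_cont). eexists. apply Dr.
- rewrite Rmult_0_l RInt_point in E. unfold A in E. rewrite !clamp_id in E; try lra.
  replace (RInt (fun y => Q S y - Q 0 y) 0 b) with (RInt r 0 b).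
  + unfold zero in E. simpl in E. lra.
  + apply RInt_ext. intros y Hy. rewrite Rmin_left ?Rmax_right in Hy; try lra.
    unfold r. rewrite clamp_id //; lra.
Qed.

Definition Cint (f : R -> C) (a b : R) : C :=
  (RInt (fun t => Re (f t)) a b, RInt (fun t => Im (f t)) a b).

Lemma Cint_derive (f : R -> C) (a : R) : (forall x, Clim (locally x) f (f x)) ->
  forall x, is_Cderive (Cint f a) x (f x).
Proof.
intros Hf.
assert (K : forall h : R -> R, (forall x, continuous h x) -> forall x, is_derive (RInt h a) x (h x)).
{ intros h Hh x. apply: (is_derive_RInt _ _ a); last by apply Hh.
  apply filter_forall. intros z. apply: RInt_correct. apply: ex_RInt_continuous. intros; apply Hh. }
intros x. split; simpl; apply K; intros z; apply (Hf z).
Qed.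

Lemma Cint_point (f : R -> C) (a : R) : Cint f a a = 0.
Proof. unfold Cint. rewrite !RInt_point. reflexivity. Qed.

Lemma Cint_ext (f g : R -> C) (a b : R) : a <= b -> (forall x, a <= x <= b -> f x = g x) -> Cint f a b = Cint g a b.
Proof.
intros Hab H. unfold Cint. f_equal; apply RInt_ext; intros x Hx;
rewrite Rmin_left // Rmax_right // in Hx; rewrite H //; lra.
Qed.

Lemma Cmod_Cint_le (f : R -> C) (a b M : R) : a <= b ->
  (forall x, a <= x <= b -> Clim (locally x) f (f x)) ->
  (forall x, a <= x <= b -> Cmod (f x) <= M) -> Cmod (Cint f a b) <= 2 * ((b - a) * M).
Proof.
intros Hab Hc Hb.
assert (K : forall h : R -> R, (forall x, a <= x <= b -> continuous h x) ->
  (forall x, a <= x <= b -> Rabs (h x) <= M) -> Rabs (RInt h a b) <= (b - a) * M).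
{ intros h h1 h2. apply abs_RInt_le_const => //. apply: ex_RInt_continuous.
  intros z Hz. rewrite Rmin_left // Rmax_right // in Hz. by apply h1. }
eapply Rle_trans; [apply Cmod_le_sum|]. unfold Cint; simpl.
assert (A := K (fun t => Re (f t)) (fun x Hx => proj1 (Hc x Hx))
  (fun x Hx => Rle_trans _ _ _ (re_le_Cmod (f x)) (Hb x Hx))).
assert (B := K (fun t => Im (f t)) (fun x Hx => proj2 (Hc x Hx))
  (fun x Hx => Rle_trans _ _ _ (Rle_trans _ _ _ (Rmax_r _ _) (Rmax_Cmod (f x))) (Hb x Hx))).
lra.
Qed.

Lemma Clim_locally_path (k : C) (p : R -> C) (x : R) : 0 < Re k -> strip (p x) ->
  Clim (locally x) p (p x) -> Clim (locally x) (fun u => G k (p u)) (G k (p x)).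
Proof.
intros Hk Hs Hp. apply: Clim_comp; [apply Clim_filterlim; [exact _|exact Hp]|by apply G_cont].
Qed.

Lemma Rmax_0_cont (x : R) : continuous (Rmax 0) x.
Proof.
apply (continuous_ext (fun x => (x + Rabs x) / 2)).
- intros y. unfold Rmax, Rabs. destruct Rle_dec, Rcase_abs; lra.
- apply: continuous_mult; [|apply: continuous_const].
  apply: continuous_plus; [apply: continuous_id|apply: continuous_Rabs].
Qed.

(** [G] along the positive real axis, the line [Im t = PI] and the segment from
    [0] to [i pi], extended to continuous functions on the whole line. *)
Definition G_bot (k : C) (s : R) : C := G k (RtoC (Rmax 0 s)).
Definition G_top (k : C) (s : R) : C := G k (ipi + RtoC (Rmax 0 s))%C.
Definition G_left (k : C) (y : R) : C := G k (Ci * RtoC (clamp PI y))%C.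

Lemma G_bot_cont (k : C) (x : R) : 0 < Re k -> Clim (locally x) (G_bot k) (G_bot k x).
Proof.
intros Hk. apply (Clim_locally_path k (fun s => RtoC (Rmax 0 s))) => //.
- unfold strip; simpl. pose proof (Rmax_l 0 x). pose proof PI_RGT_0. lra.
- apply: Clim_RtoC. apply Rmax_0_cont.
Qed.

Lemma G_top_cont (k : C) (x : R) : 0 < Re k -> Clim (locally x) (G_top k) (G_top k x).
Proof.
intros Hk. apply (Clim_locally_path k (fun s => ipi + RtoC (Rmax 0 s))%C) => //.
- unfold strip, ipi; simpl. pose proof (Rmax_l 0 x). pose proof PI_RGT_0. lra.
- apply: Clim_plus; [apply: Clim_const|]. apply: Clim_RtoC. apply Rmax_0_cont.
Qed.

Lemma G_left_cont (k : C) (x : R) : 0 < Re k -> Clim (locally x) (G_left k) (G_left k x).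
Proof.
intros Hk. pose proof PI_RGT_0. apply (Clim_locally_path k (fun y => Ci * RtoC (clamp PI y))%C) => //.
- unfold strip; simpl. pose proof (clamp_bounds PI x). lra.
- apply: Clim_mult; [apply: Clim_const|]. apply: Clim_RtoC. apply clamp_cont. lra.
Qed.

Lemma Clim_2d (f : C -> C) (s y : R) : Clim (Clocally (s, y)) f (f (s, y)) ->
  continuous (fun z : R * R => Re (f (fst z, snd z))) (s, y) /\
  continuous (fun z : R * R => Im (f (fst z, snd z))) (s, y).
Proof.
intros [A B]. split.
- apply (continuous_ext (fun z : R * R => Re (f z))); [by intros [a b]|exact A].
- apply (continuous_ext (fun z : R * R => Im (f z))); [by intros [a b]|exact B].
Qed.

Lemma G_cont_2d (k : C) (s y : R) : 0 < Re k -> 0 <= s -> 0 <= y <= PI ->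
  continuous (fun z : R * R => Re (G k (fst z, snd z))) (s, y) /\
  continuous (fun z : R * R => Im (G k (fst z, snd z))) (s, y).
Proof. intros Hk Hs Hy. apply Clim_2d. by apply G_cont. Qed.

Lemma dG_cont_2d (k : C) (s y : R) : 0 < y < PI ->
  continuous (fun z : R * R => Re (dG k (fst z, snd z))) (s, y) /\
  continuous (fun z : R * R => Im (dG k (fst z, snd z))) (s, y).
Proof. intros Hy. apply Clim_2d. by apply dG_cont. Qed.

Lemma G_horizontal (k : C) (s y : R) : 0 < y < PI -> is_Cderive (fun s => G k (s, y)) s (dG k (s, y)).
Proof.
intros Hy. eapply is_Cderive_eq.
- apply (G_derive k (fun s => (s, y)) s (RtoC 1)) => //.
  split; simpl; [apply: is_derive_id|apply: is_derive_const].
- ring.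
Qed.

Lemma G_vertical (k : C) (s y : R) : 0 < y < PI -> is_Cderive (fun y => G k (s, y)) y (dG k (s, y) * Ci)%C.
Proof.
intros Hy. apply (G_derive k (fun y => (s, y)) y Ci); first done.
split; simpl; [apply: is_derive_const|apply: is_derive_id].
Qed.

(** Cauchy's theorem for [G] on the rectangle with corners [0] and
    [S + i pi], from [rectangle] applied to its real and imaginary parts. *)
Lemma contour_rectangle (k : C) (S : R) : 0 < Re k -> 0 <= S ->
  (Cint (G_top k) 0 S - Cint (G_bot k) 0 S)%C =
  (Ci * (Cint (fun y => G k (S, y)) 0 PI - Cint (G_left k) 0 PI))%C.
Proof.
intros Hk HS. pose proof PI_RGT_0 as Hpi.
rewrite (Cint_ext (G_top k) (fun s => G k (s, PI))) //.
2: { intros s Hs. unfold G_top. rewrite Rmax_right; last lra. f_equal.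
     unfold ipi. apply injective_projections; simpl; ring. }
rewrite (Cint_ext (G_bot k) (fun s => G k (s, 0))) //.
2: { intros s Hs. unfold G_bot. rewrite Rmax_right; last lra. reflexivity. }
rewrite (Cint_ext (G_left k) (fun y => G k (0, y))); [|lra|].
2: { intros y Hy. unfold G_left. rewrite clamp_id //. f_equal. apply injective_projections; simpl; ring. }
assert (R1 := rectangle (fun s y => Re (G k (s, y))) (fun s y => - Im (G k (s, y)))
  (fun s y => - Im (dG k (s, y))) S PI HS Hpi).
assert (R2 := rectangle (fun s y => Im (G k (s, y))) (fun s y => Re (G k (s, y)))
  (fun s y => Re (dG k (s, y))) S PI HS Hpi).
assert (Ex : forall s, 0 <= s -> ex_RInt (fun y => Re (G k (s, y))) 0 PI /\ ex_RInt (fun y => Im (G k (s, y))) 0 PI).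
{ intros s Hs.
  assert (K : forall y, Rmin 0 PI <= y <= Rmax 0 PI -> Clim (locally y) (fun y => G k (s, y)) (G k (s, y))).
  { intros y Hy. rewrite Rmin_left ?Rmax_right in Hy; try lra.
    apply (Clim_locally_path k (fun y => (s, y))) => //.
    split; simpl; [apply filterlim_const|apply filterlim_id]. }
  split; apply: ex_RInt_continuous; intros y Hy; apply (K y Hy). }
assert (E1 : RInt (fun y => - Im (G k (S, y)) - - Im (G k (0, y))) 0 PI =
  RInt (fun y => Im (G k (0, y))) 0 PI - RInt (fun y => Im (G k (S, y))) 0 PI).
{ rewrite (RInt_ext _ (fun y => minus (Im (G k (0, y))) (Im (G k (S, y))))).
  - exact (RInt_minus _ _ 0 PI (proj2 (Ex 0 (Rle_refl 0))) (proj2 (Ex S HS))).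
  - intros y _. unfold minus, plus, opp; simpl. ring. }
assert (E2 : RInt (fun y => Re (G k (S, y)) - Re (G k (0, y))) 0 PI =
  RInt (fun y => Re (G k (S, y))) 0 PI - RInt (fun y => Re (G k (0, y))) 0 PI).
{ exact (RInt_minus _ _ 0 PI (proj1 (Ex S HS)) (proj1 (Ex 0 (Rle_refl 0)))). }
rewrite E1 in R1. rewrite E2 in R2. clear E1 E2.
unfold Cint. apply injective_projections; simpl.
- unfold Rminus in R1. rewrite -> R1.
  + ring.
  + intros s y Hy. destruct (G_vertical k s y Hy) as [A _].
    replace (- Im (dG k (s, y))) with (Re (dG k (s, y) * Ci)%C) => //.
    destruct (dG k (s, y)); unfold Re, Im; simpl; ring.
  + intros s y Hy. destruct (G_horizontal k s y Hy) as [_ A].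
    exact (is_derive_opp (fun s => Im (G k (s, y))) s _ A).
  + intros s y Hy. exact (continuous_opp _ _ (proj2 (dG_cont_2d k s y Hy))).
  + intros s y Hs Hy. exact (proj1 (G_cont_2d k s y Hk Hs Hy)).
  + intros s y Hs Hy. exact (continuous_opp _ _ (proj2 (G_cont_2d k s y Hk Hs Hy))).
- unfold Rminus in R2. rewrite -> R2.
  + ring.
  + intros s y Hy. destruct (G_vertical k s y Hy) as [_ A].
    replace (Re (dG k (s, y))) with (Im (dG k (s, y) * Ci)%C) => //.
    destruct (dG k (s, y)); unfold Re, Im; simpl; ring.
  + intros s y Hy. by destruct (G_horizontal k s y Hy) as [A _].
  + intros s y Hy. exact (proj1 (dG_cont_2d k s y Hy)).
  + intros s y Hs Hy. exact (proj2 (G_cont_2d k s y Hk Hs Hy)).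
  + intros s y Hs Hy. exact (proj1 (G_cont_2d k s y Hk Hs Hy)).
Qed.

(** For [t = s + i y] the numerator is of order [e^(s/2)] and the kernel of
    order [e^(-s)]. *)
Lemma G_decay (k : C) : 0 < Re k -> exists M, forall s y, 1 <= s -> 0 <= y <= PI ->
  Cmod (G k (s, y)) <= M * exp (- (1 / 2 * s)).
Proof.
intros Hk. pose proof PI_RGT_0 as Hpi.
set (c0 := exp (Rabs (Im k) * PI)). set (c1 := exp (Re k * ln (Re k / (1 / 2)))).
set (c2 := Cmod (Cpower ipi k)). set (c3 := Cmod (k * Cpower ipi (k - 1))).
assert (P0 : 0 < c0) by apply exp_pos. assert (P1 : 0 < c1) by apply exp_pos.
assert (P2 : 0 <= c2) by apply Cmod_ge_0. assert (P3 : 0 <= c3) by apply Cmod_ge_0.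
exists (4 * (c0 * c1 * exp (1 / 2 * PI) + c2 + 2 * c3 * exp (1 / 2 * (2 * PI)))).
intros s y Hs Hy. set (t := (s, y) : C).
assert (Ht0 : t <> 0) by (intros E; apply (f_equal fst) in E; simpl in E; lra).
assert (Hti : t <> ipi) by (intros E; apply (f_equal fst) in E; simpl in E; lra).
set (h := exp (1 / 2 * s)). assert (Ph : 0 < h) by apply exp_pos.
assert (Hh2 : exp s = h * h) by (unfold h; rewrite -exp_plus; f_equal; field).
assert (Hh1 : 2 <= h * h) by (rewrite -Hh2; pose proof (exp_ineq1_le s); lra).
assert (Hh : 1 <= h) by nra.
assert (Et : t = (RtoC s + Ci * RtoC y)%C) by (apply injective_projections; simpl; ring).
assert (Nt : Cmod t <= s + PI).
{ rewrite Et. eapply Rle_trans; [apply Cmod_triangle|].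
  rewrite Cmod_mult Cmod_Ci !Cmod_R !Rabs_pos_eq; lra. }
assert (B1 : Cmod (Cpower t k) <= c0 * c1 * exp (1 / 2 * PI) * h).
{ eapply Rle_trans; [apply Cmod_Cpower_le|]. fold c0. rewrite !Rmult_assoc.
  apply Rmult_le_compat_l; first lra.
  eapply Rle_trans; [apply (pow_le_exp _ (1 / 2)); [done|lra|by apply Cmod_gt_0]|]. fold c1.
  apply Rmult_le_compat_l; first lra. unfold h. rewrite -exp_plus. apply exp_le_compat. lra. }
assert (B2 : Cmod (t - ipi) <= 2 * exp (1 / 2 * (2 * PI)) * h).
{ apply Rle_trans with (s + 2 * PI).
  - eapply Rle_trans; [apply Cmod_triangle|]. rewrite Cmod_opp. unfold ipi.
    rewrite Cmod_mult Cmod_Ci Cmod_R Rabs_pos_eq; lra.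
  - unfold h. rewrite Rmult_assoc -exp_plus. pose proof (exp_ineq1_le (1 / 2 * (2 * PI) + 1 / 2 * s)). lra. }
assert (BN : Cmod (numer k t) <= (c0 * c1 * exp (1 / 2 * PI) + c2 + 2 * c3 * exp (1 / 2 * (2 * PI))) * h).
{ unfold numer. rewrite pow0_neq //. unfold Cminus at 1 2.
  eapply Rle_trans; [apply Cmod_triangle|].
  eapply Rle_trans; [apply Rplus_le_compat_r; apply Cmod_triangle|].
  rewrite !Cmod_opp Cmod_mult. fold c2 c3.
  assert (c3 * Cmod (t - ipi) <= c3 * (2 * exp (1 / 2 * (2 * PI)) * h)) by (by apply Rmult_le_compat_l).
  assert (c2 <= c2 * h) by nra. nra. }
assert (BD : h * h / 2 <= Cmod (Cexp t + 1)).
{ assert (T : Cmod (Cexp t) <= Cmod (Cexp t + 1) + 1).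
  { replace (Cexp t) with ((Cexp t + 1) + - (1))%C at 1 by ring.
    eapply Rle_trans; [apply Cmod_triangle|]. rewrite Cmod_opp Cmod_1. lra. }
  rewrite Cmod_Cexp /= Hh2 in T. lra. }
rewrite G_neq // Cmod_mult.
assert (BK : Cmod (Ckernel t) <= 4 / (h * h)).
{ unfold Ckernel. rewrite Cmod_div; last by apply Cexp_plus_1_sq_neq_0.
  rewrite Cmod_mult Cmod_Cexp /= Hh2.
  set (d := Cmod (Cexp t + 1)) in *. assert (0 < d) by nra.
  apply Rle_div_l; first nra.
  replace (4 / (h * h) * (d * d)) with (h * h * (d / (h * h / 2)) ^ 2) by (field; lra).
  assert (1 <= d / (h * h / 2)) by (apply (Rle_div_r 1 d (h * h / 2)); [nra|lra]).
  rewrite -{1}(Rmult_1_r (h * h)). apply Rmult_le_compat_l; nra. }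
replace (exp (- (1 / 2 * s))) with (/ h) by (unfold h; by rewrite exp_Ropp).
set (K := _ + _ + _) in *.
apply Rle_trans with (K * h * (4 / (h * h))).
- apply Rmult_le_compat => //; apply Cmod_ge_0.
- apply Req_le. field. lra.
Qed.

(** As [S] tends to infinity the integral over the right side vanishes. *)
Lemma contour (k I0 : C) : 0 < Re k ->
  Clim at_oo (Cint (G_bot k) 0) I0 ->
  Clim at_oo (Cint (G_top k) 0) (I0 - Ci * Cint (G_left k) 0 PI)%C.
Proof.
intros Hk HI. pose proof PI_RGT_0 as Hpi.
apply (Clim_ext_loc _ (fun S => Cint (G_bot k) 0 S +
  Ci * (Cint (fun y => G k (S, y)) 0 PI - Cint (G_left k) 0 PI))%C).
{ apply: filter_imp (p_infty_gt 0). intros S HS.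
  rewrite -contour_rectangle //; last lra. ring. }
replace (I0 - Ci * Cint (G_left k) 0 PI)%C with (I0 + Ci * (0 - Cint (G_left k) 0 PI))%C by ring.
apply: Clim_plus => //. apply: Clim_mult; first by apply: Clim_const.
apply: Clim_minus; last by apply: Clim_const.
destruct (G_decay k Hk) as [M HM].
apply (Clim_squeeze _ _ _ (fun S => 2 * (PI * M) * exp (- (1 / 2 * S)))).
- apply: filter_imp (p_infty_gt 1). intros S HS.
  replace (Cint (fun y => G k (S, y)) 0 PI - 0)%C with (Cint (fun y => G k (S, y)) 0 PI) by ring.
  replace (2 * (PI * M) * exp (- (1 / 2 * S))) with (2 * ((PI - 0) * (M * exp (- (1 / 2 * S))))) by ring.
  apply Cmod_Cint_le; first lra.
  + intros y Hy. apply (Clim_locally_path k (fun y => (S, y))) => //.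
    * split; unfold Re, Im; simpl; lra.
    * split; simpl; [apply filterlim_const|apply filterlim_id].
  + intros y Hy. apply HM; lra.
- rewrite -(Rmult_0_r (2 * (PI * M))). apply: Rlim_mult; first by apply: filterlim_const.
  apply lim_exp_neg. lra.
Qed.

(** * Elementary integrals *)

Lemma Cderive_0_const (D : R -> C) : (forall x, 0 < x -> is_Cderive D x 0) ->
  forall x y, 0 < x -> 0 < y -> D x = D y.
Proof.
intros HD.
assert (K : forall h : R -> R, (forall x, 0 < x -> is_derive h x 0) -> forall x y, 0 < x -> x <= y -> h x = h y).
{ intros h Hh x y Hx Hy. apply Rle_antisym.
  - apply (derive_nonneg_incr h (fun _ => 0)) => //; intros z Hz; [apply Hh|]; lra.
  - apply Ropp_le_cancel. apply (derive_nonneg_incr (fun x => - h x) (fun _ => 0)) => //; intros z Hz; [|lra].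
    replace 0 with (opp 0) by (unfold opp; simpl; ring). apply: is_derive_opp. apply Hh; lra. }
assert (K2 : forall x y, 0 < x -> x <= y -> D x = D y).
{ intros x y Hx Hy. apply injective_projections.
  - apply (K (fun t => Re (D t))) => // z Hz; apply (HD z Hz).
  - apply (K (fun t => Im (D t))) => // z Hz; apply (HD z Hz). }
intros x y Hx Hy. destruct (Rle_dec x y); [by apply K2|symmetry; apply K2 => //; lra].
Qed.

(** Two primitives differ by a constant, found from the limit at [0]. *)
Lemma halfint_primitive (f H : R -> C) (l m : C) : is_halfint f l ->
  (forall x, 0 < x -> is_Cderive H x (f x)) -> Clim (at_right 0) H m ->
  Clim at_oo H (l + m)%C.
Proof.
intros [F [la [lb [H1 [H2 [H3 H4]]]]]] HH Hm.
assert (E : forall x, 0 < x -> H x = (F x + (H 1 - F 1))%C).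
{ intros x Hx.
  assert (K : (H x - F x)%C = (H 1 - F 1)%C).
  { apply (Cderive_0_const (fun t => H t - F t)%C) => //; last lra.
    intros z Hz. eapply is_Cderive_eq; [apply: is_Cderive_minus; [by apply HH|by apply H1]|ring]. }
  rewrite -K. ring. }
set (c := (H 1 - F 1)%C) in *.
assert (Ec : m = (la + c)%C).
{ apply (Clim_unique (at_right 0) H) => //.
  apply (Clim_ext_loc _ (fun t => F t + c)%C).
  - apply: filter_imp at_right_pos. intros x Hx. by rewrite -E.
  - apply: Clim_plus => //. apply: Clim_const. }
apply (Clim_ext_loc _ (fun t => F t + c)%C).
- apply: filter_imp (p_infty_gt 0). intros x Hx. by rewrite -E.
- replace (l + m)%C with (lb + c)%C by (rewrite H4 Ec; ring).
  apply: Clim_plus => //. apply: Clim_const.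
Qed.

Lemma Rlim_eq {T : Type} (F : (T -> Prop) -> Prop) (f : T -> R) (a b : R) :
  a = b -> filterlim f F (locally a) -> filterlim f F (locally b).
Proof. by intros ->. Qed.

Lemma kernel_halfint : is_halfint (fun t => RtoC (kernel t)) (RtoC (1 / 2)).
Proof.
exists (fun t => RtoC (/ (1 + exp (- t)))), (RtoC (1 / 2)), (RtoC 1).
split; [|split; [|split]].
- intros x _. apply is_Cderive_RtoC. unfold kernel. pose proof (exp_pos (- x)).
  auto_derive; [lra|]. field. lra.
- apply: Clim_RtoC.
  replace (1 / 2) with (/ (1 + exp (- 0))) by (rewrite Ropp_0 exp_0; field).
  apply (lim_at_right_cont (fun t => / (1 + exp (- t)))).
  apply: (ex_derive_cont). auto_derive. pose proof (exp_pos (- 0)). lra.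
- apply: Clim_RtoC. apply (Rlim_eq _ _ (/ (1 + 0))); first by field.
  apply: (Rlim_cont _ (fun t => 1 + exp (- t)) Rinv (1 + 0)).
  + apply: Rlim_plus; first by apply: filterlim_const.
    apply: filterlim_ext (lim_exp_neg 1 Rlt_0_1). intros t. by rewrite Rmult_1_l.
  + apply: (ex_derive_cont). auto_derive. lra.
- rewrite -RtoC_minus. f_equal. field.
Qed.

(** Integrating by parts, this is the integral of [1 / (e^t + 1)]. *)
Lemma kernel_halfint_t : is_halfint (fun t => RtoC (t * kernel t)) (RtoC (ln 2)).
Proof.
set (F := fun t => - (t * exp (- t)) * / (1 + exp (- t)) + - ln (1 + exp (- t))).
assert (CF : forall x, continuous (fun t => / (1 + exp (- t))) x).
{ intros x. apply: (ex_derive_cont). auto_derive. pose proof (exp_pos (- x)). lra. }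
exists (fun t => RtoC (F t)), (RtoC (- ln 2)), (RtoC 0).
split; [|split; [|split]].
- intros x _. apply is_Cderive_RtoC. unfold F, kernel. pose proof (exp_pos (- x)).
  auto_derive; [repeat split; lra|]. field. lra.
- apply: Clim_RtoC.
  replace (- ln 2) with (F 0).
  + apply (lim_at_right_cont F).
    apply: (ex_derive_cont). unfold F. auto_derive.
    pose proof (exp_pos (- 0)). repeat split; lra.
  + unfold F. rewrite Ropp_0 exp_0. replace (1 + 1) with 2 by ring. ring.
- apply: Clim_RtoC. unfold F. apply (Rlim_eq _ _ (- 0 * / (1 + 0) + - ln (1 + 0))).
  { rewrite Rplus_0_r ln_1. ring. }
  assert (L1 : filterlim (fun t => exp (- t)) at_oo (locally 0)).
  { apply: filterlim_ext (lim_exp_neg 1 Rlt_0_1). intros t. by rewrite Rmult_1_l. }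
  assert (L2 : filterlim (fun t => 1 + exp (- t)) at_oo (locally (1 + 0))).
  { apply: Rlim_plus => //. apply: filterlim_const. }
  apply: Rlim_plus; [apply: Rlim_mult; [apply: Rlim_opp|]|apply: Rlim_opp].
  + apply (filterlim_ext_loc (fun t => exp (1 * ln t) * exp (- (1 * t)))).
    * apply: filter_imp (p_infty_gt 0). intros t Ht. rewrite !Rmult_1_l exp_ln //.
    * apply lim_pow_exp; lra.
  + apply: (Rlim_cont _ _ Rinv) => //. apply: (ex_derive_cont). auto_derive. lra.
  + apply: (Rlim_cont _ _ ln) => //. apply: (ex_derive_cont). auto_derive. lra.
- rewrite -RtoC_minus. f_equal. ring.
Qed.

Lemma Ckernel_R (t : R) : Ckernel (RtoC t) = RtoC (kernel t).
Proof.
unfold Ckernel, kernel. rewrite Cexp_R -RtoC_plus -RtoC_mult -RtoC_div.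
2: { pose proof (exp_pos t). nra. }
f_equal. rewrite exp_Ropp. pose proof (exp_pos t). field. split; lra.
Qed.

(** The integral of [G] over the positive axis, in terms of that of
    [t^k kernel t]. *)
Definition bottom_value (k I : C) : C :=
  (I - Cpower ipi k / 2 - k * Cpower ipi (k - 1) * (RtoC (ln 2) - ipi / 2))%C.

Lemma G_bot_limit (k I : C) : 0 < Re k ->
  is_halfint (fun t => Cpower (RtoC t) k * RtoC (kernel t))%C I ->
  Clim at_oo (Cint (G_bot k) 0) (bottom_value k I).
Proof.
intros Hk HI.
set (A := Cpower ipi k). set (B := (k * Cpower ipi (k - 1))%C).
replace (bottom_value k I) with (bottom_value k I + 0)%C by ring.
apply (halfint_primitive (G_bot k)).
- apply (halfint_ext (fun t => Cpower (RtoC t) k * RtoC (kernel t) + ((B * ipi - A) * RtoC (kernel t) +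
    - B * RtoC (t * kernel t)))%C).
  + intros x Hx. unfold G_bot. rewrite Rmax_right; last lra.
    rewrite G_neq.
    * rewrite Ckernel_R. unfold numer. rewrite pow0_neq; last by apply RtoC_neq_0; lra.
      rewrite RtoC_mult. fold A B. ring.
    * intros E. apply (f_equal fst) in E. simpl in E. lra.
  + replace (bottom_value k I) with (I + ((B * ipi - A) * RtoC (1 / 2) + - B * RtoC (ln 2)))%C.
    * apply halfint_plus => //. apply halfint_plus; apply halfint_scal; [apply kernel_halfint|apply kernel_halfint_t].
    * unfold bottom_value. fold A B. rewrite RtoC_div; last lra. field.
- intros x _. apply Cint_derive. intros z. by apply G_bot_cont.
- assert (K := is_Cderive_Clim _ _ _ (Cint_derive (G_bot k) 0 (fun z => G_bot_cont k z Hk) 0)).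
  rewrite Cint_point in K. destruct K as [K1 K2].
  split; (apply: filterlim_filter_le_1; [|eassumption]); apply filter_le_within.
Qed.

(** * Change of variables on the unit interval *)

Lemma derive_quotient (h : R -> R) (d : R) : is_derive h 0 d -> h 0 = 0 ->
  filterlim (fun u => h u / u) (at_right 0) (locally d).
Proof.
intros H H0. apply is_derive_Reals in H. apply filterlim_locally. intros eps.
destruct (H eps (cond_pos eps)) as [delta Hd].
apply: filter_imp (filter_and _ _ at_right_pos (at_right_lt delta (cond_pos delta))).
intros u [Hu Hu']. specialize (Hd u). rewrite Rplus_0_l H0 Rminus_0_r in Hd.
apply Hd; [lra|rewrite Rabs_pos_eq; lra].
Qed.

Lemma Cderive_quotient (f : R -> C) (d : C) : is_Cderive f 0 d -> f 0 = 0 ->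
  Clim (at_right 0) (fun u => f u * RtoC (/ u))%C d.
Proof.
intros [A B] H0. split.
- apply (filterlim_ext (fun u => Re (f u) / u)).
  + intros u. destruct (f u); unfold Re; simpl. unfold Rdiv. ring.
  + apply derive_quotient => //. by rewrite H0.
- apply (filterlim_ext (fun u => Im (f u) / u)).
  + intros u. destruct (f u); unfold Im; simpl. unfold Rdiv. ring.
  + apply derive_quotient => //. by rewrite H0.
Qed.

Lemma at_left_1_refl : filterlim (fun u => 1 - u) (at_left 1) (at_right 0).
Proof.
intros P [d Hd]. exists d. intros u Hu Hu'. apply Hd; [|lra].
ball_simpl_all.
replace (1 - u + - 0) with (- (u + - 1)) by ring. by rewrite Rabs_Ropp.
Qed.

Lemma lim_at_left_cont (f : R -> R) (x : R) : continuous f x -> filterlim f (at_left x) (locally (f x)).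
Proof. intros H. apply: filterlim_filter_le_1 H. by apply filter_le_within. Qed.

Lemma unit_at_right_0 : at_right 0 (fun u => 0 < u < 1).
Proof. apply filter_and; [apply at_right_pos|apply at_right_lt; lra]. Qed.

Lemma unit_at_left_1 : at_left 1 (fun u => 0 < u < 1).
Proof.
assert (H := at_left_1_refl _ unit_at_right_0). unfold filtermap in H.
apply: filter_imp H. intros u Hu. lra.
Qed.

Lemma sin_half_pos (u : R) : 0 < u < 1 -> 0 < sin (PI * u / 2).
Proof. intros Hu. pose proof PI_RGT_0. apply sin_gt_0; nra. Qed.

Lemma xlnx_lim : filterlim (fun x => x * ln x) (at_right 0) (locally 0).
Proof.
apply: (Rlim_squeeze_0 _ _ (fun x => 2 * exp (1 / 2 * ln x))).
- apply: filter_imp unit_at_right_0. intros x Hx.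
  assert (Hl : ln x < 0) by (rewrite -ln_1; apply ln_increasing; lra).
  rewrite Rabs_mult (Rabs_pos_eq x); last lra. rewrite Rabs_left //.
  rewrite -{1}(exp_ln x); last lra.
  replace (exp (ln x)) with (exp (1 / 2 * ln x) * exp (1 / 2 * ln x)) by (rewrite -exp_plus; f_equal; field).
  pose proof (exp_pos (1 / 2 * ln x)) as P.
  pose proof (exp_ineq1_le (- (1 / 2 * ln x))) as Q. rewrite exp_Ropp in Q.
  set (e := exp _) in *.
  assert (- ln x <= 2 * / e) by lra.
  apply Rle_trans with (e * e * (2 * / e)); first by apply Rmult_le_compat_l; nra.
  apply Req_le. field. lra.
- apply (Rlim_eq _ _ (2 * 0)); first by ring.
  apply: Rlim_mult; first by apply: filterlim_const. apply lim_pow_0. lra.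
Qed.

(** A primitive of [cot (PI u / 2) + 2 ln (1 - u) / (PI u^2)]. *)
Definition jfun (u : R) : R := 2 / PI * (ln (sin (PI * u / 2) / u) + (ln (1 - u) - ln (1 - u) / u)).

Lemma jfun_derive (u : R) : 0 < u < 1 ->
  is_derive jfun u (cot_half u + 2 * ln (1 - u) / (PI * u ^ 2)).
Proof.
intros Hu. pose proof (sin_half_pos u Hu) as Hs. pose proof PI_RGT_0.
unfold jfun. auto_derive.
- repeat split; try lra. apply Rmult_lt_0_compat => //. apply Rinv_0_lt_compat; lra.
- unfold Rdiv in *. change (1 + - u) with (1 - u).
  set (S := sin _) in *. set (c := cos _). set (L := ln _). field. repeat split; lra.
Qed.

Lemma sin_quotient : filterlim (fun u => sin (PI * u / 2) / u) (at_right 0) (locally (PI / 2)).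
Proof.
apply derive_quotient.
- auto_derive => //. replace (PI * 0 * / 2) with 0 by ring. rewrite cos_0. field.
- replace (PI * 0 / 2) with 0 by field. apply sin_0.
Qed.

Lemma jfun_lim_0 : filterlim jfun (at_right 0) (locally (2 / PI * (1 + ln (PI / 2)))).
Proof.
pose proof PI_RGT_0. unfold jfun.
apply (Rlim_eq _ _ (2 / PI * (ln (PI / 2) + (ln (1 - 0) + - (-1))))).
{ rewrite Rminus_0_r ln_1. ring. }
apply: Rlim_mult; first by apply: filterlim_const.
apply: Rlim_plus; [|apply: Rlim_plus; [|apply: Rlim_opp]].
- apply: (Rlim_cont _ _ ln); first by apply sin_quotient.
  apply: (ex_derive_cont). auto_derive. lra.
- apply (lim_at_right_cont (fun u => ln (1 - u))).
  apply: (ex_derive_cont). auto_derive. lra.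
- apply derive_quotient.
  + auto_derive; [lra|]. field.
  + by rewrite Rminus_0_r ln_1.
Qed.

Lemma jfun_lim_1 : filterlim jfun (at_left 1) (locally 0).
Proof.
pose proof PI_RGT_0.
apply (filterlim_ext_loc (fun u => 2 / PI * (ln (sin (PI * u / 2) / u) + - (((1 - u) * ln (1 - u)) * / u)))).
- apply: filter_imp unit_at_left_1. intros u Hu. unfold jfun. f_equal. f_equal. field. lra.
- assert (S1 : sin (PI * 1 / 2) / 1 = 1).
  { replace (PI * 1 / 2) with (PI / 2) by field. rewrite sin_PI2. field. }
  apply (Rlim_eq _ _ (2 / PI * (ln (sin (PI * 1 / 2) / 1) + - (0 * / 1)))).
  { rewrite S1 ln_1. ring. }
  apply: Rlim_mult; first by apply: filterlim_const.
  apply: Rlim_plus; [|apply: Rlim_opp; apply: Rlim_mult].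
  + apply (lim_at_left_cont (fun u => ln (sin (PI * u / 2) / u))).
    apply: (ex_derive_cont). auto_derive.
    unfold Rdiv in S1. rewrite S1. repeat split; lra.
  + exact (filterlim_comp _ _ _ _ _ _ _ _ at_left_1_refl xlnx_lim).
  + apply (lim_at_left_cont Rinv). apply: (ex_derive_cont). auto_derive. lra.
Qed.

Lemma Cpower_ipi (k : C) : Cpower ipi k = (Cpower Ci k * Cpower (RtoC PI) k)%C.
Proof. unfold ipi. apply Cpower_Ci_mult. simpl. apply PI_RGT_0. Qed.

Lemma is_Cderive_one_minus (u : R) : is_Cderive (fun u => RtoC 1 - RtoC u)%C u (- RtoC 1)%C.
Proof.
eapply is_Cderive_eq; [apply: is_Cderive_minus; [apply: is_Cderive_const|apply is_Cderive_id]|]. ring.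
Qed.

Lemma is_Cderive_pow_one_minus (k : C) (u : R) : u < 1 ->
  is_Cderive (fun u => Cpower (RtoC 1 - RtoC u) k)%C u (- (k * Cpower (RtoC 1 - RtoC u) (k - 1)))%C.
Proof.
intros Hu. eapply is_Cderive_eq.
- apply: is_Cderive_Cpower; [left; simpl; lra|apply is_Cderive_one_minus].
- cbv beta. ring.
Qed.

Lemma is_Cderive_pi_log (u : R) : u < 1 ->
  is_Cderive (fun u => RtoC PI + Ci * RtoC (ln (1 - u)))%C u (Ci * RtoC (- / (1 - u)))%C.
Proof.
intros Hu. eapply is_Cderive_eq.
- apply: is_Cderive_plus; [apply: is_Cderive_const|].
  apply: is_Cderive_mult; [apply: is_Cderive_const|].
  apply: (is_Cderive_RtoC (fun u => ln (1 - u)) u (- / (1 - u))).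
  auto_derive; [lra|]. field. lra.
- cbv beta. ring.
Qed.

(** On the line [Im t = PI] put [t = i pi - ln (1 - u)]; then
    [e^t / (e^t + 1)^2 dt = - du / u^2]. *)
Lemma top_form (k : C) (u : R) : 0 < u < 1 ->
  (RtoC (/ (1 - u)) * G_top k (- ln (1 - u)))%C =
  (Cpower ipi k * ((1 - Cpower (RtoC PI) (- k) * Cpower (RtoC PI + Ci * RtoC (ln (1 - u))) k)
     - k / ipi * RtoC (ln (1 - u))) / RtoC (u ^ 2))%C.
Proof.
intros Hu. pose proof PI_RGT_0 as Hpi.
assert (Hl : ln (1 - u) < 0) by (rewrite -ln_1; apply ln_increasing; lra).
unfold G_top. rewrite Rmax_right; last lra. set (L := ln (1 - u)) in *.
set (t := (ipi + RtoC (- L))%C).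
assert (Et : t = (Ci * (RtoC PI + Ci * RtoC L))%C).
{ unfold t, ipi. apply injective_projections; simpl; ring. }
assert (Hti : t <> ipi).
{ intros E. apply (f_equal fst) in E. simpl in E. lra. }
assert (Ht0 : t <> 0).
{ intros E. apply (f_equal snd) in E. simpl in E. lra. }
rewrite G_neq //. unfold numer. rewrite pow0_neq //.
assert (Ek : Ckernel t = (- RtoC ((1 - u) / u ^ 2))%C).
{ unfold Ckernel, t. rewrite Cexp_plus Cexp_ipi Cexp_R exp_Ropp. unfold L. rewrite exp_ln; last lra.
  replace (- RtoC 1 * RtoC (/ (1 - u)))%C with (RtoC (- / (1 - u))) by (rewrite RtoC_opp; ring).
  rewrite -RtoC_plus -RtoC_mult -RtoC_div.
  - rewrite -RtoC_opp. f_equal. field. repeat split; try lra.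
  - apply Rmult_integral_contrapositive.
    assert (- / (1 - u) + 1 <> 0); last by split.
    intros E. apply (f_equal (fun x => x * (1 - u))) in E. field_simplify in E; lra. }
assert (Ec : Cpower t k = (Cpower Ci k * Cpower (RtoC PI + Ci * RtoC L) k)%C).
{ rewrite Et. apply Cpower_Ci_mult. simpl. lra. }
rewrite Ek Ec Cpower_minus_1; last by apply ipi_neq_0.
rewrite !Cpower_ipi Cpower_opp.
replace (t - ipi)%C with (- RtoC L)%C by (unfold t; rewrite RtoC_opp; ring).
rewrite RtoC_div; last by nra.
rewrite RtoC_inv; last lra.
assert (U1 : RtoC (1 - u) <> 0) by (apply RtoC_neq_0; lra).
assert (U2 : RtoC (u ^ 2) <> 0) by (apply RtoC_neq_0; nra).
pose proof (Cpower_neq_0 (RtoC PI) k). pose proof ipi_neq_0.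
set (a := Cpower Ci k). set (b := Cpower (RtoC PI) k) in *. set (c := Cpower _ k).
field. done.
Qed.

(** On the segment put [t = i pi (1 - u)]; then
    [e^t / (e^t + 1)^2 = 1 / (4 sin^2 (pi u / 2))]. *)
Lemma left_form (k : C) (u : R) : 0 < u < 1 ->
  G_left k (PI * (1 - u)) = (Cpower ipi k * (Cpower (RtoC 1 - RtoC u) k - 1 + k * RtoC u)
    / RtoC (4 * sin (PI * u / 2) ^ 2))%C.
Proof.
intros Hu. pose proof PI_RGT_0 as Hpi. pose proof (sin_half_pos u Hu) as Hs.
unfold G_left. rewrite clamp_id; last nra.
set (t := (Ci * RtoC (PI * (1 - u)))%C).
assert (Et : t = (RtoC (1 - u) * ipi)%C).
{ unfold t, ipi. rewrite RtoC_mult. ring. }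
assert (Hti : t <> ipi).
{ intros E. apply (f_equal snd) in E. simpl in E. nra. }
assert (Ht0 : t <> 0).
{ intros E. apply (f_equal snd) in E. simpl in E. nra. }
rewrite G_neq //. unfold numer. rewrite pow0_neq //.
assert (Ec : Cpower t k = (Cpower (RtoC 1 - RtoC u) k * Cpower ipi k)%C).
{ rewrite Et Cpower_scal //; [by rewrite RtoC_minus|lra|apply ipi_neq_0]. }
assert (Ek : Ckernel t = (/ RtoC (4 * sin (PI * u / 2) ^ 2))%C).
{ unfold Ckernel.
  (* [e^(t/2) + e^(-t/2)] is [2 sin (PI u / 2)]. *)
  assert (H : ((Cexp t + 1) * (Cexp t + 1))%C = (RtoC (4 * sin (PI * u / 2) ^ 2) * Cexp t)%C).
  { unfold t. rewrite Cexp_Ci.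
    replace (PI * (1 - u)) with (PI - 2 * (PI * u / 2)) by field.
    set (x := PI * u / 2).
    replace (cos (PI - 2 * x)) with (- cos (2 * x)) by (rewrite cos_minus cos_PI sin_PI; ring).
    replace (sin (PI - 2 * x)) with (sin (2 * x)) by (rewrite sin_minus cos_PI sin_PI; ring).
    rewrite cos_2a sin_2a. pose proof (sin2_cos2 x) as E. unfold Rsqr in E.
    set (s := sin x) in *. set (c := cos x) in *.
    assert (E' : c * c = 1 - s * s) by lra.
    apply injective_projections; simpl.
    - rewrite E'. replace (2 * s * c * (2 * s * c)) with (4 * (s * s) * (c * c)) by ring.
      rewrite ?E'. ring_simplify. replace (c ^ 2) with (1 - s * s) by (rewrite -E'; ring). ring.
    - rewrite E'. ring. }
  rewrite H. field. split; [apply RtoC_neq_0; nra|apply Cexp_neq_0]. }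
rewrite Ek Ec Cpower_minus_1; last by apply ipi_neq_0.
rewrite Et RtoC_minus. field. split; [apply RtoC_neq_0; nra|apply ipi_neq_0].
Qed.

Definition top_int (k : C) (u : R) : C := Cint (G_top k) 0 (- ln (1 - u)).
Definition left_int (k : C) (u : R) : C := Cint (G_left k) 0 (PI * (1 - u)).
Definition cot_term (k : C) (u : R) : C :=
  ((Cpower (RtoC 1 - RtoC u) k - 1 + k * RtoC u) * RtoC (cot_half u))%C.

(** The integrals of [G] over the two sides of the contour, seen as functions
    of [u], the boundary term [cot_term] of an integration by parts on the
    vertical side, and [jfun] for the terms [i cot (PI u / 2)] and
    [2 i ln (1 - u) / (PI u^2)] that regularise the two sides separately. *)
Definition eta_primitive (k : C) (u : R) : C :=
  (- Ci * RtoC (jfun u) + Ci / k * cot_term k u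
   - 2 * Ci / (k * Cpower ipi k) * left_int k u + 2 / (k * Cpower ipi k) * top_int k u)%C.

Lemma is_Cderive_scal (c : C) (f : R -> C) (x : R) (l : C) :
  is_Cderive f x l -> is_Cderive (fun t => c * f t)%C x (c * l)%C.
Proof.
intros H. eapply is_Cderive_eq; [apply: is_Cderive_mult; [apply: is_Cderive_const|exact H]|].
cbv beta. ring.
Qed.

Lemma eta_primitive_derive (k : C) (u : R) : 0 < Re k -> 0 < u < 1 ->
  is_Cderive (eta_primitive k) u (eta_integrand k u).
Proof.
intros Hk Hu. pose proof PI_RGT_0 as Hpi. pose proof (sin_half_pos u Hu) as Hs.
assert (Hk0 : k <> 0) by (intros E; rewrite E in Hk; simpl in Hk; lra).
assert (DT : is_Cderive (top_int k) u (RtoC (/ (1 - u)) * G_top k (- ln (1 - u)))%C).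
{ apply (is_Cderive_comp_R (Cint (G_top k) 0) (fun u => - ln (1 - u))).
  - apply Cint_derive. intros z. by apply G_top_cont.
  - auto_derive; [lra|]. field. lra. }
assert (DL : is_Cderive (left_int k) u (RtoC (- PI) * G_left k (PI * (1 - u)))%C).
{ apply (is_Cderive_comp_R (Cint (G_left k) 0) (fun u => PI * (1 - u))).
  - apply Cint_derive. intros z. by apply G_left_cont.
  - auto_derive => //. ring. }
assert (DJ := is_Cderive_RtoC _ _ _ (jfun_derive u Hu)).
assert (DC : is_Cderive (cot_term k) u
  ((k - k * Cpower (RtoC 1 - RtoC u) (k - 1)) * RtoC (cot_half u) +
   (Cpower (RtoC 1 - RtoC u) k - 1 + k * RtoC u) * RtoC (- (PI / 2) / sin (PI * u / 2) ^ 2))%C).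
{ eapply is_Cderive_eq.
  - apply: is_Cderive_mult.
    + apply: is_Cderive_plus.
      * apply: is_Cderive_minus; [apply is_Cderive_pow_one_minus; lra|apply: is_Cderive_const].
      * apply: is_Cderive_scal. apply is_Cderive_id.
    + apply: (is_Cderive_RtoC (fun u => cot_half u) u (- (PI / 2) / sin (PI * u / 2) ^ 2)).
      auto_derive.
      * lra.
      * pose proof (sin2_cos2 (PI * u / 2)) as E. unfold Rsqr, Rdiv in *.
        set (s := sin _) in *. set (c := cos _) in *.
        assert (E' : c * c = 1 - s * s) by lra.
        apply Rmult_eq_reg_r with (s ^ 2); last nra. field_simplify; try lra.
        replace (c ^ 2) with (1 - s * s) by (rewrite -E'; ring). field.
  - cbv beta. ring. }
eapply is_Cderive_eq.
- apply: is_Cderive_plus.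
  + apply: is_Cderive_minus.
    * apply: is_Cderive_plus; apply: is_Cderive_scal; [exact DJ|exact DC].
    * apply: is_Cderive_scal. exact DL.
  + apply: is_Cderive_scal. exact DT.
- rewrite top_form // left_form //. unfold eta_integrand. rewrite (RtoC_minus 1 u).
  assert (U2 : RtoC (u ^ 2) <> 0) by (apply RtoC_neq_0; nra).
  assert (Q : RtoC (- (PI / 2) / sin (PI * u / 2) ^ 2) = (- (2 * RtoC PI) * / RtoC (4 * sin (PI * u / 2) ^ 2))%C).
  { rewrite -RtoC_inv; last nra. rewrite -!RtoC_mult -RtoC_opp -RtoC_mult. f_equal. field. lra. }
  assert (Q2 : RtoC (cot_half u + 2 * ln (1 - u) / (PI * u ^ 2)) =
    (RtoC (cot_half u) + 2 * RtoC (ln (1 - u)) / (RtoC PI * RtoC (u ^ 2)))%C).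
  { rewrite RtoC_plus (RtoC_div (2 * ln (1 - u))); last by apply Rgt_not_eq, Rmult_lt_0_compat; nra.
    by rewrite !RtoC_mult. }
  rewrite Q Q2. rewrite RtoC_opp.
  assert (S4 : RtoC (4 * sin (PI * u / 2) ^ 2) <> 0) by (apply RtoC_neq_0; nra).
  assert (HP : RtoC PI <> 0) by (apply RtoC_neq_0; lra).
  pose proof (Cpower_neq_0 ipi k) as Hq.
  assert (Hi : Ci <> 0) by (intros E; apply (f_equal snd) in E; simpl in E; lra).
  assert (Hii : (/ Ci)%C = (- Ci)%C).
  { apply injective_projections; simpl; field. }
  replace (k / ipi)%C with (k * - Ci / RtoC PI)%C.
  2: { unfold ipi. rewrite -Hii. field. done. }
  set (A := Cpower (RtoC 1 - RtoC u) k). set (B := Cpower (RtoC 1 - RtoC u) (k - 1)).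
  set (Z := Cpower (RtoC PI) (- k)). set (Y := Cpower (RtoC PI + _) k). set (q := Cpower ipi k) in *.
  set (co := RtoC (cot_half u)).
  set (s4 := RtoC (4 * _)) in *. set (u2 := RtoC (u ^ 2)) in *. set (ell := RtoC (ln (1 - u))).
  field. done.
Qed.

Lemma Clim_within {x : R} (D : R -> Prop) (f : R -> C) (l : C) :
  Clim (locally x) f l -> Clim (within D (locally x)) f l.
Proof. intros [A B]. split; (apply: filterlim_filter_le_1; [|eassumption]); apply filter_le_within. Qed.

Lemma Clim_eq {T : Type} (F : (T -> Prop) -> Prop) (f : T -> C) (a b : C) :
  a = b -> Clim F f a -> Clim F f b.
Proof. by intros ->. Qed.

Lemma Cpower_base_1 (k : C) : Cpower (RtoC 1) k = 1.
Proof.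
unfold Cpower. rewrite Clog_R; [|lra]. rewrite ln_1 Cmult_0_r. apply Cexp_0.
Qed.

Lemma left_int_cont (k : C) (u : R) : 0 < Re k -> Clim (locally u) (left_int k) (left_int k u).
Proof.
intros Hk. apply: is_Cderive_Clim. apply (is_Cderive_comp_R (Cint (G_left k) 0) (fun u => PI * (1 - u)) u (- PI)).
- apply Cint_derive. intros z. by apply G_left_cont.
- auto_derive => //. ring.
Qed.

Lemma top_int_cont (k : C) (u : R) : 0 < Re k -> u < 1 -> Clim (locally u) (top_int k) (top_int k u).
Proof.
intros Hk Hu. apply: is_Cderive_Clim.
apply (is_Cderive_comp_R (Cint (G_top k) 0) (fun u => - ln (1 - u)) u (/ (1 - u))).
- apply Cint_derive. intros z. by apply G_top_cont.
- auto_derive; [lra|]. field. lra.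
Qed.

Lemma cot_term_lim_0 (k : C) : Clim (at_right 0) (cot_term k) 0.
Proof.
pose proof PI_RGT_0 as Hpi.
set (f := fun u : R => (Cpower (RtoC 1 - RtoC u) k - 1 + k * RtoC u)%C).
assert (E1 : (RtoC 1 - RtoC 0)%C = RtoC 1) by ring.
assert (Hf : is_Cderive f 0 0).
{ eapply is_Cderive_eq.
  - apply: is_Cderive_plus.
    + apply: is_Cderive_minus; [apply is_Cderive_pow_one_minus; lra|apply: is_Cderive_const].
    + apply: is_Cderive_scal. apply is_Cderive_id.
  - cbv beta. rewrite E1 Cpower_base_1. ring. }
assert (Hf0 : f 0 = 0) by (unfold f; rewrite E1 Cpower_base_1; ring).
apply (Clim_ext_loc _ (fun u => f u * RtoC (/ u) * RtoC (cos (PI * u / 2) * / (sin (PI * u / 2) / u)))%C).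
- apply: filter_imp unit_at_right_0. intros u Hu. unfold cot_term. fold (f u).
  pose proof (sin_half_pos u Hu).
  rewrite -Cmult_assoc -RtoC_mult. f_equal. f_equal. field. lra.
- apply (Clim_eq _ _ (0 * RtoC (cos (PI * 0 / 2) * / (PI / 2)))%C); first by ring.
  apply: Clim_mult; first by apply Cderive_quotient.
  apply: Clim_RtoC. apply: Rlim_mult.
  + apply (lim_at_right_cont (fun u => cos (PI * u / 2))).
    apply: (ex_derive_cont). by auto_derive.
  + apply: (Rlim_cont _ _ Rinv); first by apply sin_quotient.
    apply: (ex_derive_cont). auto_derive. lra.
Qed.

Lemma cot_term_lim_1 (k : C) : 0 < Re k -> Clim (at_left 1) (cot_term k) 0.
Proof.
intros Hk. pose proof PI_RGT_0 as Hpi. unfold cot_term.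
assert (E : PI * 1 / 2 = PI / 2) by field.
apply (Clim_eq _ _ ((0 - 1 + k * RtoC 1) * RtoC (cos (PI * 1 / 2) / sin (PI * 1 / 2)))%C).
{ rewrite E cos_PI2 sin_PI2. replace (0 / 1) with 0 by field. ring. }
apply: Clim_mult.
- apply: Clim_plus; [apply: Clim_minus; [|apply: Clim_const]|apply: Clim_mult; [apply: Clim_const|]].
  + apply (Clim_ext_loc _ (fun u => Cpower (RtoC (1 - u)) k)).
    * apply filter_forall. intros u. by rewrite RtoC_minus.
    * exact (Clim_comp _ _ _ _ _ at_left_1_refl (Clim_pow_0 k Hk)).
  + apply: Clim_within. apply: Clim_RtoC. apply: filterlim_id.
- apply: Clim_RtoC. apply (lim_at_left_cont (fun u => cot_half u)).
  apply: (ex_derive_cont). auto_derive.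
  replace (PI * 1 * / 2) with (PI / 2) by field. rewrite sin_PI2. lra.
Qed.

Lemma neg_log_at_left_1 : filterlim (fun u => - ln (1 - u)) (at_left 1) at_oo.
Proof.
intros P [M HM].
assert (H := at_left_1_refl _ (at_right_lt (exp (- M)) (exp_pos _))).
unfold filtermap in H. assert (H' := unit_at_left_1).
apply: filter_imp (filter_and _ _ H H'). intros u [Hu Hu']. apply HM.
apply ln_increasing in Hu; last lra. rewrite ln_exp in Hu. lra.
Qed.

Lemma eta_integrand_cont (k : C) (u : R) : 0 < Re k -> 0 < u < 1 ->
  Clim (locally u) (eta_integrand k) (eta_integrand k u).
Proof.
intros Hk Hu. pose proof (sin_half_pos u Hu) as Hs. pose proof PI_RGT_0 as Hpi.
assert (Hk0 : k <> 0) by (intros E; rewrite E in Hk; simpl in Hk; lra).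
unfold eta_integrand. apply: Clim_plus.
- apply: Clim_mult; [apply: Clim_mult; [apply: Clim_const|]|].
  + apply (Clim_ext_loc _ (fun u => Cpower (RtoC 1 - RtoC u) (k - 1))%C).
    { apply filter_forall. intros z. by rewrite RtoC_minus. }
    rewrite RtoC_minus. apply: is_Cderive_Clim. apply is_Cderive_pow_one_minus. lra.
  + apply: Clim_RtoC.
    apply: (ex_derive_cont (fun u => cot_half u)).
    auto_derive. unfold Rdiv in Hs. lra.
- apply: Clim_div.
  + apply Cmult_neq_0 => //. apply RtoC_neq_0. nra.
  + apply: Clim_mult; [apply: Clim_const|]. apply: Clim_minus; [apply: Clim_const|].
    apply: Clim_mult; [apply: Clim_const|].
    apply: is_Cderive_Clim. apply: is_Cderive_Cpower; last by (apply is_Cderive_pi_log; lra).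
    left. simpl. lra.
  + apply: Clim_mult; [apply: Clim_const|]. apply: Clim_RtoC.
    apply: (ex_derive_cont (fun u => u ^ 2)). by auto_derive.
Qed.

Definition eta_integral_value (k I : C) : C :=
  (2 / (k * Cpower ipi k) * bottom_value k I + Ci * RtoC (2 / PI * (1 + ln (PI / 2))))%C.

(** At [0] only [jfun] and the vertical side contribute, at [1] only the upper
    side, whose value comes from [contour]; the vertical integral cancels. *)
Lemma eta_integral (k I : C) : 0 < Re k ->
  is_halfint (fun t => Cpower (RtoC t) k * RtoC (kernel t))%C I ->
  is_RInt_gen (V := C_R_NormedModule) (eta_integrand k) (at_right 0) (at_left 1) (eta_integral_value k I).
Proof.
intros Hk HI. pose proof PI_RGT_0 as Hpi.
set (J := Cint (G_left k) 0 PI). set (q := (k * Cpower ipi k)%C).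
set (j0 := RtoC (2 / PI * (1 + ln (PI / 2)))).
replace (eta_integral_value k I) with
  ((- Ci * 0 + Ci / k * 0 - 2 * Ci / q * 0 + 2 / q * (bottom_value k I - Ci * J)) -
   (- Ci * j0 + Ci / k * 0 - 2 * Ci / q * J + 2 / q * 0))%C
  by (unfold eta_integral_value; fold q j0; unfold Cdiv; ring).
apply (is_RInt_gen_primitive (at_right 0) (at_left 1) (fun u => 0 < u < 1) _ (eta_primitive k)).
- intros; lra.
- apply unit_at_right_0.
- apply unit_at_left_1.
- intros u Hu. by apply eta_primitive_derive.
- intros u Hu. by apply eta_integrand_cont.
- unfold eta_primitive. fold q. apply: Clim_plus; [apply: Clim_minus; [apply: Clim_plus|]|];
  (apply: Clim_mult; [apply: Clim_const|]).
  + apply: Clim_RtoC. apply jfun_lim_0.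
  + apply cot_term_lim_0.
  + apply: Clim_within. unfold J. replace PI with (PI * (1 - 0)) by ring. by apply left_int_cont.
  + apply: Clim_within. apply (Clim_eq _ _ (top_int k 0)); last by apply top_int_cont; lra.
    unfold top_int. rewrite Rminus_0_r ln_1 Ropp_0. apply Cint_point.
- unfold eta_primitive. fold q. apply: Clim_plus; [apply: Clim_minus; [apply: Clim_plus|]|];
  (apply: Clim_mult; [apply: Clim_const|]).
  + apply: Clim_RtoC. apply jfun_lim_1.
  + by apply cot_term_lim_1.
  + apply: Clim_within. apply (Clim_eq _ _ (left_int k 1)); last by apply left_int_cont.
    unfold left_int. rewrite Rminus_diag Rmult_0_r. apply Cint_point.
  + exact (Clim_comp _ _ _ _ _ neg_log_at_left_1 (contour k _ Hk (G_bot_limit k I Hk HI))).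
Qed.

Lemma is_series_unique_C (a : nat -> C) (l l' : C) :
  is_Cseries a l -> is_Cseries a l' -> l = l'.
Proof.
intros H H'. apply is_series_Clim in H. apply is_series_Clim in H'.
exact (Clim_unique _ _ _ _ H H').
Qed.

Lemma eta_unique (k l : C) : is_Cseries (eta_term k) l -> eta k = l.
Proof.
intros H. unfold eta. apply (iota_unique (V := C_CompleteNormedModule)); last exact H.
intros y Hy. exact (is_series_unique_C _ _ _ Hy H).
Qed.

Lemma Clog_minus_ipi : Clog (- Ci * RtoC PI)%C = (RtoC (ln PI) - ipi / 2)%C.
Proof.
pose proof PI_RGT_0 as Hpi.
replace (- Ci * RtoC PI)%C with (Cexp (RtoC (ln PI) - ipi / 2)%C).
- rewrite Clog_Cexp //. unfold ipi; simpl. lra.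
- replace (RtoC (ln PI) - ipi / 2)%C with (RtoC (ln PI) + Ci * RtoC (- (PI / 2)))%C.
  + rewrite Cexp_plus Cexp_R Cexp_Ci exp_ln // cos_neg sin_neg cos_PI2 sin_PI2.
    apply injective_projections; simpl; ring.
  + unfold ipi. apply injective_projections; simpl; field.
Qed.

(** Both sides are [I / Gamma(k+1)], where [I] is the integral of
    [t^k kernel t]; in the regularising constants [ln 2] cancels. *)
Lemma eta_formula (k : C) : 0 < Re k ->
  ex_series (V := C_NormedModule) (eta_term k) /\
  ex_RInt_gen (V := C_R_NormedModule) (eta_integrand k) (at_right 0) (at_left 1) /\
  (eta k =
    Cpower (Ci * RtoC PI) k / (2 * CGamma (k + 1))
    + Cpower (Ci * RtoC PI) (k - 1) * (1 + Clog (- Ci * RtoC PI)) / CGamma k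
    + Cpower (Ci * RtoC PI) k / (2 * CGamma k)
      * RInt_gen (V := C_R_CompleteNormedModule) (eta_integrand k) (at_right 0) (at_left 1))%C.
Proof.
intros Hk. destruct (kernel_int_ex k Hk) as [I HI].
pose proof (eta_series k I Hk HI) as HE. pose proof (eta_integral k I Hk HI) as HR.
split; [by eexists; exact HE|]. split; [by eexists; exact HR|].
rewrite (eta_unique _ _ HE).
rewrite (is_RInt_gen_unique (V := C_R_CompleteNormedModule) (Fa := at_right 0) (Fb := at_left 1)
  (eta_integrand k) (eta_integral_value k I) HR).
rewrite Clog_minus_ipi CGamma_succ //. fold ipi.
unfold eta_integral_value, bottom_value.
rewrite Cpower_minus_1; last by apply ipi_neq_0.
pose proof PI_RGT_0 as Hpi.
assert (Hk0 : k <> 0) by (intros E; rewrite E in Hk; simpl in Hk; lra).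
pose proof (CGamma_neq_0 k Hk) as HG. pose proof (Cpower_neq_0 ipi k) as Hq. pose proof ipi_neq_0 as Hi.
assert (E : (Ci * RtoC (2 / PI * (1 + ln (PI / 2))))%C = (- 2 / ipi * (1 + RtoC (ln PI) - RtoC (ln 2)))%C).
{ rewrite ln_div; [|lra|lra]. rewrite RtoC_mult RtoC_div; last lra.
  rewrite RtoC_plus RtoC_minus. unfold ipi.
  assert (Hii : (/ Ci)%C = (- Ci)%C) by (apply injective_projections; simpl; field).
  assert (HP : RtoC PI <> 0) by (apply RtoC_neq_0; lra).
  assert (Hc : Ci <> 0) by (intros E; apply (f_equal snd) in E; simpl in E; lra).
  replace (Ci)%C with (- / Ci)%C at 1 by (rewrite Hii; ring).
  field. done. }
rewrite E. set (q := Cpower ipi k) in *. set (g := CGamma k) in *.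
field. done.
Qed.

(** * Exponential remainders *)

(** [exp_tail M z] is [e^z] without the first [M] terms of its series. *)
Fixpoint exp_tail (M : nat) (z : C) : C :=
  match M with
  | O => Cexp z
  | S M' => (exp_tail M' z - z ^ M' / RtoC (INR (fact M')))%C
  end.

Lemma is_Cderive_pow (p : R -> C) (x : R) (d : C) (m : nat) : is_Cderive p x d ->
  is_Cderive (fun t => p t ^ S m / RtoC (INR (fact (S m))))%C x (d * (p x ^ m / RtoC (INR (fact m))))%C.
Proof.
intros Hp.
assert (K : forall m, is_Cderive (fun t => p t ^ m)%C x
  match m with O => 0 | S m' => (RtoC (INR (S m')) * p x ^ m' * d)%C end).
{ intros n. induction n as [|n IH].
  - apply: is_Cderive_const.
  - apply (is_Cderive_ext_loc (fun t => p t * p t ^ n)%C); first by apply filter_forall.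
    eapply is_Cderive_eq; [apply: is_Cderive_mult; [exact Hp|exact IH]|]. cbv beta.
    rewrite S_INR RtoC_plus. destruct n as [|n]; [simpl; ring|]. simpl Cpow. ring. }
eapply is_Cderive_eq; [apply: is_Cderive_mult; [exact (K (S m))|apply: is_Cderive_const]|]. cbv beta.
rewrite fact_simpl mult_INR RtoC_mult.
assert (RtoC (INR (fact m)) <> 0) by (apply RtoC_neq_0, INR_fact_neq_0).
assert (RtoC (INR (S m)) <> 0) by (apply RtoC_neq_0, not_0_INR; lia).
field. done.
Qed.

Lemma exp_tail_derive (p : R -> C) (x : R) (d : C) (M : nat) : is_Cderive p x d ->
  is_Cderive (fun t => exp_tail M (p t)) x (d * exp_tail (Nat.pred M) (p x))%C.
Proof.
intros Hp. induction M as [|M IH].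
- by apply: is_Cderive_Cexp.
- simpl Nat.pred. destruct M as [|M].
  + simpl exp_tail. eapply is_Cderive_eq.
    * apply: is_Cderive_minus; [apply: is_Cderive_Cexp; exact Hp|apply: is_Cderive_const].
    * cbv beta. ring.
  + eapply is_Cderive_eq.
    * exact (is_Cderive_minus _ _ _ _ _ IH (is_Cderive_pow p x d M Hp)).
    * simpl. ring.
Qed.

Lemma exp_tail_0 (M : nat) : exp_tail (S M) 0 = 0.
Proof.
induction M as [|M IH].
- simpl. rewrite Cexp_0. field.
- change (exp_tail (S (S M)) 0) with (exp_tail (S M) 0 - RtoC 0 ^ S M / RtoC (INR (fact (S M))))%C.
  rewrite IH. simpl Cpow. unfold Cdiv. ring.
Qed.

(** The derivative of [x |-> exp_tail (S M) (x z)] is [z exp_tail M (x z)].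
    The mean value inequality loses a factor [2]; the weight [4] in the exponent
    leaves a gain of [1/2] at each step. *)
Lemma exp_tail_bound (M : nat) (z : C) : Cmod (exp_tail M z) <= (1 / 2) ^ M * exp (4 * Cmod z).
Proof.
revert z. induction M as [|M IH]; intros z.
- simpl. rewrite Rmult_1_l Cmod_Cexp. apply exp_le_compat.
  pose proof (Rle_trans _ _ _ (Rle_abs _) (re_le_Cmod z)). pose proof (Cmod_ge_0 z). lra.
- destruct (Req_dec (Cmod z) 0) as [Ez|Ez].
  + apply Cmod_eq_0 in Ez. rewrite Ez exp_tail_0 Cmod_0.
    apply Rmult_le_pos; [apply pow_le; lra|left; apply exp_pos].
  + assert (Pz : 0 < Cmod z) by (pose proof (Cmod_ge_0 z); lra).
    replace (exp_tail (S M) z) with (exp_tail (S M) (RtoC 1 * z) - exp_tail (S M) (RtoC 0 * z))%C.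
    2: { rewrite Cmult_1_l Cmult_0_l exp_tail_0. ring. }
    set (A := (1 / 2) ^ M). assert (PA : 0 < A) by (apply pow_lt; lra).
    apply Rle_trans with (2 * (A / 4 * exp (4 * (1 * Cmod z)) - A / 4 * exp (4 * (0 * Cmod z)))).
    * apply (Cmean_value_gen (fun t => exp_tail (S M) (RtoC t * z)) (fun t => z * exp_tail M (RtoC t * z))%C
        (fun t => A / 4 * exp (4 * (t * Cmod z))) (fun t => A * Cmod z * exp (4 * (t * Cmod z)))); first lra.
      -- intros x _. apply (exp_tail_derive (fun t => RtoC t * z)%C). apply is_Cderive_line.
      -- intros x _. auto_derive => //. field.
      -- intros x Hx. rewrite Cmod_mult (Rmult_comm A) Rmult_assoc.
         apply Rmult_le_compat_l; first lra.
         eapply Rle_trans; [apply IH|]. fold A.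
         rewrite Cmod_mult Cmod_R Rabs_pos_eq; last lra. lra.
    * rewrite Rmult_1_l Rmult_0_l Rmult_0_r exp_0. simpl. fold A. lra.
Qed.

(** * Sum minus integral *)

Lemma Cint_FTC (F f : R -> C) (a b : R) : a <= b ->
  (forall x, a <= x <= b -> is_Cderive F x (f x)) ->
  (forall x, a <= x <= b -> Clim (locally x) f (f x)) -> Cint f a b = (F b - F a)%C.
Proof.
intros Hab Hd Hc.
assert (K : forall h dh : R -> R, (forall x, a <= x <= b -> is_derive h x (dh x)) ->
  (forall x, a <= x <= b -> continuous dh x) -> RInt dh a b = h b - h a).
{ intros h dh H1 H2. apply is_RInt_unique.
  apply (is_RInt_derive (V := R_CompleteNormedModule) h dh); intros x Hx;
  rewrite Rmin_left // Rmax_right // in Hx; auto. }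
unfold Cint. apply injective_projections.
- exact (K (fun t => Re (F t)) (fun t => Re (f t)) (fun x Hx => proj1 (Hd x Hx)) (fun x Hx => proj1 (Hc x Hx))).
- exact (K (fun t => Im (F t)) (fun t => Im (f t)) (fun x Hx => proj2 (Hd x Hx)) (fun x Hx => proj2 (Hc x Hx))).
Qed.

Lemma Cint_lin (f g : R -> C) (c : C) (a b : R) : a <= b ->
  (forall x, a <= x <= b -> Clim (locally x) f (f x)) ->
  (forall x, a <= x <= b -> Clim (locally x) g (g x)) ->
  Cint (fun x => f x - c * g x)%C a b = (Cint f a b - c * Cint g a b)%C.
Proof.
intros Hab Hf Hg.
assert (Ex : forall h : R -> R, (forall x, a <= x <= b -> continuous h x) -> is_RInt h a b (RInt h a b)).
{ intros h Hh. apply: RInt_correct. apply: ex_RInt_continuous. intros z Hz.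
  rewrite Rmin_left // Rmax_right // in Hz. by apply Hh. }
assert (F1 := Ex (fun t => Re (f t)) (fun x Hx => proj1 (Hf x Hx))).
assert (F2 := Ex (fun t => Im (f t)) (fun x Hx => proj2 (Hf x Hx))).
assert (G1 := Ex (fun t => Re (g t)) (fun x Hx => proj1 (Hg x Hx))).
assert (G2 := Ex (fun t => Im (g t)) (fun x Hx => proj2 (Hg x Hx))).
unfold Cint. apply injective_projections; simpl; apply is_RInt_unique.
- exact (is_RInt_minus _ _ _ _ _ _ F1 (is_RInt_minus _ _ _ _ _ _
    (is_RInt_scal _ _ _ (fst c) _ G1) (is_RInt_scal _ _ _ (snd c) _ G2))).
- exact (is_RInt_minus _ _ _ _ _ _ F2 (is_RInt_plus _ _ _ _ _ _
    (is_RInt_scal _ _ _ (fst c) _ G2) (is_RInt_scal _ _ _ (snd c) _ G1))).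
Qed.

Definition node (n : nat) : R := INR (S n).

Lemma node_ge_1 (n : nat) : 1 <= node n.
Proof. unfold node. rewrite S_INR. pose proof (pos_INR n). lra. Qed.

Lemma node_S (n : nat) : node (S n) = node n + 1.
Proof. unfold node. by rewrite S_INR. Qed.

(** The value of [f] at [n+1] minus its integral from [n+1] to [n+2]. *)
Definition defect (f : R -> C) (n : nat) : C := (f (node n) - Cint f (node n) (node n + 1))%C.

(** The bound is an increment of one function [G], so its sum over [n]
    telescopes. *)
Lemma defect_bound (f df : R -> C) (G g : R -> R) (n : nat) :
  (forall x, 1 <= x -> is_Cderive f x (df x)) ->
  (forall x, 1 <= x -> is_derive G x (g x)) ->
  (forall x, 1 <= x -> Cmod (df x) <= g x) ->
  Cmod (defect f n) <= 4 * (G (node (S n)) - G (node n)).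
Proof.
intros Hf HG Hb. pose proof (node_ge_1 n) as Hn. rewrite node_S. set (a := node n) in *.
assert (Cf : forall x, a <= x <= a + 1 -> Clim (locally x) f (f x)).
{ intros x Hx. apply: is_Cderive_Clim. apply Hf. lra. }
assert (E : defect f n = (- Cint (fun x => f x - 1 * f a)%C a (a + 1))%C).
{ rewrite (Cint_lin f (fun _ => f a)); [|lra|done|by intros; apply: Clim_const].
  rewrite (Cint_FTC (fun x => RtoC x * f a)%C (fun _ => f a)); [|lra|by intros; apply is_Cderive_line|by intros; apply: Clim_const].
  unfold defect. fold a. rewrite RtoC_plus. ring. }
rewrite E Cmod_opp.
replace (4 * (G (a + 1) - G a)) with (2 * ((a + 1 - a) * (2 * (G (a + 1) - G a)))) by ring.
apply Cmod_Cint_le; first lra.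
- intros x Hx. apply: Clim_minus; [by apply Cf|apply: Clim_const].
- intros x Hx. rewrite Cmult_1_l.
  apply Rle_trans with (2 * (G x - G a)).
  + apply (Cmean_value_gen f df G g); [lra|intros; apply Hf; lra|intros; apply HG; lra|intros; apply Hb; lra].
  + assert (G x <= G (a + 1)); last lra.
    apply (derive_nonneg_incr G g); [lra|intros; apply HG; lra|].
    intros y Hy. eapply Rle_trans; [apply Cmod_ge_0|apply Hb; lra].
Qed.

Lemma defect_lin (f g : R -> C) (c : C) (n : nat) :
  (forall x, 1 <= x -> Clim (locally x) f (f x)) ->
  (forall x, 1 <= x -> Clim (locally x) g (g x)) ->
  defect (fun x => f x - c * g x)%C n = (defect f n - c * defect g n)%C.
Proof.
intros Hf Hg. pose proof (node_ge_1 n). unfold defect.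
rewrite Cint_lin; [ring|lra|intros; apply Hf; lra|intros; apply Hg; lra].
Qed.

(** * The continuation of zeta *)

Definition telescope (d : R) (n : nat) : R := exp (- d * ln (node n)) - exp (- d * ln (node (S n))).

Lemma lim_node_pow (d : R) : 0 < d -> filterlim (fun n => exp (- d * ln (node n))) eventually (locally 0).
Proof.
intros Hd. apply: filterlim_ext (lim_INR_pow d Hd). intros n. unfold node. by rewrite S_INR.
Qed.

Lemma eventually_shift (f : nat -> nat) : (forall n, (n <= f n)%nat) -> filterlim f eventually eventually.
Proof. intros Hf P [N HN]. exists N. intros n Hn. apply HN. specialize (Hf n). lia. Qed.

Lemma telescope_series (d : R) : 0 < d -> is_series (telescope d) 1.
Proof.
intros Hd.
assert (E : forall N, sum_n (telescope d) N = 1 + - exp (- d * ln (node (S N)))).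
{ induction N as [|N IH].
  - rewrite sum_O. unfold telescope, node at 1. simpl INR. rewrite ln_1 Rmult_0_r exp_0.
    match goal with |- ?a = ?b => change (@eq R a b) end. ring.
  - rewrite sum_Sn IH. unfold telescope, plus; simpl. match goal with |- ?a = ?b => change (@eq R a b) end. ring. }
assert (L : filterlim (fun N => 1 + - exp (- d * ln (node (S N)))) eventually (locally 1)).
{ apply (Rlim_eq _ _ (1 + - 0)); first by ring.
  apply (Rlim_plus eventually (fun _ => 1)); first by apply filterlim_const. apply (Rlim_opp eventually).
  apply (filterlim_comp nat nat R S (fun N => exp (- d * ln (node N))) eventually eventually).
  - apply eventually_shift. intros; lia.
  - by apply lim_node_pow. }
unfold is_series. apply: filterlim_ext L. intros N. by rewrite E.
Qed.

Lemma Cmod_sum_n_le (a : nat -> C) (b : nat -> R) (N : nat) : (forall n, Cmod (a n) <= b n) ->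
  Cmod (Csum a N) <= sum_n b N.
Proof.
intros H. induction N as [|N IH].
- rewrite !sum_O. apply H.
- rewrite !sum_Sn. eapply Rle_trans; [apply Cmod_triangle|]. apply Rplus_le_compat; [exact IH|apply H].
Qed.

Lemma Cseries_dominated (a : nat -> C) (b : nat -> R) (B : R) :
  (forall n, Cmod (a n) <= b n) -> is_series b B ->
  exists l, is_Cseries a l /\ Cmod l <= B.
Proof.
intros H HB.
destruct (ex_series_le (V := C_CompleteNormedModule) a b) as [l Hl].
- exact H.
- by exists B.
- exists l. split; first exact Hl.
  pose proof (proj1 (is_series_Clim _ _) Hl) as Hc.
  pose proof (Clim_Cmod _ _ _ Hc) as H1.
  apply (filterlim_le (F := eventually) (fun N => Cmod (Csum a N)) (sum_n b) (Cmod l) B) => //.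
  apply filter_forall. intros N. by apply Cmod_sum_n_le.
Qed.

(** [x^(-(w+h))] without the first [M] terms of its expansion in powers of [h]. *)
Definition rho (w h : C) (M : nat) (x : R) : C :=
  (Cpower (RtoC x) (- w) * exp_tail M (- h * RtoC (ln x)))%C.

Definition taylor_coef (w : C) (m : nat) (x : R) : C :=
  (Cpower (RtoC x) (- w) * ((- RtoC (ln x)) ^ m / RtoC (INR (fact m))))%C.

Lemma rho_S (w h : C) (M : nat) (x : R) :
  rho w h (S M) x = (rho w h M x - h ^ M * taylor_coef w M x)%C.
Proof.
unfold rho, taylor_coef. simpl exp_tail.
replace (- h * RtoC (ln x))%C with (h * - RtoC (ln x))%C by ring.
rewrite Cpow_mult_l. unfold Cdiv. ring.
Qed.

Lemma rho_0 (w h : C) (x : R) : 0 < x -> rho w h 0 x = Cpower (RtoC x) (- (w + h)).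
Proof.
intros Hx. unfold rho. simpl. rewrite !Cpower_R // -Cexp_plus. f_equal. ring.
Qed.

Lemma is_Cderive_log (x : R) : 0 < x -> is_Cderive (fun t => RtoC (ln t)) x (RtoC (/ x)).
Proof. intros Hx. apply is_Cderive_RtoC. auto_derive => //. ring. Qed.

Definition drho (w h : C) (M : nat) (x : R) : C :=
  (- w * Cpower (RtoC x) (- w - 1) * exp_tail M (- h * RtoC (ln x)) +
   Cpower (RtoC x) (- w) * (- h * RtoC (/ x) * exp_tail (Nat.pred M) (- h * RtoC (ln x))))%C.

Lemma rho_derive (w h : C) (M : nat) (x : R) : 0 < x ->
  is_Cderive (rho w h M) x (drho w h M x).
Proof.
intros Hx. apply is_Cderive_mult; first by apply is_Cderive_Cpower_R.
apply (exp_tail_derive (fun x => - h * RtoC (ln x))%C). apply is_Cderive_scal. by apply is_Cderive_log.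
Qed.

Lemma taylor_coef_cont (w : C) (m : nat) (x : R) : 0 < x ->
  Clim (locally x) (taylor_coef w m) (taylor_coef w m x).
Proof.
intros Hx. unfold taylor_coef. apply: Clim_mult.
- apply: is_Cderive_Clim. by apply is_Cderive_Cpower_R.
- apply: Clim_mult; last by apply: Clim_const.
  induction m as [|m IH]; simpl; first by apply: Clim_const.
  apply: Clim_mult => //. apply: Clim_opp. apply: is_Cderive_Clim. by apply is_Cderive_log.
Qed.

Lemma rho_cont (w h : C) (M : nat) (x : R) : 0 < x -> Clim (locally x) (rho w h M) (rho w h M x).
Proof. intros Hx. apply: is_Cderive_Clim. by apply rho_derive. Qed.

(** With [Re w = 2 d] the power [x^(-w-1)] decays like [x^(-2d-1)]; the
    condition on [h] makes the exponential bound of the tail cost [x^d] only. *)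
Lemma drho_bound (w h : C) (d : R) (M : nat) (x : R) : 0 < d -> Re w = 2 * d -> 4 * Cmod h <= d -> 1 <= x ->
  Cmod (drho w h M x) <= (1 / 2) ^ M * (Cmod w + d) * exp (- (1 + d) * ln x).
Proof.
intros Hd Hw Hh Hx.
assert (Hl : 0 <= ln x) by (rewrite -ln_1; apply ln_le; lra).
pose proof (Cmod_ge_0 h) as Ph. pose proof (Cmod_ge_0 w) as Pw.
set (z := (- h * RtoC (ln x))%C).
assert (Ez : Cmod z = Cmod h * ln x) by (unfold z; rewrite Cmod_mult Cmod_opp Cmod_R Rabs_pos_eq //).
assert (Hz : exp (4 * Cmod z) <= exp (d * ln x)) by (apply exp_le_compat; rewrite Ez; nra).
set (e := exp (d * ln x)) in *. assert (Pe : 0 < e) by apply exp_pos.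
set (q := (1 / 2) ^ M). assert (Pq : 0 < q) by (apply pow_lt; lra).
assert (T0 : forall m, Cmod (exp_tail m z) <= (1 / 2) ^ m * e).
{ intros m. eapply Rle_trans; [apply exp_tail_bound|]. apply Rmult_le_compat_l => //. apply pow_le; lra. }
assert (T1 : Cmod (exp_tail (Nat.pred M) z) <= 2 * q * e).
{ eapply Rle_trans; [apply T0|]. apply Rmult_le_compat_r; first lra.
  unfold q. destruct M as [|M]; simpl; [lra|]. lra. }
set (p := exp (- (2 * d + 1) * ln x)). assert (Pp : 0 < p) by apply exp_pos.
assert (A1 : Cmod (Cpower (RtoC x) (- w - 1)) = p).
{ rewrite Cmod_Cpower_R; [|lra]. unfold p. f_equal. f_equal.
  transitivity (- Re w - 1); [unfold Re; simpl; ring|]. rewrite Hw. ring. }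
assert (A2 : Cmod (Cpower (RtoC x) (- w)) * / x = p).
{ rewrite Cmod_Cpower_R; [|lra]. rewrite -{2}(exp_ln x); last lra.
  rewrite -exp_Ropp -exp_plus. unfold p. f_equal.
  transitivity (- Re w * ln x + - ln x); [unfold Re; simpl; ring|]. rewrite Hw. ring. }
unfold drho. fold z. eapply Rle_trans; [apply Cmod_triangle|].
assert (B1 : Cmod (- w * Cpower (RtoC x) (- w - 1) * exp_tail M z) = Cmod w * p * Cmod (exp_tail M z)).
{ by rewrite Cmod_mult (Cmod_mult (- w)) Cmod_opp A1. }
assert (B2 : Cmod (Cpower (RtoC x) (- w) * (- h * RtoC (/ x) * exp_tail (Nat.pred M) z)) =
  Cmod (Cpower (RtoC x) (- w)) * (Cmod h * / x * Cmod (exp_tail (Nat.pred M) z))).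
{ rewrite (Cmod_mult (Cpower _ _)) (Cmod_mult (_ * _)%C (exp_tail _ _)) (Cmod_mult (- h)) Cmod_opp Cmod_R Rabs_pos_eq //.
  left; apply Rinv_0_lt_compat; lra. }
rewrite B1 B2.
replace (Cmod (Cpower (RtoC x) (- w)) * (Cmod h * / x * Cmod (exp_tail (Nat.pred M) z))) with
  (Cmod h * p * Cmod (exp_tail (Nat.pred M) z)) by (rewrite -A2; ring).
replace (exp (- (1 + d) * ln x)) with (p * e) by (unfold p, e; rewrite -exp_plus; f_equal; ring).
specialize (T0 M). fold q in T0.
apply Rle_trans with (Cmod w * p * (q * e) + Cmod h * p * (2 * q * e)).
- apply Rplus_le_compat; (apply Rmult_le_compat_l; [apply Rmult_le_pos; lra|done]).
- replace (q * (Cmod w + d) * (p * e)) with (Cmod w * p * (q * e) + d * (p * q * e)) by ring.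
  assert (0 < p * q * e) by (repeat apply Rmult_lt_0_compat => //). nra.
Qed.

Lemma rho_defect (w h : C) (d : R) (M n : nat) : 0 < d -> Re w = 2 * d -> 4 * Cmod h <= d ->
  Cmod (defect (rho w h M) n) <= (1 / 2) ^ M * (4 * (Cmod w + d) / d) * telescope d n.
Proof.
intros Hd Hw Hh. set (K := (1 / 2) ^ M * (Cmod w + d)).
replace ((1 / 2) ^ M * (4 * (Cmod w + d) / d) * telescope d n) with
  (4 * (- (K / d) * exp (- d * ln (node (S n))) - - (K / d) * exp (- d * ln (node n))))
  by (unfold telescope, K; field; lra).
apply (defect_bound (rho w h M) (drho w h M) (fun x => - (K / d) * exp (- d * ln x))
  (fun x => K * exp (- (1 + d) * ln x))).
- intros x Hx. apply rho_derive. lra.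
- intros x Hx. auto_derive; first lra.
  replace (- (1 + d) * ln x) with (- d * ln x + - ln x) by ring.
  rewrite exp_plus exp_Ropp exp_ln; last lra. field. lra.
- intros x Hx. by apply drho_bound.
Qed.

Lemma rho_defect_series (w h : C) (d : R) (M : nat) : 0 < d -> Re w = 2 * d -> 4 * Cmod h <= d ->
  exists l, is_Cseries (defect (rho w h M)) l /\
    Cmod l <= (1 / 2) ^ M * (4 * (Cmod w + d) / d).
Proof.
intros Hd Hw Hh.
apply (Cseries_dominated _ (fun n => (1 / 2) ^ M * (4 * (Cmod w + d) / d) * telescope d n)).
- intros n. by apply rho_defect.
- rewrite -{2}(Rmult_1_r ((1 / 2) ^ M * (4 * (Cmod w + d) / d))).
  apply (is_series_scal (V := R_NormedModule) ((1 / 2) ^ M * (4 * (Cmod w + d) / d))).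
  by apply telescope_series.
Qed.

Definition Cseries (a : nat -> C) : C := iota (T := C_CompleteNormedModule) (is_Cseries a).

Lemma Cseries_correct (a : nat -> C) (l : C) : is_Cseries a l -> Cseries a = l.
Proof.
intros H. apply (iota_unique (V := C_CompleteNormedModule)); last exact H.
intros y Hy. exact (is_series_unique_C _ _ _ Hy H).
Qed.

Lemma is_series_lin (a b : nat -> C) (c la lb : C) :
  is_Cseries a la -> is_Cseries b lb ->
  is_Cseries (fun n => a n - c * b n)%C (la - c * lb)%C.
Proof.
intros Ha Hb.
exact (is_series_minus (V := C_NormedModule) _ _ _ _ Ha (is_series_scal (V := C_NormedModule) c _ _ Hb)).
Qed.

Lemma is_series_ext_C (a b : nat -> C) (l : C) : (forall n, a n = b n) ->
  is_Cseries a l -> is_Cseries b l.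
Proof. intros E. exact (is_series_ext (V := C_NormedModule) a b l E). Qed.

(** Zeta with the integral of [x^(-k)] over [1, oo) removed; this makes the
    series converge absolutely for [0 < Re k]. *)
Definition zeta_reg (k : C) : C := Cseries (defect (fun x => Cpower (RtoC x) (- k))).

Lemma defect_ext (f g : R -> C) (n : nat) : (forall x, 1 <= x -> f x = g x) -> defect f n = defect g n.
Proof.
intros H. pose proof (node_ge_1 n). unfold defect. rewrite (H (node n)) // (Cint_ext f g) //; first lra.
intros x Hx. apply H. lra.
Qed.

Lemma zeta_reg_series (k : C) : 0 < Re k ->
  is_Cseries (defect (fun x => Cpower (RtoC x) (- k))) (zeta_reg k).
Proof.
intros Hk.
destruct (rho_defect_series k 0 (Re k / 2) 0) as [l [Hl _]]; [lra|lra|rewrite Cmod_0; lra|].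
assert (H : is_Cseries (defect (fun x => Cpower (RtoC x) (- k))) l).
{ apply: is_series_ext_C Hl. intros n. apply defect_ext. intros x Hx.
  rewrite rho_0; [|lra]. f_equal. ring. }
unfold zeta_reg. by rewrite (Cseries_correct _ _ H).
Qed.

Definition zeta_reg_coef (w : C) (m : nat) : C := Cseries (defect (taylor_coef w m)).

(** [h^m taylor_coef w m] is the difference of two successive [rho w h]. *)
Lemma zeta_reg_coef_series (w : C) (m : nat) : 0 < Re w ->
  is_Cseries (defect (taylor_coef w m)) (zeta_reg_coef w m).
Proof.
intros Hw.
(* [d / 4] is the largest value that the bound on [rho] admits for [h]. *)
set (d := Re w / 2). set (h := RtoC (d / 4)).
assert (Hd : 0 < d) by (unfold d; lra).
assert (Hwd : Re w = 2 * d) by (unfold d; field).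
assert (Hh : 4 * Cmod h <= d) by (unfold h; rewrite Cmod_R Rabs_pos_eq; lra).
assert (Hh0 : (h ^ m)%C <> 0) by (apply Cpow_nz, RtoC_neq_0; lra).
destruct (rho_defect_series w h d m) as [l1 [H1 _]] => //.
destruct (rho_defect_series w h d (S m)) as [l2 [H2 _]] => //.
assert (H : is_Cseries (defect (taylor_coef w m)) (/ h ^ m * l1 - / h ^ m * l2)%C).
{ apply (is_series_ext_C (fun n => / h ^ m * defect (rho w h m) n - / h ^ m * defect (rho w h (S m)) n)%C).
  - intros n. rewrite (defect_ext (rho w h (S m)) (fun x => rho w h m x - h ^ m * taylor_coef w m x)%C);
      last (intros; apply rho_S).
    rewrite defect_lin.
    + field. done.
    + intros x Hx. apply rho_cont. lra.
    + intros x Hx. apply taylor_coef_cont. lra.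
  - apply is_series_lin => //. exact (is_series_scal (V := C_NormedModule) _ _ _ H1). }
unfold zeta_reg_coef. by rewrite (Cseries_correct _ _ H).
Qed.

Lemma pow_n_Cpow (z : C) (n : nat) : pow_n (K := C_AbsRing) z n = (z ^ n)%C.
Proof. induction n as [|n IH]; [reflexivity|]. simpl. rewrite IH. reflexivity. Qed.

(** The remainder of the Taylor series after [M] terms is the sum of the
    defects of [rho w h M], hence of order [2^(-M)]. *)
Lemma zeta_reg_taylor (w h : C) : 0 < Re w -> 8 * Cmod h <= Re w ->
  is_pseries (K := C_AbsRing) (V := C_NormedModule) (zeta_reg_coef w) h (zeta_reg (w + h)).
Proof.
intros Hw Hh. set (d := Re w / 2).
assert (Hd : 0 < d) by (unfold d; lra).
assert (Hwd : Re w = 2 * d) by (unfold d; field).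
assert (Hh' : 4 * Cmod h <= d) by lra.
set (P := Csum (fun m => h ^ m * zeta_reg_coef w m)%C).
assert (Hwh : 0 < Re (w + h)%C).
{ pose proof (Rle_trans _ _ _ (Rle_abs _) (re_le_Cmod (- h)%C)) as K. rewrite Cmod_opp in K.
  unfold Re in *. simpl in *. lra. }
assert (H0 : is_Cseries (defect (rho w h 0)) (zeta_reg (w + h))).
{ apply: is_series_ext_C (zeta_reg_series _ Hwh). intros n. apply defect_ext. intros x Hx.
  rewrite rho_0 //. lra. }
assert (Step : forall M l, is_Cseries (defect (rho w h M)) l ->
  is_Cseries (defect (rho w h (S M))) (l - h ^ M * zeta_reg_coef w M)%C).
{ intros M l Hl. apply: is_series_ext_C (is_series_lin _ _ _ _ _ Hl (zeta_reg_coef_series w M Hw)).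
  intros n. rewrite -defect_lin.
  - apply defect_ext. intros x Hx. by rewrite rho_S.
  - intros x Hx. apply rho_cont. lra.
  - intros x Hx. apply taylor_coef_cont. lra. }
assert (HM : forall M, is_Cseries (defect (rho w h (S M))) (zeta_reg (w + h) - P M)%C).
{ induction M as [|M IH].
  - unfold P. rewrite sum_O. by apply Step.
  - unfold P. rewrite sum_Sn. fold P.
    replace (zeta_reg (w + h) - _)%C with (zeta_reg (w + h) - P M - h ^ S M * zeta_reg_coef w (S M))%C.
    + by apply Step.
    + unfold plus; simpl. ring. }
unfold is_pseries. apply (is_series_ext_C (fun m => h ^ m * zeta_reg_coef w m)%C).
{ intros m. rewrite pow_n_Cpow. reflexivity. }
apply is_series_Clim. fold P.
apply (Clim_squeeze _ _ _ (fun M => (1 / 2) ^ S M * (4 * (Cmod w + d) / d))).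
- apply filter_forall. intros M.
  destruct (rho_defect_series w h d (S M)) as [l [Hl Hb]] => //.
  rewrite (is_series_unique_C _ _ _ Hl (HM M)) in Hb.
  replace (P M - zeta_reg (w + h))%C with (- (zeta_reg (w + h) - P M))%C by ring.
  by rewrite Cmod_opp.
- apply (Rlim_eq _ _ (0 * (4 * (Cmod w + d) / d))); first by ring.
  apply: Rlim_mult; last by apply: filterlim_const.
  apply (filterlim_comp nat nat R S (fun M => (1 / 2) ^ M) eventually eventually).
  + apply eventually_shift. intros; lia.
  + apply (is_lim_seq_geom (1 / 2)). rewrite Rabs_pos_eq; lra.
Qed.

Ltac as_C := match goal with |- ?a = ?b => change (@eq C a b) end.

(** The pole [1 / (k - 1)] is the integral of [x^(-k)] over [1, oo) when
    [1 < Re k]. *)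
Definition zeta0 (k : C) : C := (zeta_reg k + 1 / (k - 1))%C.

Lemma locally_Cmod (w : C) (r : R) : 0 < r -> Clocally w (fun z => Cmod (z - w) < r).
Proof.
intros Hr.
assert (H : Clim (Clocally w) (fun z => z - w)%C (w - w)%C).
{ apply: Clim_minus; [apply Clim_id|apply: Clim_const]. }
apply Clim_Cmod in H; last exact _. replace (w - w)%C with (RtoC 0) in H by ring. rewrite Cmod_0 in H.
exact (H (fun x => x < r) (open_lt r 0 Hr)).
Qed.

Lemma pole_taylor (u h : C) : u <> 0 -> 2 * Cmod h <= Cmod u ->
  is_pseries (K := C_AbsRing) (V := C_NormedModule) (fun m => / u * (- / u) ^ m)%C h (1 / (u + h))%C.
Proof.
intros Hu Hh. pose proof (proj1 (Cmod_gt_0 u) Hu) as Pu.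
set (q := (h * - / u)%C).
assert (Hq : Cmod q <= 1 / 2).
{ unfold q. rewrite Cmod_mult Cmod_opp Cmod_inv //. apply Rle_div_l => //. lra. }
assert (H1 : (1 - q)%C <> 0).
{ intros E. apply (f_equal Cmod) in E. rewrite Cmod_0 in E.
  assert (K : Cmod 1 <= Cmod (1 - q) + Cmod q).
  { replace (RtoC 1) with ((1 - q) + q)%C at 1 by ring. apply Cmod_triangle. }
  rewrite Cmod_1 in K. lra. }
assert (H2 : (u + h)%C <> 0).
{ replace (u + h)%C with (u * (1 - q))%C by (unfold q; field; done). by apply Cmult_neq_0. }
unfold is_pseries. apply (is_series_ext_C (fun m => / u * q ^ m)%C).
{ intros m. rewrite pow_n_Cpow. unfold scal; simpl. unfold mult; simpl. unfold q. rewrite Cpow_mult_l. ring. }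
apply is_series_Clim.
assert (ES : forall M, Csum (fun m => / u * q ^ m)%C M =
  (/ u * ((1 - q ^ S M) / (1 - q)))%C).
{ induction M as [|M IH].
  - rewrite sum_O. simpl Cpow. as_C. field. done.
  - rewrite sum_Sn IH. unfold plus. simpl. as_C. field. done. }
apply (Clim_ext_loc _ (fun M => / u * ((1 - q ^ S M) / (1 - q)))%C).
{ apply filter_forall. intros M. by rewrite ES. }
apply (Clim_eq _ _ (/ u * ((1 - 0) / (1 - q)))%C).
{ assert (E : (u * (1 - q))%C = (u + h)%C) by (unfold q; field; done).
  rewrite -E. field. done. }
apply: Clim_mult; first by apply: Clim_const.
apply: Clim_mult; last by apply: Clim_const.
apply: Clim_minus; first by apply: Clim_const.
apply (Clim_squeeze _ _ _ (fun M => (1 / 2) ^ S M)).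
- apply filter_forall. intros M.
  replace (q ^ S M - 0)%C with (q ^ S M)%C by ring. rewrite Cmod_pow.
  apply pow_incr. split => //. apply Cmod_ge_0.
- apply (filterlim_comp nat nat R S (fun M => (1 / 2) ^ M) eventually eventually).
  + apply eventually_shift. intros; lia.
  + apply (is_lim_seq_geom (1 / 2)). rewrite Rabs_pos_eq; lra.
Qed.

Lemma zeta0_analytic (w : C) : 0 < Re w -> w <> 1 -> analytic_at zeta0 w.
Proof.
intros Hw H1. set (u := (w - 1)%C).
assert (Hu : u <> 0) by (intros E; apply H1; by apply Csub_eq).
pose proof (proj1 (Cmod_gt_0 u) Hu) as Pu.
exists (fun m => zeta_reg_coef w m + / u * (- / u) ^ m)%C.
assert (L1 := locally_Cmod w (Re w / 8) ltac:(lra)).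
assert (L2 := locally_Cmod w (Cmod u / 2) ltac:(lra)).
apply: filter_imp (filter_and _ _ L1 L2). intros z [Hz1 Hz2].
set (h := (z - w)%C) in *.
assert (A := zeta_reg_taylor w h Hw ltac:(lra)).
assert (B := pole_taylor u h Hu ltac:(lra)).
replace (zeta0 z) with (zeta_reg (w + h) + 1 / (u + h))%C.
- apply: is_series_ext_C (is_series_plus (V := C_NormedModule) _ _ _ _ A B).
  intros m. unfold scal, plus; simpl. unfold mult; simpl. ring.
- unfold zeta0, h, u. f_equal; f_equal; ring.
Qed.

Lemma Cmod_neg_pow (k : C) (x : R) : 0 < x -> Cmod (Cpower (RtoC x) (- k)) = exp (- Re k * ln x).
Proof. intros Hx. rewrite Cmod_Cpower_R //. Qed.

Lemma neg_pow_cont (k : C) (x : R) : 0 < x ->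
  Clim (locally x) (fun x => Cpower (RtoC x) (- k)) (Cpower (RtoC x) (- k)).
Proof. intros Hx. apply: is_Cderive_Clim. by apply is_Cderive_Cpower_R. Qed.

Lemma node_int (k : C) (n : nat) : k <> 1 ->
  Cint (fun x => Cpower (RtoC x) (- k)) (node n) (node n + 1) =
  ((Cpower (RtoC (node n)) (1 - k) - Cpower (RtoC (node (S n))) (1 - k)) / (k - 1))%C.
Proof.
intros Hk. pose proof (node_ge_1 n) as Hn.
assert (Hk' : (k - 1)%C <> 0) by (intros E; apply Hk; by apply Csub_eq).
rewrite (Cint_FTC (fun x => Cpower (RtoC x) (1 - k) * (- / (k - 1)))%C).
- rewrite node_S. field. done.
- lra.
- intros x Hx. eapply is_Cderive_eq.
  + apply: is_Cderive_mult; [apply is_Cderive_Cpower_R; lra|apply: is_Cderive_const].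
  + cbv beta. replace (1 - k - 1)%C with (- k)%C by ring. field. done.
- intros x Hx. apply neg_pow_cont. lra.
Qed.

Lemma zeta_partial_sum (k : C) (N : nat) : k <> 1 ->
  Csum (zeta_term k) N =
  (Csum (defect (fun x => Cpower (RtoC x) (- k))) N +
   (1 - Cpower (RtoC (node (S N))) (1 - k)) / (k - 1))%C.
Proof.
intros Hk.
assert (Hk' : (k - 1)%C <> 0) by (intros E; apply Hk; by apply Csub_eq).
assert (E : forall n, zeta_term k n = (defect (fun x => Cpower (RtoC x) (- k)) n +
  (Cpower (RtoC (node n)) (1 - k) - Cpower (RtoC (node (S n))) (1 - k)) / (k - 1))%C).
{ intros n. unfold defect. rewrite node_int // Cpower_opp. unfold zeta_term. fold (node n).
  pose proof (Cpower_neq_0 (RtoC (node n)) k). field. done. }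
induction N as [|N IH].
- rewrite !sum_O E. f_equal. f_equal. f_equal.
  change (node 0) with 1. by rewrite Cpower_base_1.
- rewrite !sum_Sn IH E. unfold plus. simpl. as_C. field. done.
Qed.

Lemma zeta0_series (k : C) : 1 < Re k -> is_Cseries (zeta_term k) (zeta0 k).
Proof.
intros Hk.
assert (Hk1 : k <> 1) by (intros E; rewrite E in Hk; simpl in Hk; lra).
apply is_series_Clim.
apply (Clim_ext_loc _ (fun N => Csum (defect (fun x => Cpower (RtoC x) (- k))) N +
   (1 - Cpower (RtoC (node (S N))) (1 - k)) / (k - 1))%C).
{ apply filter_forall. intros N. by rewrite zeta_partial_sum. }
unfold zeta0. apply: Clim_plus.
- apply is_series_Clim. apply zeta_reg_series. lra.
- apply (Clim_eq _ _ ((1 - 0) / (k - 1))%C); first by unfold Cdiv; ring.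
  apply: Clim_mult; last by apply: Clim_const.
  apply: Clim_minus; first by apply: Clim_const.
  apply (Clim_squeeze _ _ _ (fun N => exp (- (Re k - 1) * ln (node (S N))))).
  + apply filter_forall. intros N. pose proof (node_ge_1 (S N)).
    replace (Cpower (RtoC (node (S N))) (1 - k) - 0)%C with (Cpower (RtoC (node (S N))) (1 - k)) by ring.
    rewrite Cmod_Cpower_R; last lra. apply Req_le. f_equal. f_equal.
    destruct k as [a b]. unfold Re; simpl. ring.
  + apply (filterlim_comp nat nat R S (fun N => exp (- (Re k - 1) * ln (node N))) eventually eventually).
    * apply eventually_shift. intros; lia.
    * apply lim_node_pow. lra.
Qed.

Lemma node_even (n : nat) : node (S (2 * n)) = 2 * node n.
Proof. unfold node. rewrite !S_INR mult_INR. simpl. ring. Qed.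

Lemma sign_even (n : nat) : (-1) ^ (2 * n) = 1.
Proof. apply pow_1_even. Qed.

(** The terms [j^(-k)] with [j] even have the wrong sign; removing each of them
    twice leaves [2^(1-k)] times a partial sum of zeta. *)
Lemma eta_partial_sum (k : C) (N : nat) :
  Csum (eta_term k) (S (2 * N)) =
  (Csum (zeta_term k) (S (2 * N)) -
   Cpower (RtoC 2) (1 - k) * Csum (zeta_term k) N)%C.
Proof.
assert (E0 : forall n, eta_term k (2 * n) = zeta_term k (2 * n)).
{ intros n. unfold eta_term, zeta_term. by rewrite sign_even. }
assert (E1 : forall n, eta_term k (S (2 * n)) = (zeta_term k (S (2 * n)) - Cpower (RtoC 2) (1 - k) * zeta_term k n)%C).
{ intros n. unfold eta_term, zeta_term. rewrite -tech_pow_Rmult sign_even.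
  fold (node n) (node (S (2 * n))). rewrite node_even.
  pose proof (node_ge_1 n). rewrite (RtoC_mult 2 (node n)) Cpower_scal; [|lra|apply RtoC_neq_0; lra].
  rewrite Cpower_minus Cpower_1; last by apply RtoC_neq_0; lra.
  pose proof (Cpower_neq_0 (RtoC 2) k). pose proof (Cpower_neq_0 (RtoC (node n)) k).
  replace (RtoC (-1 * 1)) with (- RtoC 1)%C by (rewrite -RtoC_opp; f_equal; ring). field. done. }
induction N as [|N IH].
- change (2 * 0)%nat with 0%nat. rewrite !sum_Sn !sum_O.
  rewrite (E0 0%nat) (E1 0%nat). unfold plus; simpl. as_C. ring.
- replace (S (2 * S N)) with (S (S (S (2 * N)))) by lia.
  rewrite (sum_Sn _ (S (S (2 * N)))) (sum_Sn _ (S (2 * N))) IH.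
  rewrite (sum_Sn (zeta_term k) (S (S (2 * N)))) (sum_Sn (zeta_term k) (S (2 * N))) (sum_Sn (zeta_term k) N).
  replace (S (S (2 * N))) with (2 * S N)%nat by lia.
  rewrite (E0 (S N)) (E1 (S N)). unfold plus. as_C. cbn -[Cpower INR]. ring.
Qed.

Lemma node_int_lim (k : C) : 0 < Re k ->
  Clim eventually (fun n => Cint (fun x => Cpower (RtoC x) (- k)) (node n) (node n + 1)) 0.
Proof.
intros Hk. apply (Clim_squeeze _ _ _ (fun n => 2 * exp (- Re k * ln (node n)))).
- apply filter_forall. intros n. pose proof (node_ge_1 n).
  set (J := Cint _ _ _). replace (J - 0)%C with J by ring. unfold J.
  replace (2 * exp (- Re k * ln (node n))) with (2 * ((node n + 1 - node n) * exp (- Re k * ln (node n)))) by ring.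
  apply Cmod_Cint_le; first lra.
  + intros x Hx. apply neg_pow_cont. lra.
  + intros x Hx. rewrite Cmod_neg_pow; last lra. apply exp_le_compat.
    assert (ln (node n) <= ln x) by (apply ln_le; lra). nra.
- apply (Rlim_eq _ _ (2 * 0)); first by ring.
  apply (Rlim_mult eventually (fun _ => 2)); first by apply filterlim_const. by apply lim_node_pow.
Qed.

(** In [H(2N+2) - 2^(1-k) H(N+1)], with [H] the partial sums of zeta, the
    integrals of [x^(-k)] leave the constant [(1 - 2^(1-k)) / (k - 1)] and one
    integral over an interval of length [1] near [2N], which tends to zero. *)
Lemma eta_zeta0 (k l : C) : 0 < Re k -> k <> 1 -> is_Cseries (eta_term k) l ->
  l = ((1 - Cpower (RtoC 2) (1 - k)) * zeta0 k)%C.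
Proof.
intros Hk Hk1 Hl.
assert (Hk' : (k - 1)%C <> 0) by (intros E; apply Hk1; by apply Csub_eq).
set (f := fun x => Cpower (RtoC x) (- k)). set (c := Cpower (RtoC 2) (1 - k)).
set (S2 := fun N : nat => S (2 * N)).
assert (LS : filterlim S2 eventually eventually) by (apply eventually_shift; unfold S2; intros; lia).
assert (LSS : filterlim (fun N => S (S2 N)) eventually eventually) by (apply eventually_shift; unfold S2; intros; lia).
apply (Clim_unique eventually (fun N => Csum (eta_term k) (S2 N))).
- apply: Clim_comp; [exact LS|]. by apply is_series_Clim.
- pose proof (proj1 (is_series_Clim _ _) (zeta_reg_series k Hk)) as HD. fold f in HD.
  apply (Clim_ext_loc _ (fun N => Csum (defect f) (S2 N) -
    c * Csum (defect f) N +
    ((1 - c) / (k - 1) - Cint f (node (S (S2 N))) (node (S (S2 N)) + 1)))%C).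
  + apply filter_forall. intros N. change (Csum (eta_term k) (S2 N)) with
      (Csum (eta_term k) (S (2 * N))).
    rewrite eta_partial_sum !zeta_partial_sum // node_int //. fold f c (S2 N).
    assert (E : Cpower (RtoC (node (S (S (S2 N))))) (1 - k) = (c * Cpower (RtoC (node (S N))) (1 - k))%C).
    { unfold c. pose proof (node_ge_1 (S N)).
      rewrite -Cpower_scal; [|lra|apply RtoC_neq_0; lra].
      rewrite -RtoC_mult -node_even. do 3 f_equal. unfold S2. lia. }
    rewrite E. field. done.
  + apply (Clim_eq _ _ (zeta_reg k - c * zeta_reg k + ((1 - c) / (k - 1) - 0))%C).
    { unfold zeta0. field. done. }
    apply: Clim_plus; apply: Clim_minus.
    * exact (Clim_comp _ _ _ _ _ LS HD).
    * apply: Clim_mult => //. apply: Clim_const.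
    * apply: Clim_const.
    * exact (Clim_comp _ _ _ _ _ LSS (node_int_lim k Hk)).
Qed.

(** * Uniqueness of the continuation *)

(** A power series vanishing on a left neighbourhood of [0] has its constant
    term zero by continuity, and the series divided by the variable inherits
    the hypotheses. *)
Lemma pseries_one_sided (e : R) : 0 < e -> forall (n : nat) (a : nat -> R),
  (forall x, Rabs x < e -> ex_pseries a x) -> (forall x, - e < x < 0 -> PSeries a x = 0) -> a n = 0.
Proof.
intros He.
assert (K : forall a, (forall x, Rabs x < e -> ex_pseries a x) ->
  (forall x, - e < x < 0 -> PSeries a x = 0) -> a 0%nat = 0).
{ intros a Hex H0.
  assert (Hc : continuity_pt (PSeries a) 0).
  { apply PSeries_continuity. rewrite Rabs_R0.
    apply Rbar_lt_le_trans with (Finite (Rabs (e / 2))); first by simpl; rewrite Rabs_pos_eq; lra.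
    apply Rbar_not_lt_le. intros Hlt. apply (CV_disk_outside _ _ Hlt).
    apply: is_lim_seq_ext; last first.
    - apply (ex_series_lim_0 (fun k => scal (pow_n (e / 2) k) (a k))).
      apply Hex. rewrite Rabs_pos_eq; lra.
    - intros n. unfold scal; simpl. unfold mult; simpl. rewrite pow_n_pow. ring. }
  rewrite -PSeries_0.
  apply continuity_pt_filterlim in Hc.
  apply (filterlim_locally_unique (F := at_left 0) (V := R_NormedModule) (PSeries a)).
  - apply: filterlim_filter_le_1 Hc. apply filter_le_within.
  - apply (filterlim_ext_loc (fun _ => 0)); last by apply filterlim_const.
    exists (mkposreal e He). intros y Hy Hy'. symmetry. apply H0.
    ball_simpl_all.
    apply Rabs_def2 in Hy. lra. }
induction n as [|n IH]; intros a Hex H0; first by apply K.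
change (a (S n)) with (PS_decr_1 a n).
assert (Hinv : forall x : R, x = zero \/ (exists y : R, mult y x = one)).
{ intros x. destruct (Req_dec x 0) as [->|Hx]; [by left|right]. exists (/ x).
  unfold mult, one; simpl. by rewrite Rinv_l. }
apply IH.
- intros x Hx. apply ex_pseries_decr_1 => //. by apply Hex.
- intros x Hx. assert (Hx' : Rabs x < e) by (apply Rabs_def1; lra).
  pose proof (PSeries_decr_1 a x (Hex x Hx')) as E. rewrite H0 // K // in E. nra.
Qed.

Lemma is_series_components (a : nat -> C) (l : C) : is_Cseries a l ->
  is_series (fun n => Re (a n)) (Re l) /\ is_series (fun n => Im (a n)) (Im l).
Proof.
intros H. apply is_series_Clim in H. destruct H as [A B].
assert (E : forall N, Re (Csum a N) = sum_n (fun n => Re (a n)) N /\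
  Im (Csum a N) = sum_n (fun n => Im (a n)) N).
{ induction N as [|N [IH1 IH2]].
  - by rewrite !sum_O.
  - rewrite !sum_Sn -IH1 -IH2. by split. }
split.
- apply: filterlim_ext A. intros N. apply E.
- apply: filterlim_ext B. intros N. apply E.
Qed.

Lemma pseries_zero_one_sided (d : nat -> C) (f : R -> C) (e : R) : 0 < e ->
  (forall x, Rabs x < e -> is_Cseries (fun n => RtoC (x ^ n) * d n)%C (f x)) ->
  (forall x, - e < x < 0 -> f x = 0) -> forall x, Rabs x < e -> f x = 0.
Proof.
intros He Hf H0.
assert (K : forall (a : nat -> R) (g : R -> R), (forall x, Rabs x < e -> is_pseries a x (g x)) ->
  (forall x, - e < x < 0 -> g x = 0) -> forall x, Rabs x < e -> g x = 0).
{ intros a g Hg Hg0 x Hx.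
  assert (Ha : forall n, a n = 0).
  { intros n. apply (pseries_one_sided e He n).
    - intros y Hy. eexists. by apply Hg.
    - intros y Hy. rewrite -(Hg0 y Hy). apply is_pseries_unique. apply Hg. apply Rabs_def1; lra. }
  rewrite -(is_pseries_unique _ _ _ (Hg x Hx)).
  rewrite (PSeries_ext _ (fun _ => 0)) //. by apply PSeries_const_0. }
intros x Hx. apply injective_projections.
- apply (K (fun n => Re (d n)) (fun x => Re (f x))) => //.
  + intros y Hy. destruct (is_series_components _ _ (Hf y Hy)) as [A _].
    apply: is_series_ext A. intros n. destruct (d n). unfold scal, Re; simpl. unfold mult; simpl.
    rewrite pow_n_pow. ring.
  + intros y Hy. by rewrite H0.
- apply (K (fun n => Im (d n)) (fun x => Im (f x))) => //.
  + intros y Hy. destruct (is_series_components _ _ (Hf y Hy)) as [_ A].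
    apply: is_series_ext A. intros n. destruct (d n). unfold scal, Im; simpl. unfold mult; simpl.
    rewrite pow_n_pow. ring.
  + intros y Hy. by rewrite H0.
Qed.

(** The difference is a power series in the real parameter along the line of
    direction [v], and it vanishes on one side of [w]. *)
Lemma analytic_continue (Y Z : C -> C) (w v : C) (e0 : R) : analytic_at Y w -> analytic_at Z w -> 0 < e0 ->
  (forall x, - e0 < x < 0 -> Y (w + RtoC x * v)%C = Z (w + RtoC x * v)%C) ->
  exists e, 0 < e /\ forall x, Rabs x < e -> Y (w + RtoC x * v)%C = Z (w + RtoC x * v)%C.
Proof.
intros [a Ha] [b Hb] He0 H.
assert (L : filterlim (fun x : R => w + RtoC x * v)%C (locally 0) (Clocally w)).
{ apply Clim_filterlim; first exact _. apply (Clim_eq _ _ (w + RtoC 0 * v)%C); first by ring.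
  apply: Clim_plus; first by apply: Clim_const. apply: Clim_mult; last by apply: Clim_const.
  apply: Clim_RtoC. apply: filterlim_id. }
destruct (L _ (filter_and _ _ Ha Hb)) as [e1 He1].
set (e := Rmin e0 e1). assert (He : 0 < e) by (apply Rmin_glb_lt => //; apply cond_pos).
exists e. split => //. intros x Hx. apply Csub_eq.
apply (pseries_zero_one_sided (fun m => v ^ m * (a m - b m))%C
  (fun x => Y (w + RtoC x * v) - Z (w + RtoC x * v))%C e He) => //.
- intros y Hy.
  assert (By : ball 0 e1 y).
  { ball_simpl. rewrite Ropp_0 Rplus_0_r.
    eapply Rlt_le_trans; [exact Hy|apply Rmin_r]. }
  destruct (He1 y By) as [A B].
  replace (w + RtoC y * v - w)%C with (RtoC y * v)%C in A, B by ring.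
  apply: is_series_ext_C (is_series_minus (V := C_NormedModule) _ _ _ _ A B).
  intros m. rewrite !pow_n_Cpow Cpow_mult_l RtoC_pow. unfold scal, minus, plus, opp; simpl. unfold mult; simpl. ring.
- intros y Hy. rewrite H; first by ring. pose proof (Rmin_l e0 e1). fold e in H0. lra.
Qed.

(** The supremum of the parameters up to which the two functions agree is
    reached and, by [analytic_continue], cannot be smaller than [1]. *)
Lemma analytic_segment (Y Z : C -> C) (p v : C) (t0 : R) : 0 < t0 <= 1 ->
  (forall t, 0 <= t <= 1 -> analytic_at Y (p + RtoC t * v)%C /\ analytic_at Z (p + RtoC t * v)%C) ->
  (forall t, 0 <= t <= t0 -> Y (p + RtoC t * v)%C = Z (p + RtoC t * v)%C) ->
  Y (p + v)%C = Z (p + v)%C.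
Proof.
intros Ht0 Han Hs.
set (E := fun t => 0 <= t <= 1 /\ forall s, 0 <= s <= t -> Y (p + RtoC s * v)%C = Z (p + RtoC s * v)%C).
destruct (completeness E) as [T [HT1 HT2]].
- exists 1. intros t [Ht _]. lra.
- exists t0. split; [lra|done].
- assert (HTt0 : t0 <= T) by (apply HT1; split; [lra|done]).
  assert (HT : T <= 1) by (apply HT2; intros t [Ht _]; lra).
  assert (Hlt : forall s, 0 <= s < T -> Y (p + RtoC s * v)%C = Z (p + RtoC s * v)%C).
  { intros s Hs'. destruct (Ceq_dec (Y (p + RtoC s * v)%C) (Z (p + RtoC s * v)%C)) as [|Hn] => //. exfalso.
    assert (T <= s); last lra. apply HT2. intros t [Ht Ht'].
    apply Rnot_lt_le. intros Hst. apply Hn. apply Ht'. lra. }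
  destruct (Han T ltac:(lra)) as [A B].
  destruct (analytic_continue Y Z _ v T A B) as [e [He K]]; first lra.
  { intros x Hx. replace (p + RtoC T * v + RtoC x * v)%C with (p + RtoC (T + x) * v)%C by (rewrite RtoC_plus; ring).
    apply Hlt. lra. }
  assert (K' : forall s, 0 <= s < T + e -> Y (p + RtoC s * v)%C = Z (p + RtoC s * v)%C).
  { intros s Hs'. destruct (Rlt_le_dec s T) as [h|h]; first (apply Hlt; lra).
    replace (p + RtoC s * v)%C with (p + RtoC T * v + RtoC (s - T) * v)%C by (rewrite RtoC_minus; ring).
    apply K. rewrite Rabs_pos_eq; lra. }
  assert (HT' : T = 1).
  { apply Rle_antisym => //. apply Rnot_lt_le. intros h.
    assert (E (Rmin 1 (T + e / 2))).
    { split.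
      - split; [apply Rmin_glb; lra|apply Rmin_l].
      - intros s Hs'. apply K'. pose proof (Rmin_r 1 (T + e / 2)). lra. }
    pose proof (HT1 _ H) as Hm. unfold Rmin in Hm. destruct Rle_dec; lra. }
  replace (p + v)%C with (p + RtoC 1 * v)%C by ring. apply K'. lra.
Qed.

(** Every point of the half-plane other than [1] is the end of a segment that
    starts in [1 < Re k] and avoids [1]. *)
Lemma continuation_unique (Y Z : C -> C) : is_zeta_continuation Y -> is_zeta_continuation Z ->
  forall k, 0 < Re k -> k <> 1 -> Y k = Z k.
Proof.
intros [Y1 Y2] [Z1 Z2] k Hk Hk1.
assert (Hbig : forall z, 1 < Re z -> Y z = Z z).
{ intros z Hz. exact (is_series_unique_C _ _ _ (Y2 z Hz) (Z2 z Hz)). }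
destruct (Rlt_le_dec 1 (Re k)) as [Hk2|Hk2]; first by apply Hbig.
(* The segment starts on the same side of the real axis as [k], so it misses
   the pole; its first quarter lies in [1 < Re k]. *)
set (i0 := match Rle_dec 0 (Im k) with left _ => 1 | right _ => -1 end).
set (p := (2, i0) : C). set (v := (k - p)%C).
replace k with (p + v)%C by (unfold v; ring).
unfold Re in Hk, Hk2.
apply (analytic_segment Y Z p v (1 / 4)); first lra.
- intros t Ht.
  assert (D : 0 < Re (p + RtoC t * v)%C /\ (p + RtoC t * v)%C <> 1).
  { split.
    - unfold v, p, Re; simpl. nra.
    - intros E. pose proof (f_equal snd E) as E2. simpl in E2.
      assert (t = 1).
      { unfold i0, Im in E2. simpl in E2. destruct (Rle_dec 0 (snd k)); nra. }
      subst t. apply Hk1. rewrite -E. unfold v. ring. }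
  split; [apply Y1|apply Z1]; apply D.
- intros t Ht. apply Hbig. unfold v, p, Re; simpl. nra.
Qed.

Local Open Scope C_scope.

Theorem mainTheorem2 :
  (forall k : C, (0 < Re k)%R ->
     ex_series (V := C_NormedModule) (eta_term k) /\
     ex_RInt_gen (V := C_R_NormedModule) (eta_integrand k)
       (at_right 0) (at_left 1) /\
     eta k =
       Cpower (Ci * RtoC PI) k / (2 * CGamma (k + 1))
       + Cpower (Ci * RtoC PI) (k - 1) * (1 + Clog (- Ci * RtoC PI)) / CGamma k
       + Cpower (Ci * RtoC PI) k / (2 * CGamma k)
         * RInt_gen (V := C_R_CompleteNormedModule) (eta_integrand k)
             (at_right 0) (at_left 1)) /\
  (exists Z : C -> C, is_zeta_continuation Z) /\
  (forall Z : C -> C, is_zeta_continuation Z ->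
     forall k : C, (0 < Re k)%R -> Cpower 2 (1 - k) <> 1 ->
       Z k = eta k / (1 - Cpower 2 (1 - k))).
Proof.
assert (HZ : is_zeta_continuation zeta0).
{ split; [exact zeta0_analytic | exact zeta0_series]. }
split; [exact eta_formula|]. split; [by exists zeta0|].
intros Z H k Hk H2.
assert (Hk1 : k <> 1).
{ intros E. apply H2. rewrite E. replace (RtoC 1 - RtoC 1) with (RtoC 0) by ring.
  unfold Cpower. rewrite Cmult_0_l. apply Cexp_0. }
rewrite (continuation_unique Z zeta0 H HZ k Hk Hk1).
destruct (eta_formula k Hk) as [[l Hl] _].
rewrite (eta_unique k l Hl) (eta_zeta0 k l Hk Hk1 Hl).
field. intros E. apply H2. symmetry. by apply Csub_eq.
Qed.
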